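(* Let $T\ge 2$, let $\mu_1,\dots,\mu_T\in\mathcal P(\mathbb R)$ have finite first moments, and let $f\in C_{\rm lin}(\mathbb R^T)$. Assume $\mathcal M_{\rm hom}(\mu_1,\dots,\mu_T)\neq\emptyset$ and that Assumption (A) holds, with measures $\theta^{s,t}$ as in (A). Then the supremum of $\mathbb E^{\mathbb Q}[f(S)]$ over $\mathbb Q\in\mathcal M_{\rm hom}(\mu_1,\dots,\mu_T)$ is attained, and $$\max_{\mathbb Q\in\mathcal M_{\rm hom}(\mu_1,\dots,\mu_T)}\mathbb E^{\mathbb Q}[f(S)]=\inf\Big\{\sum_{t=1}^T\int_{\mathbb R}h_t\,d\mu_t\Big\},$$ where the infimum is taken over all $h_t\in C_{\rm lin}(\mathbb R)$ ($t=1,\dots,T$), $\vartheta_t\in C_b(\mathbb R^t)$ ($t=1,\dots,T-1$) and $g_{s,t,\tau}\in C_b(\mathbb R^2)$ ($(s,t,\tau)\in\Delta$) such that for all $x=(x_1,\dots,x_T)\in\mathbb R^T$ $$f(x)\le\sum_{t=1}^T h_t(x_t)+\sum_{t=1}^{T-1}\vartheta_t(x_1,\dots,x_t)(x_{t+1}-x_t)+\sum_{(s,t,\tau)\in\Delta}\Big(g_{s,t,\tau}(x_s,x_{s+\tau})\frac{d\theta^{s,t}}{d\mu_s}(x_s)-g_{s,t,\tau}(x_t,x_{t+\tau})\frac{d\theta^{s,t}}{d\mu_t}(x_t)\Big).$$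
   Context: $S=(S_1,\dots,S_T)$ is the canonical process on $\mathbb R^T$ (with Borel $\sigma$-algebra), $S_t(\omega)=\omega_t$. $\mathcal P(\mathbb R^d)$ denotes Borel probability measures. $C_{\rm lin}(\mathbb R^d)$ is the set of continuous $f:\mathbb R^d\to\mathbb R$ with $|f(x)|/(1+|x|)$ bounded; $C_b(\mathbb R^d)$ the bounded continuous functions. For $\mathbb Q\in\mathcal P(\mathbb R^T)$ and a sub-tuple $I=(t_1,\dots,t_k)$ of $(1,\dots,T)$, $\mathbb Q_I$ is the law of $(S_{t_1},\dots,S_{t_k})$ under $\mathbb Q$, and $\mathbb Q_t:=\mathbb Q_{(t)}$. $\Pi(\mu_1,\dots,\mu_T)$ is the set of $\mathbb Q$ with $\mathbb Q_t=\mu_t$ for all $t$; $\mathcal M(\mu_1,\dots,\mu_T)$ is the set of $\mathbb Q\in\Pi(\mu_1,\dots,\mu_T)$ with $\mathbb E^{\mathbb Q}[S_{t+1}\mid S_1,\dots,S_t]=S_t$ for $t=1,\dots,T-1$. Let $\Delta=\{(s,t,\tau)\in\{1,\dots,T\}^3: s<t,\ t+\tau\le T\}$. For $\mu,\nu\in\mathcal P(\mathbb R)$, an event holds ''$\mu\wedge\nu$-a.s.'' if it holds almost surely with respect to $\mu^{\nu,\rm abs}$, the part of $\mu$ absolutely continuous w.r.t. $\nu$ in the Lebesgue decomposition $\mu=\mu^{\nu,\rm abs}+\mu^{\nu,\rm sing}$. For $\mathbb Q\in\mathcal P(\mathbb R^T)$ and $1\le s<s+\tau\le T$, let $K_{s,s+\tau}:\mathbb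 R\to\mathcal P(\mathbb R)$ be a stochastic kernel with $\mathbb Q_{(s,s+\tau)}=\mathbb Q_s\otimes K_{s,s+\tau}$. $\mathbb Q$ is called homogeneous if $K_{s,s+\tau}=K_{t,t+\tau}$ holds $\mathbb Q_s\wedge\mathbb Q_t$-a.s. for all $(s,t,\tau)\in\Delta$. $\mathcal P_{\rm hom}(\mathbb R^T)$ is the set of homogeneous measures, $\mathcal M_{\rm hom}(\mu_1,\dots,\mu_T):=\mathcal M(\mu_1,\dots,\mu_T)\cap\mathcal P_{\rm hom}(\mathbb R^T)$. Assumption (A): for all $(s,t)\in\{1,\dots,T\}^2$ there is a finite Borel measure $\theta^{s,t}$ on $\mathbb R$, equivalent to $\mu_t^{\mu_s,\rm abs}$, such that $\frac{d\theta^{s,t}}{d\mu_t}$ and $\frac{d\theta^{s,t}}{d\mu_s}$ have continuous bounded versions (these versions are used above). *)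

(* Defs.v *)
(* Conventions: time indices are 0-based,
   i.e. paper index t in {1,...,T} corresponds to t-1 in {0,...,T-1}. *)
From HB Require Import structures.
From mathcomp Require Import all_boot all_order all_algebra.
From mathcomp Require Import all_classical all_reals all_analysis.
Import numFieldNormedType.Exports.

Set Implicit Arguments.
Unset Strict Implicit.
Unset Printing Implicit Defensive.

Import Order.TTheory GRing.Theory Num.Theory.
Local Open Scope ring_scope.
Local Open Scope classical_set_scope.

Section Defs.
Context {R : realType}.

(* the canonical process: S_k(x) = x_k on R^T = T.-tuple R (product sigma-algebra
   generated by the coordinates, i.e. the Borel sigma-algebra of R^T) *)
Definition coord {T : nat} (x : T.-tuple R) (k : nat) : R := nth 0 x k.

Definition rowT {T : nat} (x : T.-tuple R) : 'rV[R]_T := \row_(i < T) tnth x i.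

Definition rowUpTo {T : nat} (t : nat) (x : T.-tuple R) : 'rV[R]_t.+1 :=
  \row_(i < t.+1) coord x i.

Definition Clin {V : normedModType R} (f : V -> R) : Prop :=
  continuous f /\ exists C : R, forall x, `|f x| <= C * (1 + `|x|).

Definition Cb {V : topologicalType} (f : V -> R) : Prop :=
  continuous f /\ exists M : R, forall x, `|f x| <= M.

Definition marginal {T : nat} (Q : probability (T.-tuple R) R) (t : nat)
  : set R -> \bar R := pushforward Q (fun x => coord x t).

Definition finite_first_moment (mu : probability R R) : Prop :=
  mu.-integrable setT (fun y => (y : R)%:E).

Definition in_Pi {T : nat} (mu : nat -> probability R R)
    (Q : probability (T.-tuple R) R) : Prop :=
  forall t, (t < T)%N -> forall A : set R, measurable A ->
    marginal Q t A = mu t A.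

Definition natural_filtration {T : nat} (t : nat) : set (set (T.-tuple R)) :=
  g_sigma_preimage (fun i : 'I_t.+1 => fun x : T.-tuple R => coord x i).

(* E^Q[S_{t+1} | S_0..S_t] = S_t for every t+1 < T, via the defining property
   of conditional expectation (with integrability of all S_t). *)
Definition is_martingale {T : nat} (Q : probability (T.-tuple R) R) : Prop :=
  (forall t, (t < T)%N -> Q.-integrable setT (fun x => (coord x t)%:E)) /\
  (forall t, (t.+1 < T)%N -> forall B, natural_filtration t B ->
     (\int[Q]_(x in B) (coord x t.+1)%:E = \int[Q]_(x in B) (coord x t)%:E)%E).

Definition in_M {T : nat} (mu : nat -> probability R R)
    (Q : probability (T.-tuple R) R) : Prop :=
  in_Pi mu Q /\ is_martingale Q.

Definition mut_singular (m1 m2 : set R -> \bar R) : Prop :=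
  exists N, measurable N /\ m2 N = 0%E /\ m1 (~` N) = 0%E.

Definition lebesgue_decomp (mu nu : set R -> \bar R)
    (ma ms : {measure set R -> \bar R}) : Prop :=
  (forall A, measurable A -> mu A = (ma A + ms A)%E) /\
  ma `<< nu /\ mut_singular ms nu.

(* P holds mu /\ nu - a.s., i.e. a.s. w.r.t. mu^{nu,abs} *)
Definition ae_wedge (mu nu : set R -> \bar R) (P : R -> Prop) : Prop :=
  forall ma ms, lebesgue_decomp mu nu ma ms -> {ae ma, forall x, P x}.

Definition inDelta (T s t tau : nat) : bool :=
  [&& (s < t)%N, (0 < tau)%N & (t + tau < T)%N].

Definition disintegrates {T : nat} (Q : probability (T.-tuple R) R)
    (s u : nat) (K : R.-pker R ~> R) : Prop :=
  forall A B : set R, measurable A -> measurable B ->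
    Q [set x | A (coord x s) /\ B (coord x u)] =
    (\int[Q]_(x in [set x | A (coord x s)]) K (coord x s) B)%E.

Definition homogeneous {T : nat} (Q : probability (T.-tuple R) R) : Prop :=
  exists K : nat -> nat -> R.-pker R ~> R,
    (forall s tau, (0 < tau)%N -> (s + tau < T)%N ->
       disintegrates Q s (s + tau) (K s (s + tau))) /\
    (forall s t tau, inDelta T s t tau ->
       ae_wedge (marginal Q s) (marginal Q t)
         (fun y => forall B, measurable B ->
             K s (s + tau) y B = K t (t + tau) y B)).

Definition in_Mhom {T : nat} (mu : nat -> probability R R)
    (Q : probability (T.-tuple R) R) : Prop :=
  in_M mu Q /\ homogeneous Q.

Definition assumptionA (T : nat) (mu : nat -> probability R R)
    (theta : nat -> nat -> {finite_measure set R -> \bar R})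
    (dth_s dth_t : nat -> nat -> R -> R) : Prop :=
  forall s t, (s < T)%N -> (t < T)%N ->
    (forall ma ms, lebesgue_decomp (mu t) (mu s) ma ms ->
       theta s t `<< ma /\ ma `<< theta s t) /\
    Cb (dth_t s t) /\ Cb (dth_s s t) /\
    (forall A, measurable A ->
       theta s t A = (\int[mu t]_(y in A) (dth_t s t y)%:E)%E) /\
    (forall A, measurable A ->
       theta s t A = (\int[mu s]_(y in A) (dth_s s t y)%:E)%E).

Definition dual_admissible (T : nat) (f : 'rV[R]_T -> R)
    (dth_s dth_t : nat -> nat -> R -> R)
    (h : nat -> R -> R) (vt : forall t : nat, 'rV[R]_t.+1 -> R)
    (g : nat -> nat -> nat -> R * R -> R) : Prop :=
  (forall t, (t < T)%N -> Clin (h t)) /\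
  (forall t, (t.+1 < T)%N -> Cb (vt t)) /\
  (forall s t tau, inDelta T s t tau -> Cb (g s t tau)) /\
  forall x : T.-tuple R,
    f (rowT x) <=
      \sum_(t < T) h t (coord x t)
    + \sum_(t < T.-1) vt t (rowUpTo t x) * (coord x t.+1 - coord x t)
    + \sum_(s < T) \sum_(t < T) \sum_(tau < T | inDelta T s t tau)
        (g s t tau (coord x s, coord x (s + tau)) * dth_s s t (coord x s)
         - g s t tau (coord x t, coord x (t + tau)) * dth_t s t (coord x t)).

Definition dual_value (T : nat) (mu : nat -> probability R R)
    (h : nat -> R -> R) : \bar R :=
  (\sum_(t < T) \int[mu t]_y (h t y)%:E)%E.

Definition primal_value {T : nat} (f : 'rV[R]_T -> R)
    (Q : probability (T.-tuple R) R) : \bar R :=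
  (\int[Q]_x (f (rowT x))%:E)%E.

End Defs.

(* Main.v *)
(* On the space of continuous functions of linear growth, the dual value [p] is
   sublinear, and it is finite by weak duality since a homogeneous martingale
   coupling exists. Hahn-Banach gives a linear [L <= p] with [L f = p f]. As
   nonpositive functions have dual value at most 0, [L] is positive; as [L] acts
   on functions of one coordinate by integration against [mu_t], it is tight, so
   a Daniell construction represents it by a probability [Q]. Every hedging
   instrument has dual value at most 0, as does its opposite, so [Q] integrates
   it to 0, which says that [Q] is a homogeneous martingale coupling. Hence
   [E^Q f = p f], and weak duality makes [Q] optimal: neither compactness of the
   set of couplings nor a minimax theorem is needed. *)
Require Import Defs.
From HB Require Import structures.
From mathcomp Require Import all_boot all_order all_algebra.
From mathcomp Require Import all_classical all_reals all_analysis.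
From mathcomp Require Import measurable_realfun ring lra.
Import numFieldNormedType.Exports.
Import Order.TTheory GRing.Theory Num.Theory.
Set Implicit Arguments.
Unset Strict Implicit.
Unset Printing Implicit Defensive.
Local Open Scope ring_scope.
Local Open Scope classical_set_scope.
(* [vector.coord] of MathComp shadows the canonical process. *)
Local Notation coord := Defs.coord.

(** * The Hahn-Banach theorem on a subspace *)

(** Homogeneity speaks of kernels up to null sets, whereas the instruments are continuous test
    functions. Assumption (A) links them: weighting the law of $(S_s,S_{s+\tau})$ by
    $d\theta^{s,t}/d\mu_s$ gives $\theta^{s,t}\otimes K_{s,s+\tau}$, and likewise at $t$. An
    instrument therefore integrates to the difference of the integrals of $g$ under two such
    measures, and this vanishes for all $g$ exactly when the kernels agree $\theta^{s,t}$-a.e. That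
    $\theta^{s,t}$ has the right null sets takes an argument, since (A) ties it to a part of $\mu_t$
    and homogeneity refers to a part of $\mu_s$. The Daniell step starts without any monotone
    continuity of $L$ and must reach unbounded functions. Tightness and a Dini argument replace the
    former, and only $\mathbb E^{\mathbb Q}[f]\le L f$ for $f\ge 0$ is obtained. Equality is
    recovered in two rounds, by applying this inequality to $H+\phi$ and $H-\phi$ with a dominating
    $H$ that is already integrated exactly: $H=1$ identifies the marginals, and then $H=\sum_t
    C(1+|x_t|)$ reaches all of $C_{\rm lin}$. *)

Section hahn_banach.
Context {R : realType} {V : lmodType R}.
Variable W : set V.
Hypothesis WD : forall u v, W u -> W v -> W (u + v).
Hypothesis WZ : forall c u, W u -> W (c *: u).

(** Positive homogeneity is asked only as an inequality, the form that passes easily to infima;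
    scaling by the inverse restores equality in [sublinear_onZ]. *)
Definition sublinear_on (q : V -> R) :=
  (forall u v, W u -> W v -> q (u + v) <= q u + q v) /\
  (forall c u, 0 < c -> W u -> q (c *: u) <= c * q u).

Lemma sublinear_onZ q c u : sublinear_on q -> 0 < c -> W u ->
  q (c *: u) = c * q u.
Proof.
move=> [_ qZ] c0 Wu; apply/eqP; rewrite eq_le qZ//=.
have := qZ c^-1 (c *: u); rewrite invr_gt0 c0 scalerA mulVf ?gt_eqF// scale1r.
by move=> /(_ isT (WZ _ Wu)); rewrite -ler_pdivlMl ?invr_gt0// invrK.
Qed.

Lemma sublinear_on0 q u : sublinear_on q -> W u -> q 0 = 0.
Proof.
move=> sq Wu; have W0 : W 0 by rewrite -(scale0r u); exact: WZ.
have := @sublinear_onZ q 2 0 sq (ltr0Sn _ _) W0; rewrite scaler0 => h.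
by apply/eqP; lra.
Qed.

Lemma sublinear_on_ge q u v : sublinear_on q -> W u -> W v ->
  q u - q (- v) <= q (u + v).
Proof.
move=> [qD _] Wu Wv; rewrite lerBlDr.
have WNv : W (- v) by rewrite -scaleN1r; exact: WZ.
have := qD (u + v) (- v) (WD Wu Wv) WNv.
by rewrite addrK.
Qed.

(** The infimum over $t\ge 0$ of $q(v+tw)-t\,q(w)$ is the classical sublinear functional below $q$
    whose value at $-w$ is at most $-q(w)$ (take $t=1$). A minimal $q$ cannot be lowered this way,
    hence is odd. *)
Definition shrink_set (q : V -> R) (w v : V) : set R :=
  [set r | exists2 t, 0 <= t & r = q (v + t *: w) - t * q w].

Definition shrink q w v := inf (shrink_set q w v).

Lemma shrink_has_inf q w v : sublinear_on q -> W w -> W v ->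
  has_inf (shrink_set q w v).
Proof.
move=> sq Ww Wv; split.
  by exists (q (v + 0 *: w) - 0 * q w); exists 0.
exists (- q (- v)) => _ [t t0 ->].
have -> : t * q w = q (t *: w).
  move: t0; rewrite le_eqVlt => /predU1P[<-|t0].
    by rewrite mul0r scale0r (sublinear_on0 sq Wv).
  by rewrite (sublinear_onZ sq).
have := sublinear_on_ge sq (WZ t Ww) Wv.
by rewrite [_ + v]addrC; lra.
Qed.

Lemma shrink_le q w v t : sublinear_on q -> W w -> W v -> 0 <= t ->
  shrink q w v <= q (v + t *: w) - t * q w.
Proof.
move=> sq Ww Wv t0; apply: ge_inf.
  by case: (shrink_has_inf sq Ww Wv).
by exists t.
Qed.

Lemma shrink_sublinear q w : sublinear_on q -> W w -> sublinear_on (shrink q w).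
Proof.
move=> sq Ww; split.
  move=> u v Wu Wv; rewrite -lerBlDr.
  apply: lb_le_inf; first by case: (shrink_has_inf sq Ww Wu).
  move=> _ [t t0 ->]; rewrite lerBlDl -lerBlDr.
  apply: lb_le_inf; first by case: (shrink_has_inf sq Ww Wv).
  move=> _ [s s0 ->].
  have := shrink_le sq Ww (WD Wu Wv) (addr_ge0 t0 s0).
  have -> : u + v + (t + s) *: w = (u + t *: w) + (v + s *: w).
    by rewrite scalerDl addrACA.
  have := sq.1 (u + t *: w) (v + s *: w) (WD Wu (WZ t Ww)) (WD Wv (WZ s Ww)).
  by lra.
move=> c u c0 Wu; rewrite mulrC -ler_pdivrMr//.
apply: lb_le_inf; first by case: (shrink_has_inf sq Ww Wu).
move=> _ [t t0 ->]; rewrite ler_pdivrMr//.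
have := shrink_le sq Ww (WZ c Wu) (mulr_ge0 (ltW c0) t0).
rewrite -scalerA -scalerDr (sublinear_onZ sq)//; first by lra.
exact/WD/WZ.
Qed.

Lemma shrink_le_self q w v : sublinear_on q -> W w -> W v -> shrink q w v <= q v.
Proof.
move=> sq Ww Wv; have := shrink_le sq Ww Wv (lexx 0).
by rewrite scale0r addr0 mul0r subr0.
Qed.

Lemma shrink_leN q w : sublinear_on q -> W w -> shrink q w (- w) <= - q w.
Proof.
move=> sq Ww; have WNw : W (- w) by rewrite -scaleN1r; exact: WZ.
have := shrink_le sq Ww WNw ler01.
by rewrite scale1r addNr (sublinear_on0 sq Ww) mul1r sub0r.
Qed.

(** Zorn's lemma for the reversed pointwise order. A chain is bounded by its pointwise infimum,
    which is finite because every sublinear $b\le p$ satisfies $b(v)\ge -p(-v)$, and subadditive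
    because of any two members of a chain the smaller one serves both summands. *)
Lemma minimal_sublinear p : sublinear_on p ->
  exists q, [/\ sublinear_on q, forall v, W v -> q v <= p v &
    forall q', sublinear_on q' -> (forall v, W v -> q' v <= q v) ->
      forall v, W v -> q v <= q' v].
Proof.
move=> sp.
pose P q := sublinear_on q /\ forall v, W v -> q v <= p v.
pose rel_ (q1 q2 : {q | P q}) := `[< forall v, W v -> sval q2 v <= sval q1 v >].
have Pp : P p by split.
have [| | |[q [sq qp]] qmin] := @ZL_preorder _ (exist P p Pp) rel_.
- by move=> t; apply/asboolP.
- move=> r s t /asboolP rs /asboolP st; apply/asboolP => v Wv.
  exact: le_trans (st _ Wv) (rs _ Wv).
- move=> A totA.
  have [A0|/set0P[a Aa]] := eqVneq A set0.
    by exists (exist P p Pp) => s; rewrite A0.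
  pose S v := [set sval b v | b in A].
  have Slb v : W v -> has_inf (S v).
    move=> Wv; split; first by exists (sval a v), a.
    exists (- p (- v)) => _ [[b [sb bp]] Ab <-] /=.
    have WNv : W (- v) by rewrite -scaleN1r; exact: WZ.
    have := sb.1 _ _ Wv WNv; rewrite subrr (sublinear_on0 sb Wv).
    by have := bp _ WNv; lra.
  have infS b v : A b -> W v -> inf (S v) <= sval b v.
    by move=> Ab Wv; apply: ge_inf; [exact: (Slb v Wv).2|exists b].
  have P0 : P (fun v => inf (S v)).
    split; last first.
      by move=> v Wv; rewrite (le_trans (infS a _ Aa Wv))//; exact: (svalP a).2.
    split.
      move=> u v Wu Wv; rewrite -lerBlDr.
      apply: lb_le_inf; first exact: (Slb u Wu).1.
      move=> _ [b Ab <-]; rewrite lerBlDl -lerBlDr.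
      apply: lb_le_inf; first exact: (Slb v Wv).1.
      move=> _ [c Ac <-]; rewrite lerBlDr.
      have [/asboolP bc|/asboolP cb] := totA _ _ Ab Ac.
        rewrite (le_trans (infS c _ Ac (WD Wu Wv)))//.
        rewrite (le_trans ((svalP c).1.1 _ _ Wu Wv))//.
        by rewrite addrC lerD2l bc.
      rewrite (le_trans (infS b _ Ab (WD Wu Wv)))//.
      rewrite (le_trans ((svalP b).1.1 _ _ Wu Wv))//.
      by rewrite addrC lerD2r cb.
    move=> c u c0 Wu; rewrite mulrC -ler_pdivrMr//.
    apply: lb_le_inf; first exact: (Slb u Wu).1.
    move=> _ [b Ab <-]; rewrite ler_pdivrMr// mulrC.
    rewrite (le_trans (infS b _ Ab (WZ c Wu)))//.
    exact: (svalP b).1.2.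
  by exists (exist P _ P0) => s As; apply/asboolP => v Wv; exact: infS.
exists q; split=> // q' sq' q'q v Wv.
have Pq' : P q' by split=> // u Wu; exact: le_trans (q'q _ Wu) (qp _ Wu).
by have /asboolP := qmin (exist P q' Pq') (asboolT q'q); exact.
Qed.

(* A minimal sublinear functional below [shrink p v0] is odd, hence linear, and
   [shrink] forces its value at [v0] to be at least [p v0]. *)
Theorem hahn_banach p v0 : sublinear_on p -> W v0 ->
  exists L : V -> R, [/\ forall u v, W u -> W v -> L (u + v) = L u + L v,
    forall c u, W u -> L (c *: u) = c * L u,
    forall v, W v -> L v <= p v & L v0 = p v0].
Proof.
move=> sp Wv0.
have [q [sq qp qmin]] := minimal_sublinear (shrink_sublinear sp Wv0).
have qN w : W w -> q (- w) = - q w.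
  move=> Ww; have WNw : W (- w) by rewrite -scaleN1r; exact: WZ.
  have := sq.1 _ _ Ww WNw; rewrite subrr (sublinear_on0 sq Ww).
  have := qmin _ (shrink_sublinear sq Ww)
    (fun v Wv => shrink_le_self sq Ww Wv) _ WNw.
  have := shrink_leN sq Ww => h1 h2 h3.
  by apply/eqP; rewrite eq_le; apply/andP; split; lra.
exists q; split.
- move=> u v Wu Wv; apply/eqP; rewrite eq_le sq.1//=.
  by have := sublinear_on_ge sq Wu Wv; rewrite qN// opprK.
- move=> c u Wu; have [c0|c0|->] := ltgtP c 0.
  + rewrite -[c]opprK scaleNr qN; last exact: WZ.
    by rewrite (sublinear_onZ sq) ?oppr_gt0// !mulNr.
  + by rewrite (sublinear_onZ sq).
  + by rewrite scale0r (sublinear_on0 sq Wu) mul0r.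
- move=> v Wv; rewrite (le_trans (qp _ Wv))//; exact: shrink_le_self.
- have WNv0 : W (- v0) by rewrite -scaleN1r; exact: WZ.
  apply/eqP; rewrite eq_le; apply/andP; split.
    by rewrite (le_trans (qp _ Wv0))//; exact: shrink_le_self.
  have := le_trans (qp _ WNv0) (shrink_leN sp Wv0).
  by rewrite qN// lerN2.
Qed.

End hahn_banach.

(** * Tests for equality of measures on tuples *)

Section measurability_continuous.
Context {R : realType}.

Lemma ball_rowP n (v w : 'rV[R]_n) (e : R) : 0 < e ->
  (forall i, `|v ord0 i - w ord0 i| < e) -> ball v e w.
Proof. by move=> e0 vw; split => // i j; rewrite ord1; exact: vw. Qed.

(** Tuples carry the product sigma-algebra and rows the topology. The countably many half-open grid
    cubes of side $1/(k+1)$ connect them: each is a finite intersection of coordinate conditions,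
    and an open set is the union of the cubes that it contains. *)
Let floor_cube n (kz : nat * {ffun 'I_n -> int}) : set (n.-tuple R) :=
  [set x | forall i, Num.floor (kz.1.+1%:R * tnth x i) = kz.2 i].

Let measurable_floor_cube n (kz : nat * {ffun 'I_n -> int}) :
  measurable (floor_cube kz).
Proof.
have -> : floor_cube kz = \bigcap_(i in [set: 'I_n])
    ((@tnth _ R)^~ i @^-1` `[(kz.2 i)%:~R / kz.1.+1%:R,
                             (kz.2 i + 1)%:~R / kz.1.+1%:R[).
  have h (r : R) i : (Num.floor (kz.1.+1%:R * r) == kz.2 i) =
      (r \in Interval (BLeft ((kz.2 i)%:~R / kz.1.+1%:R))
                      (BLeft ((kz.2 i + 1)%:~R / kz.1.+1%:R))).
    by rewrite floor_eq in_itv/= ler_pdivrMr// ltr_pdivlMr// ![r * _]mulrC.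
  apply/seteqP; split => x /= H i; first by move=> _ /=; rewrite -h H.
  by apply/eqP; rewrite h; exact: H.
apply: fin_bigcap_measurable => // i _.
rewrite -[X in measurable X]setTI.
exact: (measurable_tnth i).
Qed.

Lemma measurable_open_rowT n (f : 'rV[R]_n -> R) : continuous f ->
  measurable [set x : n.-tuple R | 0 < f (rowT x)].
Proof.
move=> cf; set U := [set x | _].
pose F kz : set (n.-tuple R) :=
  if `[< floor_cube kz `<=` U >] then floor_cube kz else set0.
have -> : U = \bigcup_kz F kz.
  apply/seteqP; split => [x Ux|x [kz _]]; last first.
    by rewrite /F; case: asboolP => // h /h.
  have /nbhs_ballP[e /= e0 he] : nbhs (rowT x) [set v | 0 < f v].
    by apply: (cf (rowT x) [set y | 0 < y]); exact: lt_nbhsr.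
  pose k := Num.trunc e^-1.
  have ke : k.+1%:R^-1 < e.
    by rewrite -[e]invrK ltf_pV2 ?posrE ?invr_gt0//; exact: truncnS_gt.
  exists (k, [ffun i => Num.floor (k.+1%:R * tnth x i)]) => //.
  rewrite /F; case: asboolP => [_ i|]; first by rewrite ffunE.
  case=> y yc; apply: he; apply: ball_rowP => // i.
  rewrite !mxE; apply: le_lt_trans ke.
  have := yc i; rewrite /= ffunE => yi.
  have /andP[x1 x2] := floor_itv (k.+1%:R * tnth x i).
  have /andP[y1 y2] := floor_itv (k.+1%:R * tnth y i).
  rewrite -(@ler_pM2l _ k.+1%:R)// mulfV// -[X in X * _]gtr0_norm//.
  rewrite -normrM mulrBr.
  move: x1 x2 y1 y2; rewrite yi !intrD => x1 x2 y1 y2.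
  by rewrite ler_norml; apply/andP; split; lra.
apply: countable_bigcupT_measurable => [|kz]; first exact: countableP.
by rewrite /F; case: asboolP => // _; exact: measurable_floor_cube.
Qed.

Lemma measurable_continuous_rowT n (f : 'rV[R]_n -> R) : continuous f ->
  measurable_fun setT (fun x : n.-tuple R => f (rowT x)).
Proof.
move=> cf; apply: (measurability _ (RGenOInfty.measurableE R)).
move=> _ [_ [a ->] <-]; rewrite setTI.
rewrite [X in measurable X](_ : _ = [set x | 0 < f (rowT x) - a]); last first.
  by apply/seteqP; split => x /=; rewrite in_itv/= andbT subr_gt0.
apply: (@measurable_open_rowT _ (fun v => f v - a)) => v.
exact: (cvgB (cf v) (cvg_cst a)).
Qed.

End measurability_continuous.

Section ramp.
Context {R : realType}.

(** For continuous $m$, the continuous functions [ramp (k * m)] increase with $k$ to the indicator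
    of $\{m>0\}$; this is how test functions reach sets. *)
Definition ramp (y : R) : R := Num.min 1 (Num.max 0 y).

Lemma ramp_ge0 y : 0 <= ramp y.
Proof. by rewrite /ramp le_min ler01/= le_max lexx. Qed.

Lemma ramp_le1 y : ramp y <= 1.
Proof. by rewrite /ramp ge_min lexx. Qed.

Lemma ramp0 y : y <= 0 -> ramp y = 0.
Proof. by move=> y0; rewrite /ramp (max_l y0) min_r. Qed.

Lemma ramp1 y : 1 <= y -> ramp y = 1.
Proof.
by move=> y1; rewrite /ramp max_r ?min_l// (le_trans _ y1).
Qed.

Lemma le_ramp : {homo ramp : x y / x <= y}.
Proof.
by move=> x y xy; rewrite /ramp le_min2// le_max2.
Qed.

Lemma continuous_ramp : continuous ramp.
Proof.
rewrite (_ : ramp = (fun=> 1) \min ((fun=> 0) \max id))//.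
apply: min_fun_continuous; first by move=> x; exact: cvg_cst.
by apply: max_fun_continuous; [move=> x; exact: cvg_cst|move=> x; exact: cvg_id].
Qed.

Lemma continuous_ramp_scale (V : topologicalType) (m : V -> R) (c : R) :
  continuous m -> continuous (fun v => ramp (c * m v)).
Proof.
move=> cm v; apply: (@continuous_cvg _ _ _ _ _ (fun v => c * m v) ramp).
  exact: continuous_ramp.
by apply: cvgM; [exact: cvg_cst|exact: cm].
Qed.

Lemma ramp_near1 (y : R) : 0 < y -> \forall k \near \oo, ramp (k%:R * y) = 1.
Proof.
move=> y0; near=> k; apply: ramp1; rewrite -ler_pdivrMr// div1r.
apply: ltW; near: k; exact: nbhs_infty_gtr.
Unshelve. all: by end_near. Qed.

Lemma cvg_ramp (y : R) :
  ramp (k%:R * y) @[k --> \oo] --> (if 0 < y then 1 else 0 : R).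
Proof.
case: ifPn => y0; last first.
  rewrite (_ : (fun k => _) = fun=> 0); first exact: cvg_cst.
  apply/funext => k; apply: ramp0; rewrite mulr_ge0_le0// leNgt//.
apply: cvg_near_cst; exact: ramp_near1.
Qed.

End ramp.

Section measure_eq_test.
Context {R : realType}.

Lemma cvg_integral_ramp d (X : measurableType d)
    (nu : {finite_measure set X -> \bar R}) (m : X -> R) :
  measurable_fun setT m ->
  (\int[nu]_x (ramp (k%:R * m x))%:E)%E @[k --> \oo] -->
    nu [set x | 0 < m x].
Proof.
move=> mm.
have mU : measurable [set x | 0 < m x].
  rewrite [X in measurable X](_ : _ = m @^-1` `]0, +oo[); last first.
    by apply/seteqP; split => x /=; rewrite in_itv/= andbT.
  by rewrite -[X in measurable X]setTI; exact: mm.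
rewrite -(setIT [set x | 0 < m x]) -(integral_indic nu measurableT mU).
apply: (@dominated_cvg _ _ _ _ _ _ _ _ (cst 1%E)) => //.
- move=> k; apply/measurable_EFinP.
  apply: (measurableT_comp (continuous_measurable_fun continuous_ramp)).
  by apply: measurable_funM.
- move=> x _ /=; apply: cvg_EFin; first by near=> k.
  rewrite indicE (_ : (x \in [set x0 | 0 < m x0]) = (0 < m x)); last first.
    by apply/idP/idP; rewrite inE.
  by have := @cvg_ramp R (m x); case: ifP.
- by apply/integrableP; split => //; rewrite integral_cst//= normr1 mul1e;
    rewrite -ge0_fin_numE//; exact: fin_num_measure.
- by move=> k x _ /=; rewrite lee_fin ger0_norm ?ramp_ge0// ramp_le1.
Unshelve. all: by end_near. Qed.

Definition cozero n : set (set (n.-tuple R)) :=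
  [set [set x | 0 < m (rowT x)] | m in [set m : 'rV[R]_n -> R | continuous m]].

(** One inclusion is the measurability of open sets; for the other, $\{x_i<a\}$ is the cozero set of
    $a-x_i$. *)
Lemma measurable_tupleE n : @measurable _ (n.-tuple R) = <<s @cozero n >>.
Proof.
apply/seteqP; split; last first.
  apply: smallest_sub; first exact: sigma_algebra_measurable.
  by move=> _ [m cm <-]; exact: measurable_open_rowT.
apply: smallest_sub; first exact: smallest_sigma_algebra.
case: n => [|n]; first by rewrite big_ord0.
rewrite -bigcup_mkord_ord; apply: bigcup_sub => i /= ni B [C mC <-].
have : measurable_fun (setT : set (g_sigma_algebraType (@cozero n.+1)))
    (fun x : n.+1.-tuple R => tnth x (inord i)).
  apply: (measurability _ (RGenInftyO.measurableE R)).
  move=> _ [_ [a ->] <-]; rewrite setTI; apply: sub_sigma_algebra.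
  exists (fun v => a - v ord0 (inord i)).
    move=> v.
    exact: (cvgB (cvg_cst a) (@coord_continuous _ _ _ ord0 (inord i) v)).
  by apply/seteqP; split => x /=; rewrite in_itv/= subr_gt0 mxE.
exact.
Qed.

(** Cozero sets generate the sigma-algebra and form a pi-system, since $\min(m_1,m_2)>0$ means that
    both are positive. On such a set both measures are limits of integrals of ramps, which are
    admissible tests. *)
Lemma measure_eq_test n (nu1 nu2 : {finite_measure set (n.-tuple R) -> \bar R}) :
  (forall phi : 'rV[R]_n -> R, continuous phi ->
    (forall v, 0 <= phi v <= 1) ->
    (\int[nu1]_x (phi (rowT x))%:E = \int[nu2]_x (phi (rowT x))%:E)%E) ->
  forall A, measurable A -> nu1 A = nu2 A.
Proof.
move=> h A mA.
have GT : cozero (setT : set (n.-tuple R)).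
  exists (fun=> 1 : R); first exact: cst_continuous.
  by apply/seteqP; split => x //= _; exact: ltr01.
apply: (measure_unique (@cozero n) (fun=> setT)) => //.
- exact: measurable_tupleE.
- move=> _ _ [m1 c1 <-] [m2 c2 <-]; exists (m1 \min m2).
    exact: min_fun_continuous.
  by apply/seteqP; split => x /=; rewrite lt_min => /andP.
- by rewrite bigcup_const//; exists 0%N.
- move=> _ [m cm <-].
  have c1 := cvg_integral_ramp (nu := nu1) (measurable_continuous_rowT cm).
  have c2 := cvg_integral_ramp (nu := nu2) (measurable_continuous_rowT cm).
  apply: (cvg_unique _ c1); first exact: ereal_hausdorff.
  rewrite (_ : (fun k => _) =
      (fun k => \int[nu2]_x (ramp (k%:R * m (rowT x)))%:E)%E)//.
  apply/funext => k; apply: (h (fun v => ramp (k%:R * m v))).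
    exact: continuous_ramp_scale.
  by move=> v; rewrite ramp_ge0 ramp_le1.
- move=> k; rewrite -ge0_fin_numE//; exact: fin_num_measure.
Qed.

End measure_eq_test.

(** * Daniell representation *)

Section Clin_closure.
Context {R : realType} {V : normedModType R}.
Implicit Types f g : V -> R.

Lemma Clin_bound f : Clin f -> exists2 C, 0 <= C & forall v, `|f v| <= C * (1 + `|v|).
Proof.
move=> [_ [C hC]]; exists `|C| => // v; apply: (le_trans (hC v)).
by rewrite ler_wpM2r ?ler_norm// addr_ge0.
Qed.

Lemma ClinD f g : Clin f -> Clin g -> Clin (f + g).
Proof.
move=> /[dup] -[cf _] /Clin_bound[C C0 fC] /[dup] -[cg _] /Clin_bound[D D0 gD].
split; first by move=> v; exact: (cvgD (cf v) (cg v)).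
exists (C + D) => v; rewrite mulrDl (le_trans (ler_normD _ _))//.
by rewrite lerD.
Qed.

Lemma ClinZ c f : Clin f -> Clin (c *: f).
Proof.
move=> /[dup] -[cf _] /Clin_bound[C C0 fC].
split; first by move=> v; exact: (cvgM (cvg_cst c) (cf v)).
exists (`|c| * C) => v; rewrite normrM -mulrA.
by rewrite ler_wpM2l.
Qed.

Lemma ClinB f g : Clin f -> Clin g -> Clin (f - g).
Proof. by move=> cf cg; rewrite -scaleN1r; exact/ClinD/ClinZ. Qed.

Lemma Clin_dominated f g : Clin f -> continuous g ->
  (forall v, `|g v| <= `|f v|) -> Clin g.
Proof.
move=> [_ [C fC]] cg gf; split => //; exists C => v.
exact: le_trans (gf v) (fC v).
Qed.

Lemma Clin_bounded f M : continuous f -> (forall v, `|f v| <= M) -> Clin f.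
Proof.
move=> cf fM; split => //; exists `|M| => v; apply: (le_trans (fM v)).
by rewrite (le_trans (ler_norm M))// ler_peMr// lerDl.
Qed.

Lemma Clin_cst (c : R) : Clin ((fun=> c) : V -> R).
Proof. by apply: (@Clin_bounded _ `|c|) => //; exact: cst_continuous. Qed.

Lemma Clin_min f c : 0 <= c -> Clin f -> (forall v, 0 <= f v) ->
  Clin (fun v => Num.min (f v) c).
Proof.
move=> c0 cf f0; apply: (Clin_dominated cf).
  by apply: (@min_fun_continuous _ _ _ f (fun=> c)); [exact: cf.1|exact: cst_continuous].
by move=> v; rewrite !ger0_norm ?f0// ?ge_min ?lexx// le_min f0.
Qed.

End Clin_closure.

Section daniell.
Context {R : realType} {n : nat}.
Notation V := 'rV[R]_n.
Variable L : (V -> R) -> R.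
Hypothesis LD : forall f g, Clin f -> Clin g -> L (f + g) = L f + L g.
Hypothesis LZ : forall c f, Clin f -> L (c *: f) = c * L f.
Hypothesis L_ge0 : forall f, Clin f -> (forall v, 0 <= f v) -> 0 <= L f.
Hypothesis L1 : L (fun=> 1) = 1.
(** This replaces the monotone continuity in Daniell's theorem: outside a ball the constant 1 is
    dominated at small cost, and on the ball compactness is available. *)
Hypothesis L_tight : forall e, 0 < e -> exists W M, [/\ Clin W, L W <= e,
  forall v, 0 <= W v & forall v, M < `|v| -> 1 <= W v].

Let LB f g : Clin f -> Clin g -> L (f - g) = L f - L g.
Proof.
by move=> cf cg; rewrite -scaleN1r LD//; [rewrite LZ// mulN1r|exact: ClinZ].
Qed.

Let le_L f g : Clin f -> Clin g -> (forall v, f v <= g v) -> L f <= L g.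
Proof.
move=> cf cg fg; rewrite -subr_ge0 -LB//; apply: L_ge0; first exact: ClinB.
by move=> v; rewrite [X in _ <= X]/GRing.add/= subr_ge0.
Qed.

Let L_cst c : L (fun=> c) = c.
Proof.
have -> : (fun=> c) = c *: (fun=> 1) :> (V -> R).
  by apply/funext => v; apply/esym; exact: mulr1.
by rewrite LZ ?L1 ?mulr1//; exact: Clin_cst.
Qed.

(* The threshold [c < 1] lets the increasing sequence reach 1 only in the limit. *)
Definition daniell_cover (A : set (n.-tuple R)) : set R :=
  [set r | exists s : nat -> V -> R, [/\ forall k, Clin (s k),
    forall k v, 0 <= s k v, forall k v, s k v <= s k.+1 v,
    forall x, A x -> forall c, c < 1 -> exists k, c < s k (rowT x) &
    forall k, L (s k) <= r]].

Definition daniell_outer (A : set (n.-tuple R)) : R := inf (daniell_cover A).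

Let cover1 A : daniell_cover A 1.
Proof.
exists (fun _ _ => 1); split => //.
- by move=> _; exact: Clin_cst.
- by move=> _; rewrite L_cst.
Qed.

Let cover_ge0 A r : daniell_cover A r -> 0 <= r.
Proof.
by move=> [s [cs s0 _ _ sr]]; apply: le_trans (sr 0%N); exact: L_ge0.
Qed.

Let outer_le A r : daniell_cover A r -> daniell_outer A <= r.
Proof.
by move=> Ar; apply: ge_inf => //; exists 0 => z; exact: cover_ge0.
Qed.

Let outer_ge A r : (forall z, daniell_cover A z -> r <= z) -> r <= daniell_outer A.
Proof. by move=> h; apply: lb_le_inf => //; exists 1; exact: cover1. Qed.

Let outer_eps A e : 0 < e -> exists2 r, daniell_cover A r & r < daniell_outer A + e.
Proof.
move=> e0; apply: inf_adherent => //; split; first by exists 1; exact: cover1.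
by exists 0 => z; exact: cover_ge0.
Qed.

Let mu A : \bar R := (daniell_outer A)%:E.

Let mu0 : mu set0 = 0%E.
Proof.
congr (_%:E); apply/eqP; rewrite eq_le; apply/andP; split.
  apply: outer_le; exists (fun _ _ => 0); split => //.
  - by move=> _; exact: Clin_cst.
  - by move=> _; rewrite L_cst.
by apply: outer_ge => z; exact: cover_ge0.
Qed.

Let mu_ge0 A : (0 <= mu A)%E.
Proof. by rewrite lee_fin; apply: outer_ge => z; exact: cover_ge0. Qed.

Let s_mono (s : nat -> V -> R) : (forall k v, s k v <= s k.+1 v) ->
  forall v, {homo s ^~ v : k l / (k <= l)%N >-> k <= l}.
Proof. by move=> h v; apply: homo_leq => // a b c; exact: le_trans. Qed.

Let mu_sub A F : subset_sigma_subadditive mu A F.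
Proof.
move=> AF; apply/lee_addgt0Pr => e e0.
have en j : 0 < e / (2 ^ j.+1)%:R by rewrite divr_gt0// ltr0n expn_gt0.
have /choice[r hr] : forall j, exists r, daniell_cover (F j) r /\
    r < daniell_outer (F j) + e / (2 ^ j.+1)%:R.
  by move=> j; have [r ? ?] := outer_eps (F j) (en j); exists r.
have /choice[s hs] := fun j => (hr j).1.
apply: (le_trans _ (epsilon_trick xpredT _ (ltW e0))); last by move=> j; exact: mu_ge0.
set S := (X in (_ <= X)%E).
have SE k : ((\sum_(j < k) r j)%:E <= S)%E.
  rewrite -sumEFin.
  apply: (@le_trans _ _ (\sum_(0 <= j < k) (mu (F j) + (e / (2 ^ j.+1)%:R)%:E))%E).
    rewrite big_mkord; apply: lee_sum => j _.
    by rewrite -EFinD lee_fin ltW//; exact: (hr j).2.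
  by apply: nneseries_lim_ge => j _ _; rewrite adde_ge0// lee_fin ltW.
have [->|Soo] := eqVneq S +oo%E; first by rewrite leey.
have Sfin : S \is a fin_num.
  rewrite ge0_fin_numE ?ltey//.
  by have := SE 0%N; rewrite big_ord0.
rewrite -(fineK Sfin) lee_fin; apply: outer_le.
(* A diagonal sequence: stage $k$ adds the $k$-th terms of the first $k$ covers. It stays a finite
   sum in [Clin], increases with $k$, and eventually contains every term of every cover. *)
exists (fun k => \sum_(j < k) s j k).
have cS k l : Clin (\sum_(j < k) s j l).
  elim: k => [|k ih]; first by rewrite big_ord0; exact: Clin_cst.
  by rewrite big_ord_recr/=; apply: ClinD => //; have [] := hs k.
have SvE k l v : (\sum_(j < k) s j l) v = \sum_(j < k) s j l v.
  by rewrite fct_sumE.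
split => //.
- by move=> k v; rewrite SvE; apply: sumr_ge0 => j _; have [_ s0 _ _ _] := hs j.
- move=> k v; rewrite !SvE big_ord_recr/= -[leLHS]addr0 lerD//.
    by apply: ler_sum => j _; have [_ _ sm _ _] := hs j.
  by have [_ s0 _ _ _] := hs k.
- move=> x /AF[j _ Fjx] c c1; have [_ s0 sm h _] := hs j.
  have [k ck] := h x Fjx c c1.
  exists (maxn k j.+1); rewrite SvE (bigD1 (Ordinal (leq_maxr k j.+1)))//=.
  rewrite (lt_le_trans ck)// (le_trans (s_mono sm _ (leq_maxl k j.+1)))//.
  by rewrite lerDl; apply: sumr_ge0 => i _; have [_ ? _ _ _] := hs i.
- move=> k; rewrite -lee_fin fineK// (le_trans _ (SE k))// lee_fin.
  have -> : forall l, L (\sum_(j < l) s j k) = \sum_(j < l) L (s j k).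
    elim=> [|l ih]; first by rewrite !big_ord0 (L_cst 0).
    rewrite !big_ord_recr/= LD; [by rewrite ih|exact: cS|].
    by have [] := hs l.
  by apply: ler_sum => j _; have [_ _ _ _] := hs j.
Qed.

HB.instance Definition _ := isSubsetOuterMeasure.Build R (n.-tuple R) mu mu0 mu_ge0 mu_sub.

(** A nearly optimal cover $s_k$ of $E$ is split with the ramps $g_k\uparrow 1_U$: the sequence $s_k
    g_k$ covers $E\cap U$, and what remains covers $E\setminus U$. *)
Let mu_cozero : @cozero R n `<=` mu.-caratheodory.
Proof.
move=> _ [m cm <-]; set U := [set x | _].
apply: le_caratheodory_measurable => E; rewrite -EFinD lee_fin.
apply/ler_addgt0Pr => e e0.
have e20 : 0 < e / 2 by rewrite divr_gt0.
have [r [s [cs s0 sm sE sr]] rE] := outer_eps E e20.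
pose g k v := ramp (k%:R * m v).
have cg k : continuous (g k) by exact: continuous_ramp_scale.
have gm k v : g k v <= g k.+1 v.
  rewrite /g; have [m0|m0] := leP (m v) 0.
    by rewrite !ramp0// mulr_ge0_le0.
  by apply: le_ramp; rewrite ler_wpM2r ?ler_nat//; exact: ltW.
have cC (t : V -> R) (h : V -> R) : Clin t -> continuous h ->
    (forall v, 0 <= h v <= 1) -> Clin (fun v => t v * h v).
  move=> ct ch h01; apply: (Clin_dominated ct).
    by move=> v; exact: (cvgM (ct.1 v) (ch v)).
  move=> v; have /andP[h0 h1] := h01 v.
  by rewrite normrM [X in _ * X]ger0_norm// ler_piMr.
pose u k v := s k v * g k v.
have g01 k v : 0 <= g k v <= 1 by rewrite ramp_ge0 ramp_le1.
have cu k : Clin (u k) by exact: cC.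
have um k v : u k v <= u k.+1 v.
  by apply: ler_pM => //; exact: ramp_ge0.
have us k v : u k v <= s k v by apply: ler_piMr => //; exact: ramp_le1.
pose S := [set L (u k) | k in setT].
have Sub k : L (u k) <= sup S.
  apply: ub_le_sup; last by exists k.
  by exists r => _ [j _ <-]; apply: le_trans (sr j); exact: le_L.
have [K SK] : exists K, sup S - e / 2 < L (u K).
  have hS : has_sup S.
    split; first by exists (L (u 0%N)), 0%N.
    by exists r => _ [j _ <-]; apply: le_trans (sr j); exact: le_L.
  by have [_ [K _ <-] ?] := sup_adherent e20 hS; exists K.
have UE : daniell_outer (E `&` U) <= sup S.
  apply: outer_le; exists u; split => //.
    by move=> k v; rewrite mulr_ge0// ramp_ge0.
  move=> x [Ex Ux] c c1; have [k ck] := sE x Ex c c1.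
  have [j _ hj] := @ramp_near1 R (m (rowT x)) Ux.
  exists (maxn k j); rewrite /u /g hj/= ?leq_maxr// mulr1.
  by rewrite (lt_le_trans ck)// (s_mono sm)// leq_maxl.
(* Since $1-g_k$ decreases in $k$, the index of $g$ is frozen at $K$ to keep the cover increasing.
   With $l=\max(k,K)$ one has $s_k(1-g_K)\le s_l-s_Kg_K$, whose value under $L$ is at most
   $r-L(u_K)$; the choice of $K$ makes this close to $r-\sup S$. *)
have UcE : daniell_outer (E `&` ~` U) <= r - L (u K).
  have cg' : continuous (fun v : V => 1 - g K v).
    by move=> v; exact: (cvgB (cvg_cst (1 : R)) (cg K v)).
  have g01' v : 0 <= 1 - g K v <= 1.
    by have /andP[? ?] := g01 K v; apply/andP; split; lra.
  apply: outer_le; exists (fun k v => s k v * (1 - g K v)); split.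
  - by move=> k; exact: cC.
  - by move=> k v; rewrite mulr_ge0//; have /andP[] := g01' v.
  - by move=> k v; rewrite ler_wpM2r//; have /andP[] := g01' v.
  - move=> x [Ex /negP]; rewrite -leNgt => Ux c c1.
    have [k ck] := sE x Ex c c1; exists k; rewrite /g ramp0 ?subr0 ?mulr1//.
    by rewrite mulr_ge0_le0.
  - move=> k; pose l := maxn k K.
    apply: (@le_trans _ _ (L (s l - u K))); last first.
      by rewrite LB// lerD2r.
    apply: le_L; [exact: cC|exact: ClinB|] => v.
    rewrite [leRHS]/GRing.add/=.
    apply: (@le_trans _ _ (s l v * (1 - g K v))).
      by rewrite ler_wpM2r ?(s_mono sm) ?leq_maxl//; have /andP[] := g01' v.
    rewrite mulrBr mulr1 lerD2l lerN2 ler_wpM2r ?ramp_ge0//.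
    by rewrite (s_mono sm)// leq_maxr.
by move: UE UcE SK rE; lra.
Qed.

Let mu_cara : (@measurable _ (n.-tuple R)) `<=` mu.-caratheodory.
Proof.
rewrite measurable_tupleE; apply: smallest_sub mu_cozero; split.
- exact: caratheodory_measurable_set0.
- by move=> A mA; rewrite setTD; exact: caratheodory_measurable_setC.
- exact: caratheodory_measurable_bigcup.
Qed.

Let mu_sigma_additive : semi_sigma_additive (mu : set (n.-tuple R) -> \bar R).
Proof.
move=> F mF tF mbF.
apply: (@caratheodory_measure_sigma_additive R (n.-tuple R) mu) => //.
- by move=> i; exact: mu_cara (mF i).
- exact: mu_cara.
Qed.

Definition daniell_measure := mu.

HB.instance Definition _ := isMeasure.Build _ (n.-tuple R) R daniell_measure
  mu0 mu_ge0 mu_sigma_additive.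

Let mu_setT : daniell_measure setT = 1%E.
Proof.
congr (_%:E); apply/eqP; rewrite eq_le; apply/andP; split.
  by apply: outer_le; exact: cover1.
apply: outer_ge => r [s [cs s0 sm sT sr]].
apply/ler_addgt0Pr => e e0.
have e30 : 0 < e / 2 by rewrite divr_gt0.
have [W [M [cW LW W0 W1]]] := L_tight e30.
(* Dini's argument: the open sets $\{s_k>1-e/2\}$ increase and cover a compact ball, so a single
   index suffices. Then $1\le s_K+e/2+W$ everywhere, and applying $L$ gives $1\le r+e$. *)
have [K hK] : exists K, forall v, `|v| <= M -> 1 - e / 2 < s K v.
  pose B : set V := [set v | `|v| <= M].
  have cB : compact B.
    apply: bounded_closed_compact; last first.
      rewrite (_ : B = (fun v : V => `|v|) @^-1` `]-oo, M]).
        apply: closed_comp; last exact: interval_closed.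
        by move=> v _; exact: norm_continuous.
      by apply/seteqP; split => v /=; rewrite in_itv.
    exists M; split => [|x Mx v /= /le_trans]; first exact: num_real.
    by apply; exact: ltW.

  have := cB; rewrite compact_cover => /(_ nat setT
    (fun k => [set v | 1 - e / 2 < s k v])) [].
  - move=> k _; rewrite (_ : [set v | _] = s k @^-1` `]1 - e / 2, +oo[).
      apply: open_comp; last exact: interval_open.
      by move=> v _; exact: (cs k).1.
    by apply/seteqP; split => v /=; rewrite in_itv/= andbT.
  - move=> v Bv.
    have [k hk] := sT [tuple v ord0 i | i < n] I (1 - e / 2) ltac:(lra).
    exists k => //=; move: hk; congr (_ < s k _).
    by apply/rowP => i; rewrite mxE tnth_mktuple.
  - move=> D _ BD; exists (\max_(k <- finmap.enum_fset D) k)%N => v /BD[k Dk] /= hk.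
    rewrite (lt_le_trans hk)// (s_mono sm)//.
    by apply: leq_bigmax_seq.
have : L (fun=> 1) <= L (s K + ((fun=> e / 2) + W)).
  apply: le_L; [exact: Clin_cst|by apply/ClinD/ClinD => //; exact: Clin_cst|].
  move=> v; rewrite /GRing.add/=.
  have [vM|vM] := leP `|v| M.
    by have := hK v vM; have := W0 v; lra.
  by have := W1 v vM; have := s0 K v; lra.
rewrite L_cst LD//; last by apply: ClinD => //; exact: Clin_cst.
rewrite LD//; last exact: Clin_cst.
by rewrite L_cst; have := sr K; lra.
Qed.

HB.instance Definition _ := Measure_isProbability.Build _ _ _ daniell_measure mu_setT.

(** Markov's inequality: the constant sequence $c^{-1}f$ is a cover of the set. *)
Let mu_ge (f : V -> R) (c : R) : Clin f -> (forall v, 0 <= f v) -> 0 < c ->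
  (daniell_measure [set x | (c <= f (rowT x))%R] <= (L f / c)%:E)%E.
Proof.
move=> cf f0 c0; rewrite lee_fin; apply: outer_le.
exists (fun _ => c^-1 *: f); split => //.
- by move=> _; exact: ClinZ.
- by move=> _ v; rewrite /GRing.scale/= mulr_ge0// invr_ge0 ltW.
- move=> x /= cfx d d1; exists 0%N; rewrite (lt_le_trans d1)//.
  by rewrite /GRing.scale/= ler_pdivlMl// mulr1.
- by move=> _; rewrite LZ// mulrC.
Qed.

Let Q : probability (n.-tuple R) R := daniell_measure.

(** The function is cut into horizontal slices of height $d$. A slice is nonzero only where the
    slice below it is full, so its integral is at most $d$ times the measure of that set, hence by
    Markov at most $L$ of the slice below. The shift by one slice leaves the lowest one, which costs
    the additional $d$. *)
Let layer (f : V -> R) (d : R) : Clin f -> (forall v, 0 <= f v) -> 0 < d -> forall k,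
  (\int[Q]_x (Num.min (f (rowT x)) (k.+1%:R * d))%:E <=
   (d + L (fun v => Num.min (f v) (k%:R * d)))%:E)%E.
Proof.
move=> cf f0 d0.
pose c k v := Num.min (f v) (k%:R * d).
have cC k : Clin (c k) by apply: Clin_min => //; rewrite mulr_ge0// ltW.
have c0 k v : 0 <= c k v by rewrite le_min f0 mulr_ge0// ltW.
have mc k : measurable_fun setT (fun x : n.-tuple R => (c k (rowT x))%:E).
  by apply/measurable_EFinP; exact: (measurable_continuous_rowT (cC k).1).
have kd k : k.+1%:R * d = k%:R * d + d by rewrite -natr1 mulrDl mul1r.
have cd k v : 0 <= c k.+1 v - c k v.
  by rewrite subr_ge0 /c kd le_min2// lerDl ltW.
have cd' k v : c k.+1 v - c k v <= d.
  rewrite /c kd /Num.min; case: ltP => ?; case: ltP => ?; lra.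
elim=> [|k ih].
  rewrite mul1r (_ : (fun v => Num.min (f v) (0%:R * d)) = fun=> 0); last first.
    by apply/funext => v; rewrite mul0r min_r.
  rewrite L_cst addr0.
  apply: (@le_trans _ _ (\int[Q]_x (cst d%:E x))%E); last first.
    by rewrite integral_cst//= probability_setT mule1.
  apply: ge0_le_integral => //.
  - by move=> x _; rewrite lee_fin -[d]mul1r; exact: (c0 1%N).
  - by move: (mc 1%N); rewrite /c mul1r.
  - by move=> x _; rewrite lee_fin ge_min lexx orbT.
have -> : (\int[Q]_x (Num.min (f (rowT x)) (k.+2%:R * d))%:E =
  \int[Q]_x (c k.+1 (rowT x))%:E +
  \int[Q]_x (c k.+2 (rowT x) - c k.+1 (rowT x))%:E)%E.
  rewrite -ge0_integralD//.
  - by apply: eq_integral => x _; rewrite -EFinD addrCA subrr addr0.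
  - by move=> x _; rewrite lee_fin.
  - by move=> x _; rewrite lee_fin.
  - by apply/measurable_EFinP/measurable_funB; apply/measurable_EFinP; exact: mc.
have mE : measurable [set x : n.-tuple R | d <= c k.+1 (rowT x) - c k (rowT x)].
  rewrite [X in measurable X](_ : _ =
    (fun x : n.-tuple R => c k.+1 (rowT x) - c k (rowT x)) @^-1` `[d, +oo[).
    rewrite -[X in measurable X]setTI.
    by apply: measurable_funB => //; apply/measurable_EFinP; exact: mc.
  by apply/seteqP; split => x /=; rewrite in_itv/= andbT.
have -> : (d + L (c k.+1))%:E =
    ((d + L (c k))%:E + (d * (L (c k.+1 - c k) / d))%:E)%E.
  by rewrite -EFinD mulrCA mulfV ?gt_eqF// mulr1 LB//; congr (_%:E); lra.
apply: leeD; first exact: ih.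
apply: (@le_trans _ _ (\int[Q]_x (d%:E *
    (\1_[set x : n.-tuple R | (d <= c k.+1 (rowT x) - c k (rowT x))%R] x)%:E))%E).
  apply: ge0_le_integral => //.
  - by move=> x _; rewrite lee_fin.
  - by apply/measurable_EFinP/measurable_funB; apply/measurable_EFinP; exact: mc.
  - by apply/measurable_EFinP/measurable_funM => //; exact: measurable_indic.
  - move=> x _; rewrite -EFinM lee_fin indicE.
    have [h|h] := leP d (c k.+1 (rowT x) - c k (rowT x)).
      by rewrite mem_set// mulr1; exact: cd'.
    rewrite memNset/= ?mulr0; last by apply/negP; rewrite -ltNge.
    rewrite subr_le0 /c.
    have : f (rowT x) < k.+1%:R * d.
      rewrite ltNge; apply/negP => fk; move: h; rewrite /c min_r// min_r.
        by rewrite kd; lra.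
      by rewrite (le_trans _ fk)// kd lerDl ltW.
    by move=> fk; rewrite ge_min [X in _ <= X]min_l ?lexx// ltW.
rewrite ge0_integralZl//; last 2 first.
  by apply/measurable_EFinP; exact: measurable_indic.
  by rewrite lee_fin ltW.
rewrite integral_indic// setIT EFinM lee_wpmul2l// ?lee_fin ?(ltW d0)//.
by have := mu_ge (ClinB (cC k.+1) (cC k)) (cd k) d0; rewrite lee_fin.
Qed.

(** The slice estimate passes to the limit, in the number of slices by monotone convergence and then
    in their height. The resulting one-sided bound is enough for the representation, where functions
    are tested together with a dominating one. *)
Theorem daniell : exists Q : probability (n.-tuple R) R,
  forall f, Clin f -> (forall v, 0 <= f v) ->
    (\int[Q]_x (f (rowT x))%:E <= (L f)%:E)%E.
Proof.
exists Q => f cf f0; apply/lee_addgt0Pr => d d0.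
pose c k v := Num.min (f v) (k%:R * d).
have cC k : Clin (c k) by apply: Clin_min => //; rewrite mulr_ge0// ltW.
have : (\int[Q]_x (c k (rowT x))%:E)%E @[k --> \oo] -->
    (\int[Q]_x (f (rowT x))%:E)%E.
  have fE x : ((f (rowT x))%:E = limn (fun k => (c k (rowT x))%:E))%E.
    apply/esym/cvg_lim => //; apply: cvg_near_cst; near=> k.
    rewrite /c min_l// -ler_pdivrMr//; apply: ltW; near: k.
    exact: nbhs_infty_gtr.
  under eq_integral do rewrite fE.
  apply: (@cvg_monotone_convergence _ _ _ _ _ measurableT
    (fun k x => (c k (rowT x))%:E)).
  - by move=> k; apply/measurable_EFinP; exact: (measurable_continuous_rowT (cC k).1).
  - by move=> k x _; rewrite lee_fin le_min f0 mulr_ge0// ltW.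
  - move=> x _ k l kl; rewrite lee_fin /c le_min2// ler_wpM2r ?ler_nat//.
    exact: ltW.
move=> /cvg_lim <-//; apply: lime_le.
  apply: ereal_nondecreasing_is_cvgn => k l kl.
  apply: ge0_le_integral => //.
  - by move=> x _; rewrite lee_fin le_min f0 mulr_ge0// ltW.
  - by apply/measurable_EFinP; exact: (measurable_continuous_rowT (cC k).1).
  - by apply/measurable_EFinP; exact: (measurable_continuous_rowT (cC l).1).
  - by move=> x _; rewrite lee_fin /c le_min2// ler_wpM2r ?ler_nat// ltW.
near=> k; have -> : k = k.-1.+1 by rewrite prednK//; near: k; exact: nbhs_infty_gt.
rewrite (le_trans (layer cf f0 d0 _))// -EFinD lee_fin addrC lerD2r.
by apply: (le_L (cC _) cf) => v; rewrite ge_min lexx.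
Unshelve. all: by end_near. Qed.

End daniell.

(** * Disintegration of laws on the line *)

Section weighted_pushforward.
Context d1 d2 (X : measurableType d1) (Y : measurableType d2) (R : realType).
Variables (m : {measure set X -> \bar R}) (w : X -> R) (f : X -> Y).
Hypothesis w0 : forall x, 0 <= w x.
Hypothesis iw : m.-integrable setT (EFin \o w).
Hypothesis mf : measurable_fun setT f.

(** The image under $f$ of the measure with density $w$; for $w=1$ and a probability [m] it is the
    law of $f$. The proofs are arguments so that the finite-measure structure can be inferred from
    the term alone. *)
Definition wpush (_ : forall x, 0 <= w x) (_ : m.-integrable setT (EFin \o w))
  (_ : measurable_fun setT f) (B : set Y) : \bar R :=
  (\int[m]_(x in f @^-1` B) (w x)%:E)%E.

Notation nu := (wpush w0 iw mf).

Let mpre B : measurable B -> measurable (f @^-1` B).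
Proof. by move=> mB; rewrite -[X in measurable X]setTI; exact: mf. Qed.

Let mw : measurable_fun setT w.
Proof. exact/measurable_EFinP/(measurable_int _ iw). Qed.

Let wpush0 : nu set0 = 0%E.
Proof. by rewrite /wpush preimage_set0 integral_set0. Qed.

Let wpush_ge0 B : (0 <= nu B)%E.
Proof. by apply: integral_ge0 => x _; rewrite lee_fin. Qed.

Let wpush_sigma_additive : semi_sigma_additive nu.
Proof.
move=> F mF tF mUF; rewrite /wpush preimage_bigcup; apply: cvg_toP.
  apply: ereal_nondecreasing_is_cvgn => k l kl.
  by apply: lee_sum_nneg_natr => // j _ _; exact: wpush_ge0.
rewrite ge0_integral_bigcup//=.
- by move=> i; exact: mpre.
- by apply/measurable_funTS/measurable_EFinP.
- by move=> x _; rewrite lee_fin.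
- apply/trivIsetP => i j _ _ ij; rewrite -preimage_setI.
  by move/trivIsetP : tF => /(_ _ _ _ _ ij) ->//; rewrite preimage_set0.
Qed.

HB.instance Definition _ := isMeasure.Build _ _ _ nu
  wpush0 wpush_ge0 wpush_sigma_additive.

Let wpush_fin : fin_num_fun nu.
Proof.
move=> B mB; apply: integrable_fin_num; first exact: mpre.
exact: (integrableS measurableT (mpre mB) (@subsetT _ _) iw).
Qed.

HB.instance Definition _ := @Measure_isFinite.Build _ _ _ nu wpush_fin.

Import HBNNSimple.

Lemma ge0_integral_wpush (g : Y -> \bar R) : measurable_fun setT g ->
  (forall y, 0 <= g y)%E ->
  (\int[nu]_y g y = \int[m]_x (g (f x) * (w x)%:E))%E.
Proof.
move=> mg g0.
have step (h : {nnsfun Y >-> R}) :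
    (\int[nu]_y (h y)%:E = \int[m]_x ((h (f x))%:E * (w x)%:E))%E.
  transitivity (\int[nu]_y \sum_(r \in range h) (r * \1_(h @^-1` [set r]) y)%:E)%E.
    by apply: eq_integral => y _; rewrite fsumEFin// -fimfunE.
  rewrite ge0_integral_fsum//; last 2 first.
    by move=> r; apply/measurable_EFinP/measurable_funM.
    by move=> r y _; exact: nnfun_muleindic_ge0.
  transitivity (\int[m]_x \sum_(r \in range h)
      ((r * \1_(h @^-1` [set r]) (f x))%:E * (w x)%:E))%E; last first.
    apply: eq_integral => x _; rewrite [in RHS]fimfunE -fsumEFin//.
    by rewrite ge0_mule_fsuml// => r; exact: nnfun_muleindic_ge0.
  rewrite ge0_integral_fsum//; last 2 first.
    move=> r; apply/measurable_EFinP/measurable_funM => //.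
    apply: measurable_funM => //.
    by apply: measurableT_comp mf; exact: measurable_indic.
    by move=> r x _; rewrite mule_ge0 ?lee_fin//; exact: nnfun_muleindic_ge0.
  apply: eq_fsbigr => r; rewrite inE => -[y0 _ <-].
  under eq_integral do rewrite EFinM.
  rewrite ge0_integralZl//; last 2 first.
    by apply/measurable_EFinP; exact: measurable_indic.
    by rewrite lee_fin.
  under [RHS]eq_integral do rewrite EFinM -muleA.
  rewrite ge0_integralZl//; last 3 first.
    apply/measurable_EFinP/measurable_funM => //.
    by apply: measurableT_comp mf; exact: measurable_indic.
    by move=> x _; rewrite -EFinM lee_fin mulr_ge0.
    by rewrite lee_fin.
  congr (_ * _)%E; rewrite integral_indic// setIT.
  transitivity (\int[m]_(x in f @^-1` (h @^-1` [set h y0])) (w x)%:E)%E => //.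
  rewrite integral_mkcond; apply: eq_integral => x _.
  by rewrite patchE -EFinM indicE; case: (boolP (_ \in _)) => xh;
    rewrite (_ : (f x \in _) = (x \in f @^-1` (h @^-1` [set h y0])))//
       ?xh ?(negbTE xh) ?mul1r ?mul0r.
pose h := nnsfun_approx measurableT mg.
have hc y : (h n y)%:E @[n --> \oo] --> g y.
  by apply: cvg_nnsfun_approx.
have hm y : {homo (fun n => (h n y)%:E) : k l / (k <= l)%N >-> (k <= l)%E}.
  by move=> k l kl; rewrite lee_fin; exact/lefP/nd_nnsfun_approx.
have c1 : (\int[nu]_y (h n y)%:E)%E @[n --> \oo] --> (\int[nu]_y g y)%E.
  have gE y : g y = limn (fun n => (h n y)%:E) by apply/esym/cvg_lim.
  under [X in _ --> X]eq_integral do rewrite gE.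
  apply: (@cvg_monotone_convergence _ _ _ _ _ measurableT
    (fun n y => (h n y)%:E)) => //.
  - by move=> n; exact/measurable_EFinP.
  - by move=> n y _; rewrite lee_fin.
have c2 : (\int[nu]_y (h n y)%:E)%E @[n --> \oo] -->
    (\int[m]_x (g (f x) * (w x)%:E))%E.
  have gE x : (g (f x) * (w x)%:E = limn (fun n => (h n (f x))%:E * (w x)%:E))%E.
    by apply/esym/cvg_lim => //; apply: cvgeZr.
  have -> : (fun n => \int[nu]_y (h n y)%:E)%E =
      (fun n => \int[m]_x ((h n (f x))%:E * (w x)%:E))%E.
    by apply/funext => n; exact: step.
  under [X in _ --> X]eq_integral do rewrite gE.
  apply: (@cvg_monotone_convergence _ _ _ _ _ measurableT
    (fun n x => ((h n (f x))%:E * (w x)%:E)%E)) => //.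
  - move=> n; apply/measurable_EFinP/measurable_funM => //.
    exact: (measurableT_comp _ mf).
  - by move=> n x _; rewrite mule_ge0 ?lee_fin.
  - by move=> x _ k l kl; rewrite lee_wpmul2r ?lee_fin//; exact: hm.
exact: (cvg_unique _ c1 c2).
Qed.

Lemma ge0_integral_wpush_in (B : set Y) (g : Y -> \bar R) : measurable B ->
  measurable_fun setT g -> (forall y, 0 <= g y)%E ->
  (\int[nu]_(y in B) g y = \int[m]_(x in f @^-1` B) (g (f x) * (w x)%:E))%E.
Proof.
move=> mB mg g0; rewrite [LHS]integral_mkcond.
have mgB : measurable_fun setT (g \_ B).
  by apply/(measurable_restrictT _ _).1 => //; exact: measurable_funTS.
have gB0 y : (0 <= (g \_ B) y)%E by rewrite patchE; case: ifP.
rewrite (ge0_integral_wpush mgB gB0).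
rewrite [RHS]integral_mkcond; apply: eq_integral => x _; rewrite !patchE.
rewrite (_ : (f x \in B) = (x \in f @^-1` B)); last first.
  by apply/idP/idP; rewrite !inE.
by case: ifP; rewrite ?mul0e.
Qed.

Lemma integral_wpush (g : Y -> R) : measurable_fun setT g ->
  (\int[nu]_y (g y)%:E = \int[m]_x (g (f x) * w x)%:E)%E.
Proof.
move=> mg; rewrite [LHS]integralE [RHS]integralE.
rewrite !ge0_integral_wpush//; last 2 first.
- by apply: measurable_funeneg; exact/measurable_EFinP.
- by apply: measurable_funepos; exact/measurable_EFinP.
congr (_ - _)%E; apply: eq_integral => x _.
- rewrite !funeposE -!EFin_max -EFinM; congr (_%:E).
  by rewrite maxr_pMl// mul0r.
- rewrite !funenegE -!EFinN -!EFin_max -EFinM; congr (_%:E).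
  by rewrite maxr_pMl// mul0r mulNr.
Qed.

End weighted_pushforward.

Section almost_everywhere.
Context d (X : measurableType d) (R : realType).
Variable m : {measure set X -> \bar R}.

Lemma ae_forall_countable (I : countType) (P : I -> X -> Prop) :
  (forall i, {ae m, forall x, P i x}) -> {ae m, forall x, forall i, P i x}.
Proof.
move=> h.
pose F k : set X := if @unpickle I k is Some i then ~` [set x | P i x] else set0.
have : m.-negligible (\bigcup_k F k).
  apply: negligible_bigcup => k; rewrite /F.
  by case: unpickle => [i|]; [exact: h|exact: negligible_set0].
apply: negligibleS => x /= /existsNP[i nP]; exists (pickle i) => //.
by rewrite /F pickleK.
Qed.

Lemma integral_le_ae (f g : X -> R) :
  m.-integrable setT (EFin \o f) -> m.-integrable setT (EFin \o g) ->
  (forall A, measurable A ->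
    (\int[m]_(x in A) (f x)%:E <= \int[m]_(x in A) (g x)%:E)%E) ->
  {ae m, forall x, f x <= g x}.
Proof.
move=> If Ig h.
have mf : measurable_fun setT f by exact/measurable_EFinP/(measurable_int _ If).
have mg : measurable_fun setT g by exact/measurable_EFinP/(measurable_int _ Ig).
(* Tested on the set where the claim fails, the nonnegative function $f-g$ has integral at most 0,
   so it vanishes almost everywhere there. *)
pose N := [set x | g x < f x].
have mN : measurable N.
  rewrite (_ : N = (fun x => f x - g x) @^-1` `]0, +oo[); last first.
    by apply/seteqP; split => x; rewrite /N/= in_itv/= andbT subr_gt0.
  by rewrite -[X in measurable X]setTI; exact: measurable_funB.
have IfN := integrableS measurableT mN (@subsetT _ _) If.
have IgN := integrableS measurableT mN (@subsetT _ _) Ig.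
have : (\int[m]_(x in N) `|(f x - g x)%:E| = 0)%E.
  apply/eqP; rewrite eq_le integral_ge0 ?andbT//.
  rewrite (eq_integral (fun x => (f x)%:E - (g x)%:E)%E); last first.
    by move=> x; rewrite inE => Nx; rewrite /= ger0_norm// subr_ge0 ltW.
  by rewrite integralB_EFin// sube_le0 ?h.
move/(ae_eq_integral_abs _ mN); move=> H.
have /H : measurable_fun N (fun x => (f x - g x)%:E).
  by apply/measurable_funTS/measurable_EFinP/measurable_funB.
apply: filterS => x hx; rewrite leNgt; apply/negP => Nx.
by have [/eqP] := hx Nx; rewrite subr_eq0 gt_eqF.
Qed.

End almost_everywhere.

Section real_measures.
Context {R : realType}.

Lemma measure_itvNyo_le (m : {measure set R -> \bar R}) (r : R) c :
  (forall a, a < r -> (m `]-oo, a] <= c)%E) -> (m `]-oo, r[ <= c)%E.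
Proof.
move=> h; pose F n : set R := `]-oo, r - n.+1%:R^-1].
have UF : \bigcup_n F n = `]-oo, r[%classic.
  apply/seteqP; split => [x [n _]|x]; rewrite /F/= !in_itv/=.
    by move=> /le_lt_trans; apply; rewrite ltrBlDr ltrDl.
  move=> xr; exists (Num.trunc (r - x)^-1) => //=; rewrite in_itv/=.
  rewrite lerBrDl -lerBrDr -[leRHS]invrK lef_pV2 ?posrE ?invr_gt0 ?subr_gt0//.
  by apply: ltW; exact: truncnS_gt.
have : (m \o F) n @[n --> \oo] --> m (\bigcup_n F n).
  apply: nondecreasing_cvg_mu.
  - by move=> n; exact: measurable_itv.
  - by rewrite UF; exact: measurable_itv.
  - move=> k l kl; apply/subsetPset => x; rewrite /F/= !in_itv/= => /le_trans.
    by apply; rewrite lerD2l lerN2 lef_pV2 ?posrE// ler_nat.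
rewrite UF => /[dup] /cvgP cF /cvg_lim <-//.
apply: lime_le => //; apply: nearW => n; apply: h.
by rewrite ltrBlDr ltrDl.
Qed.

(** The law of a quantile is only known up to the mass at the endpoint, between the open and the
    closed half-line, and only at rationals. A half-line $]-\infty,r[$ is exhausted by closed ones,
    and a rational strictly between $a$ and $r$ closes the gap. *)
Lemma measure_eq_rat_sandwich (m1 m2 : {measure set R -> \bar R}) :
  (m1 setT < +oo)%E ->
  (forall q : rat, (m1 `]-oo, ratr q[ <= m2 `]-oo, ratr q])%E) ->
  (forall q : rat, (m2 `]-oo, ratr q] <= m1 `]-oo, ratr q])%E) ->
  forall B, measurable B -> m1 B = m2 B.
Proof.
move=> m1oo h1 h2 B mB.
have le_itv (m : {measure set R -> \bar R}) (i j : interval R) :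
    [set` i] `<=` [set` j] -> (m [set` i] <= m [set` j])%E.
  by move=> ij; apply: le_measure => //; rewrite inE; exact: measurable_itv.
apply: (measure_unique (@RGenInftyO.G R) (fun n => `]-oo, n%:R[%classic)) => //.
- exact: RGenInftyO.measurableE.
- move=> _ _ [x ->] [y ->]; exists (Num.min x y).
  by apply/seteqP; split => z /=; rewrite !in_itv/= lt_min => /andP.
- by move=> n; exists n%:R.
- apply/seteqP; split => // x _; exists (Num.trunc x).+1 => //=.
  by rewrite in_itv/=; exact: truncnS_gt.
- move=> _ [r ->]; apply/eqP; rewrite eq_le; apply/andP; split.
    apply: measure_itvNyo_le => a ar.
    have [q] := rat_in_itvoo ar; rewrite in_itv/= => /andP[aq qr].
    apply: le_trans (le_trans (h1 q) _); apply: le_itv => x /=; rewrite !in_itv/=.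
      by move=> /le_lt_trans; apply.
    by move=> /le_lt_trans; apply.
  apply: measure_itvNyo_le => a ar.
  have [q] := rat_in_itvoo ar; rewrite in_itv/= => /andP[aq qr].
  apply: le_trans (le_trans (h2 q) _); apply: le_itv => x /=; rewrite !in_itv/=.
    by move=> /le_trans; apply; exact: ltW.
  by move=> /le_lt_trans; apply.
- by move=> n; apply: le_lt_trans m1oo; apply: le_measure; rewrite ?inE.
Qed.

Corollary finite_measure_eq_rat_sandwich (m1 m2 : {finite_measure set R -> \bar R}) :
  (forall q : rat, (m1 `]-oo, ratr q[ <= m2 `]-oo, ratr q])%E) ->
  (forall q : rat, (m2 `]-oo, ratr q] <= m1 `]-oo, ratr q])%E) ->
  forall B, measurable B -> m1 B = m2 B.
Proof.
by apply: measure_eq_rat_sandwich; rewrite -ge0_fin_numE//; exact: fin_num_measure.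
Qed.

End real_measures.

(** * Kernels built from a uniform variable and quantiles *)

Section law_kernel.
Context {R : realType}.

Definition unif01 : probability (measurableTypeR R) R := uniform_prob (@ltr01 R).

Lemma unif01_le (c : R) : 0 <= c <= 1 -> unif01 [set t | (t <= c)%R] = c%:E.
Proof.
move=> /andP[c0 c1]; rewrite /unif01/= /uniform_prob integral_uniform_pdf.
rewrite (_ : _ `&` _ = `[0, c]%classic); last first.
  apply/seteqP; split => x /=; rewrite !in_itv/=.
    by move=> [xc /andP[-> _]].
  by move=> /andP[-> xc]; split => //; rewrite (le_trans xc c1).
rewrite (eq_integral (fun=> 1%E)); last first.
  move=> x; rewrite inE/= in_itv/= => /andP[x0 xc].
  by rewrite /uniform_pdf x0 (le_trans xc c1)/= subr0 invr1.
rewrite integral_cst//= mul1e lebesgue_measure_itv/= lte_fin.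
by move: c0; rewrite le_eqVlt => /predU1P[<-|->]; rewrite ?ltxx// oppr0 adde0.
Qed.

Variables (H : R * measurableTypeR R -> R).
Hypothesis mH : measurable_fun setT H.

Let mHy y : measurable_fun setT (fun t => H (y, t)).
Proof. by apply: measurableT_comp => //; exact: pair1_measurable. Qed.

(** The law of $H(y,U)$ with $U$ uniform on $[0,1]$. With kernels of this form, the kernel axioms
    reduce to joint measurability of $H$. *)
Definition law_measure (_ : measurable_fun setT H) (y : R) (B : set R) : \bar R :=
  unif01 ((fun t => H (y, t)) @^-1` B).

Let mpre y B : measurable B -> measurable ((fun t => H (y, t)) @^-1` B).
Proof. by move=> mB; rewrite -[X in measurable X]setTI; exact: mHy. Qed.

Let law0 y : law_measure mH y set0 = 0%E.
Proof. by rewrite /law_measure preimage_set0 measure0. Qed.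

Let law_ge0 y B : (0 <= law_measure mH y B)%E.
Proof. exact: measure_ge0. Qed.

Let law_sigma_additive y : semi_sigma_additive (law_measure mH y).
Proof.
move=> F mF tF mUF; rewrite /law_measure preimage_bigcup.
apply: measure_semi_sigma_additive.
- by move=> n; exact: mpre.
- apply/trivIsetP => /= i j _ _ ij; rewrite -preimage_setI.
  by move/trivIsetP : tF => /(_ _ _ _ _ ij) ->//; rewrite preimage_set0.
- by rewrite -preimage_bigcup; exact: mpre.
Qed.

HB.instance Definition _ y := isMeasure.Build _ _ _ (law_measure mH y)
  (law0 y) (@law_ge0 y) (@law_sigma_additive y).

Definition law_kernel (h : measurable_fun setT H) :
  R -> {measure set R -> \bar R} := law_measure mH.

Let measurable_law B : measurable B ->
  measurable_fun setT ((law_kernel mH) ^~ B).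
Proof.
move=> mB.
have mHB : measurable (H @^-1` B) by rewrite -[X in measurable X]setTI; exact: mH.
have := measurable_fun_xsection unif01 mHB.
congr (measurable_fun _ _); apply/funext => y /=.
rewrite /law_measure; congr (unif01 _).
by apply/seteqP; split => t; rewrite /xsection/= inE.
Qed.

HB.instance Definition _ := isKernel.Build _ _ _ _ _ (law_kernel mH) measurable_law.

Let law_prob y : law_kernel mH y setT = 1%E.
Proof. by rewrite /law_kernel/= /law_measure preimage_setT probability_setT. Qed.

HB.instance Definition _ :=
  Kernel_isProbability.Build _ _ _ _ _ (law_kernel mH) law_prob.

Definition law_pkernel : R.-pker R ~> R := law_kernel mH.

Lemma law_pkernelE y B : law_pkernel y B = unif01 [set t | B (H (y, t))].
Proof. by []. Qed.

End law_kernel.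

Section quantile.
Context {R : realType}.
Variable F : rat -> R -> R.
Hypothesis mF : forall q, measurable_fun setT (F q).

(** The infimum is the generalized inverse of $q\mapsto F_q(y)$ at level $t$. Adding the element 1
    and restricting to $q\ge 0$ keeps it in $[0,1]$ even at those $y$ where $F$, fixed only up to
    null sets, is no distribution function. *)
Definition quantile_set (p : R * measurableTypeR R) : set R :=
  [set r | r = 1 \/ exists q : rat, [/\ 0 <= q, p.2 <= F q p.1 & r = ratr q]].

Definition quantile (p : R * measurableTypeR R) : R := inf (quantile_set p).

Let quantile_set_ge0 p r : quantile_set p r -> 0 <= r.
Proof. by move=> [->//|[q [q0 _ ->]]]; rewrite ler0q. Qed.

Let quantile_has_inf p : has_inf (quantile_set p).
Proof. by split; [exists 1; left|exists 0 => r; exact: quantile_set_ge0]. Qed.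

Lemma quantile_ge0 p : 0 <= quantile p.
Proof. by apply: lb_le_inf; [exists 1; left|move=> r; exact: quantile_set_ge0]. Qed.

Lemma quantile_le1 p : quantile p <= 1.
Proof. by apply: ge_inf; [exact: (quantile_has_inf p).2|left]. Qed.

Lemma quantile_le q p : 0 <= q -> p.2 <= F q p.1 -> quantile p <= ratr q.
Proof.
by move=> q0 pF; apply: ge_inf; [exact: (quantile_has_inf p).2|right; exists q].
Qed.

Lemma quantile_lt a p : quantile p < a ->
  1 < a \/ exists q : rat, [/\ 0 <= q, ratr q < a & p.2 <= F q p.1].
Proof.
move=> /inf_lt; move=> /(_ (quantile_has_inf p).1)[r [->|[q [q0 pF ->]]] ra].
  by left.
by right; exists q.
Qed.

(** An infimum lies below $a$ exactly when some member does, and apart from 1 the members are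
    indexed by rationals; strict sublevel sets are thus countable unions. *)
Lemma measurable_quantile : measurable_fun setT quantile.
Proof.
apply: (measurability _ (RGenInftyO.measurableE R)).
move=> _ [_ [a ->] <-]; rewrite setTI.
pose D q : set (R * measurableTypeR R) :=
  if (0 <= q) && (ratr q < a) then [set p | p.2 <= F q p.1] else set0.
have -> : quantile @^-1` `]-oo, a[ =
    (if 1 < a then setT else set0) `|` \bigcup_q D q.
  apply/seteqP; split => p; rewrite /= in_itv/=.
    move=> /quantile_lt[->|[q [q0 qa pF]]]; first by left.
    by right; exists q => //; rewrite /D q0 qa.
  move=> [|[q _]].
    by case: ifPn => // a1 _; exact: le_lt_trans (quantile_le1 p) a1.
  rewrite /D; case: ifPn => // /andP[q0 qa] pF.
  exact: le_lt_trans (quantile_le q0 pF) qa.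
apply: measurableU; first by case: ifP.
apply: bigcupT_measurable_rat => q; rewrite /D; case: ifPn => // _.
rewrite (_ : [set p | _] = (fun p => F q p.1 - p.2) @^-1` `[0, +oo[); last first.
  by apply/seteqP; split => p /=; rewrite in_itv/= andbT subr_ge0.
rewrite -[X in measurable X]setTI; apply: measurable_funB => //.
exact: measurableT_comp (mF q) measurable_fst.
Qed.

End quantile.

Lemma integrable_indic d (X : measurableType d) (R : realType)
    (m : {measure set X -> \bar R}) (A : set X) :
  (m setT < +oo)%E -> measurable A -> m.-integrable setT (EFin \o (\1_A : X -> R)).
Proof.
move=> mT mA; apply: (@le_integrable _ _ _ _ _ measurableT _ (cst 1%E)).
- by apply/measurable_EFinP; exact: measurable_indic.
- move=> x _; rewrite /= lee_fin normr1 indicE.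
  by case: (_ \in _); rewrite ?normr1 ?normr0.
- by apply/integrableP; split => //; rewrite integral_cst//= normr1 mul1e.
Qed.

Section disintegration.
Context d (X : measurableType d) (R : realType).
Variable Q : probability X R.

Let indic_ge0 T (A : set T) x : 0 <= \1_A x :> R.
Proof. by rewrite indicE. Qed.

Let QT : (Q setT < +oo)%E. Proof. by rewrite probability_setT ltry. Qed.

(** For rational $q$, $F_q$ is the Radon-Nikodym density of $A\mapsto Q(Y\in A, Z\le q)$ with
    respect to the law of $Y$. Almost everywhere the $F_q$ are at once increasing in $q$ and at most
    1, and the kernel is the law of the associated quantile. Both sides are exhibited as finite
    measures in $B$, so that they can be compared on rational half-lines. *)
Lemma disintegration01 (Y Z : X -> R) : measurable_fun setT Y ->
  measurable_fun setT Z -> (forall x, 0 <= Z x <= 1) ->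
  exists H : R * measurableTypeR R -> R, exists mH : measurable_fun setT H,
  forall A : set R, measurable A ->
  exists m1 : {finite_measure set R -> \bar R},
    (forall B, measurable B ->
      m1 B = (\int[Q]_(x in Y @^-1` A) law_pkernel mH (Y x) B)%E) /\
    (forall B, measurable B -> m1 B = Q (Y @^-1` A `&` Z @^-1` B)).
Proof.
move=> mY mZ Z01.
have mYA A : measurable A -> measurable (Y @^-1` A).
  by move=> mA; rewrite -[X in measurable X]setTI; exact: mY.
have mZA A : measurable A -> measurable (Z @^-1` A).
  by move=> mA; rewrite -[X in measurable X]setTI; exact: mZ.
have i1 : Q.-integrable setT (EFin \o cst (1 : R)).
  apply/integrableP; split; first exact/measurable_EFinP.
  rewrite (eq_integral (cst 1%E)); last by move=> x _; rewrite /= normr1.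
  by rewrite integral_cst//= mul1e.
pose mu : {finite_measure set R -> \bar R} := wpush (fun _ => ler01) i1 mY.
have muE A : measurable A -> mu A = Q (Y @^-1` A) :> \bar R.
  move=> mA; transitivity (\int[Q]_(x in Y @^-1` A) (cst 1%:E x))%E => //.
  by rewrite integral_cst ?mul1e//; exact: mYA.
have mule q : measurable (Z @^-1` `]-oo, ratr q]) by apply: mZA; exact: measurable_itv.
pose nu (q : rat) : {finite_measure set R -> \bar R} :=
  wpush (indic_ge0 (Z @^-1` `]-oo, ratr q]))
        (integrable_indic QT (mule q)) mY.
have nuE q A : measurable A ->
    nu q A = Q (Z @^-1` `]-oo, ratr q] `&` Y @^-1` A) :> \bar R.
  by move=> mA; rewrite -integral_indic//; exact: mYA.
have nule q A : measurable A -> (nu q A <= mu A)%E.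
  move=> mA; rewrite nuE// muE//; apply: le_measure; rewrite ?inE//.
    by apply: measurableI => //; exact: mYA.
  exact: mYA.
have numu q : nu q `<< mu.
  apply/null_content_dominatesP => A mA muA0; apply/eqP.
  by rewrite eq_le measure_ge0 andbT -[leRHS]muA0 nule.
have /choice[F hF] : forall q, exists F : R -> R, [/\ measurable_fun setT F,
    forall y, 0 <= F y, mu.-integrable setT (EFin \o F) &
    forall A, measurable A -> nu q A = (\int[mu]_(y in A) (F y)%:E)%E].
  move=> q; have [f [f0 ffin If fE]] := radon_nikodym_sigma_finite (numu q).
  have fEE : f = EFin \o (fine \o f) by apply/funext => y; rewrite /= fineK.
  exists (fine \o f); split.
  - apply/measurable_EFinP; rewrite -fEE; exact: (measurable_int _ If).
  - by move=> y; exact: fine_ge0.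
  - by rewrite -fEE.
  - by move=> A mA; rewrite fE//; apply: eq_integral => y _; rewrite fineK.
have mF q : measurable_fun setT (F q) by have [] := hF q.
have F0 q y : 0 <= F q y by have [] := hF q.
have FE q A : measurable A -> nu q A = (\int[mu]_(y in A) (F q y)%:E)%E.
  by have [_ _ _] := hF q; exact.
have IF q : mu.-integrable setT (EFin \o F q) by have [] := hF q.
have mono : {ae mu, forall y, forall pq : rat * rat,
    pq.1 <= pq.2 -> F pq.1 y <= F pq.2 y}.
  apply: ae_forall_countable => -[p q] /=.
  have [pq|_] := boolP (p <= q); last by apply: aeW.
  apply: filterS (integral_le_ae (IF p) (IF q) _) => // A mA.
  rewrite -!FE// !nuE//; apply: le_measure; rewrite ?inE.
  - by apply: measurableI => //; exact: mYA.
  - by apply: measurableI => //; exact: mYA.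
  - apply: setSI => x /=; rewrite !in_itv/= => /le_trans; apply.
    by rewrite ler_rat.
have le1 : {ae mu, forall y, forall q : rat, F q y <= 1}.
  apply: ae_forall_countable => q.
  apply: (integral_le_ae (IF q)) => [|A mA].
    apply/integrableP; split; first exact/measurable_EFinP.
    rewrite (eq_integral (cst 1%E)); last by move=> x _; rewrite /= normr1.
    by rewrite integral_cst//= mul1e muE.
  rewrite -FE//; apply: (le_trans (nule _ _ mA)).
  by rewrite integral_cst//= mul1e.
pose H := quantile F; pose mH := measurable_quantile mF.
pose K := law_pkernel mH.
(* In this range a quantile below $q$ forces $t\le F_q(y)$ by monotonicity, which in turn forces a
   quantile at most $q$. For $q<0$ and $q\ge 1$ the bounds 0 and 1 on the quantile and on $Z$
   decide. *)
have Kae : {ae mu, forall y, forall q : rat, 0 <= q -> ratr q < 1 :> R ->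
    (K y `]-oo, ratr q[ <= (F q y)%:E)%E /\ ((F q y)%:E <= K y `]-oo, ratr q])%E}.
  apply: filterS2 mono le1 => y hm h1 q q0 q1.
  rewrite -(@unif01_le R (F q y)) ?F0 ?h1// !law_pkernelE.
  have mle : measurable [set t : measurableTypeR R | t <= F q y].
    rewrite (_ : [set t | _] = `]-oo, F q y]%classic); first exact: measurable_itv.
    by apply/seteqP; split => t /=; rewrite in_itv.
  have mHB B : measurable B -> measurable [set t : measurableTypeR R | B (H (y, t))].
    move=> mB; rewrite -[X in measurable X]setTI.
    exact: (measurableT_comp mH (pair1_measurable y)).
  split; apply: le_measure; rewrite ?inE//.
  - by apply: mHB; exact: measurable_itv.
  - move=> t /=; rewrite in_itv/= => /quantile_lt[|[p [p0 pq tp]]].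
      by rewrite ltNge ltW.
    by apply: (le_trans tp); apply: (hm (p, q)); rewrite -(@ler_rat R) ltW.
  - by apply: mHB; exact: measurable_itv.
  - by move=> t /= tF; rewrite in_itv/=; exact: quantile_le.
exists H, mH => A mA.
have mYAT : measurable ((Y @^-1` A) `*` [set: measurableTypeR R]).
  by apply: measurableX => //; exact: mYA.
have PT : ((Q \x @unif01 R) [set: X * measurableTypeR R] < +oo)%E.
  rewrite -setXTT product_measure1E//.
  apply: lte_mul_pinfty => //; first exact: fin_num_measure.
  by rewrite -ge0_fin_numE//; exact: fin_num_measure.
have mHY : measurable_fun setT (fun p : X * measurableTypeR R => H (Y p.1, p.2)).
  apply: (measurableT_comp mH); apply: measurable_fun_pair => //.
  exact: measurableT_comp mY measurable_fst.
(* The mixture of the kernels over $Y\in A$ is obtained as the law of $H(Y,U)$ under the product of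
   $Q$ and the uniform law, restricted to $Y\in A$, which makes it a finite measure at once. *)
pose m1 : {finite_measure set R -> \bar R} :=
  wpush (indic_ge0 ((Y @^-1` A) `*` [set: measurableTypeR R]))
    (integrable_indic PT mYAT) mHY.
have m1E B : measurable B ->
    m1 B = (\int[Q]_(x in Y @^-1` A) K (Y x) B)%E :> \bar R.
  move=> mB.
  transitivity (\int[Q \x @unif01 R]_(p in
     (fun p : X * measurableTypeR R => H (Y p.1, p.2)) @^-1` B)
     (\1_((Y @^-1` A) `*` [set: measurableTypeR R]) p)%:E)%E => //.
  have mfB : measurable
      ((fun p : X * measurableTypeR R => H (Y p.1, p.2)) @^-1` B).
    rewrite -[X in measurable X]setTI; exact (mHY measurableT B mB).
  rewrite (integral_indic _ mfB mYAT).
  rewrite /product_measure1/= [RHS]integral_mkcond; apply: eq_integral => x _.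
  rewrite patchE; case: ifPn => [|/negP]; rewrite inE/= => YA.
    rewrite law_pkernelE; congr (unif01 _).
    apply/seteqP; split => t; rewrite /xsection/= inE/=; first by case.
    by move=> HB; split.
  rewrite (_ : xsection _ _ = set0) ?measure0//.
  by apply/seteqP; split => t //; rewrite /xsection/= inE/= => -[[]].
pose m2 : {finite_measure set R -> \bar R} :=
  wpush (indic_ge0 (Y @^-1` A)) (integrable_indic QT (mYA _ mA)) mZ.
have m2E B : measurable B -> m2 B = Q (Y @^-1` A `&` Z @^-1` B) :> \bar R.
  by move=> mB; rewrite -(integral_indic Q (mZA _ mB) (mYA _ mA)).
have transfer (k : R -> \bar R) : measurable_fun setT k -> (forall y, 0 <= k y)%E ->
    (\int[mu]_(y in A) k y = \int[Q]_(x in Y @^-1` A) k (Y x))%E.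
  move=> mk k0; rewrite ge0_integral_wpush_in//.
  by apply: eq_integral => x _; rewrite mule1.
have Kitv (i : interval R) : measurable [set` i] -> measurable_fun setT (fun y => K y [set` i]).
  by move=> mi; exact: measurable_kernel.
exists m1; split => // B mB; rewrite -m2E//.
apply: finite_measure_eq_rat_sandwich => // q.
- rewrite m1E//; have [q1|q1] := leP 1 (ratr q : R).
    rewrite m2E// (_ : Z @^-1` _ = setT) ?setIT; last first.
      apply/seteqP; split => x //= _; rewrite in_itv/=.
      by have /andP[_ Zx] := Z01 x; exact: le_trans Zx q1.
    apply: (@le_trans _ _ (\int[Q]_(x in Y @^-1` A) cst 1%E x))%E; last first.
      by rewrite integral_cst ?mul1e//; exact (mYA A mA).
    apply: ge0_le_integral => //; first exact (mYA A mA).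
      apply: measurable_funTS; exact: (measurableT_comp (Kitv _ _) mY).
    move=> x _; rewrite -[leRHS](@prob_kernel _ _ _ _ _ K (Y x)).
    by apply: le_measure; rewrite ?inE//; exact: measurable_itv.
  have [q0|q0] := ltP q 0.
    rewrite integral0_eq ?measure_ge0// => x _; rewrite law_pkernelE.
    rewrite (_ : [set t | _] = set0) ?measure0//.
    apply/seteqP; split => t //=; rewrite in_itv/= => Hq.
    have := quantile_ge0 F (Y x, t); rewrite leNgt => /negP; apply.
    by rewrite (lt_trans Hq)// ltrq0.
  rewrite -(transfer (fun y => K y `]-oo, ratr q[)) => [||//]; last first.
    by apply: Kitv; exact: measurable_itv.
  rewrite m2E// setIC -nuE// FE//.
  apply: ae_ge0_le_integral => //.
  - by apply: measurable_funTS; exact: Kitv.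
  - by move=> y _; rewrite lee_fin.
  - by apply: measurable_funTS; exact/measurable_EFinP.
  - by apply: filterS Kae => y /(_ q q0 q1)[].
- rewrite m1E//; have [q1|q1] := leP 1 (ratr q : R).
    rewrite m2E// (_ : Z @^-1` _ = setT) ?setIT; last first.
      apply/seteqP; split => x //= _; rewrite in_itv/=.
      by have /andP[_ Zx] := Z01 x; exact: le_trans Zx q1.
    rewrite (eq_integral (cst 1%E)); last first.
      move=> x _; rewrite law_pkernelE (_ : [set t | _] = setT) ?probability_setT//.
      apply/seteqP; split => t //= _; rewrite in_itv/=.
      exact: le_trans (quantile_le1 _ _) q1.
    by rewrite integral_cst ?mul1e//; exact (mYA A mA).
  have [q0|q0] := ltP q 0.
    rewrite m2E// (_ : Z @^-1` _ = set0) ?setI0 ?measure0 ?integral_ge0//.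
    apply/seteqP; split => x //=; rewrite in_itv/= => Zq.
    have /andP[] := Z01 x; rewrite leNgt => /negP + _; apply.
    by rewrite (le_lt_trans Zq)// ltrq0.
  rewrite -(transfer (fun y => K y `]-oo, ratr q])) => [||//]; last first.
    by apply: Kitv; exact: measurable_itv.
  rewrite m2E// setIC -nuE// FE//.
  apply: ae_ge0_le_integral => //.
  - by move=> y _; rewrite lee_fin.
  - by apply: measurable_funTS; exact/measurable_EFinP.
  - by apply: measurable_funTS; exact: Kitv.
  - by apply: filterS Kae => y /(_ q q0 q1)[].
Qed.

(* Composing [Z] with the logistic map reduces to a variable valued in [0, 1]. *)
Theorem disintegration (Y Z : X -> R) : measurable_fun setT Y ->
  measurable_fun setT Z ->
  exists K : R.-pker R ~> R, forall A B : set R, measurable A -> measurable B ->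
    Q (Y @^-1` A `&` Z @^-1` B) = (\int[Q]_(x in Y @^-1` A) K (Y x) B)%E.
Proof.
move=> mY mZ.
pose phi (z : R) : R := (1 + expR (- z))^-1.
pose psi (x : R) : R := ln x - ln (1 - x).
have den0 (z : R) : 0 < 1 + expR (- z) by rewrite addr_gt0// expR_gt0.
have mphi : measurable_fun setT phi.
  apply: continuous_measurable_fun => z.
  apply: (@continuousV _ _ (fun z : R => 1 + expR (- z))); first by rewrite gt_eqF.
  have ce : {for z, continuous (fun z : R => expR (- z))}.
    apply: (@continuous_cvg _ _ _ _ _ (fun z : R => - z) expR).
      exact: continuous_expR.
    exact: opp_continuous.
  exact: (cvgD (cvg_cst (1 : R)) ce).
have mpsi : measurable_fun setT psi.
  apply: measurable_funB; first exact: measurable_ln.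
  apply: (measurableT_comp (@measurable_ln R)).
  exact: measurable_funB.
have phi01 z : 0 <= phi z <= 1.
  rewrite /phi invr_ge0 ltW//= invf_le1// lerDl expR_ge0//.
have phiK z : psi (phi z) = z.
  rewrite /psi /phi lnV ?posrE//.
  have -> : 1 - (1 + expR (- z))^-1 = expR (- z) / (1 + expR (- z)).
    by field; rewrite gt_eqF.
  by rewrite ln_div ?posrE ?expR_gt0// expRK; ring.
have mpZ : measurable_fun setT (phi \o Z) by exact: measurableT_comp.
have [H [mH hH]] := disintegration01 mY mpZ (fun x => phi01 (Z x)).
have mpH : measurable_fun setT (psi \o H) by exact: measurableT_comp.
exists (law_pkernel mpH) => A B mA mB.
have mpB : measurable (psi @^-1` B) by rewrite -[X in measurable X]setTI; exact: mpsi.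
have [m1 [h1 h2]] := hH _ mA.
transitivity (m1 (psi @^-1` B)); last by rewrite h1.
rewrite h2//; congr (Q (_ `&` _)).
by apply/seteqP; split => x /=; rewrite phiK.
Qed.

End disintegration.

Lemma sube_eq0P {R : realDomainType} (x y : \bar R) : y \is a fin_num ->
  (x - y = 0)%E <-> x = y.
Proof.
move=> fy; split=> [xy|->]; last exact: subee.
by rewrite -(subeK x fy) xy add0e.
Qed.

Lemma posnegE {R : realDomainType} (a : R) : a = Num.max a 0 - Num.max (- a) 0.
Proof.
have [a0|/ltW a0] := leP a 0.
  by rewrite max_l ?oppr_ge0// sub0r opprK.
by rewrite max_r ?oppr_le0// subr0.
Qed.

(** * Martingales and homogeneity by test functions *)

Section test_functions.
Context d (X : measurableType d) (R : realType).
Variables (m : {measure set X -> \bar R}) (u v : X -> R).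
Hypotheses (u0 : forall x, 0 <= u x) (v0 : forall x, 0 <= v x).
Hypotheses (iu : m.-integrable setT (EFin \o u)) (iv : m.-integrable setT (EFin \o v)).

(** Two maps and two weights are allowed in order to serve both properties: for martingales $f=g$ is
    the past and $u,v$ are the two parts of the increment; for homogeneity $f,g$ are two pairs of
    coordinates and $u,v$ the densities of [theta]. *)
Lemma eq_integral_weighted d' (Y : measurableType d') (f g : X -> Y)
    (phi : Y -> R) :
  measurable_fun setT f -> measurable_fun setT g -> measurable_fun setT phi ->
  (forall C, measurable C ->
    (\int[m]_(x in f @^-1` C) (u x)%:E = \int[m]_(x in g @^-1` C) (v x)%:E)%E) ->
  (\int[m]_x (phi (f x) * u x)%:E = \int[m]_x (phi (g x) * v x)%:E)%E.
Proof.
move=> mf mg mphi h.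
rewrite -(integral_wpush u0 iu mf mphi) -(integral_wpush v0 iv mg mphi).
apply: eq_measure_integral => C mC _; exact: h.
Qed.

Lemma eq_weighted_sets n (f g : X -> n.-tuple R) :
  measurable_fun setT f -> measurable_fun setT g ->
  (forall phi : 'rV[R]_n -> R, continuous phi -> (forall w, 0 <= phi w <= 1) ->
    (\int[m]_x (phi (rowT (f x)) * u x)%:E =
     \int[m]_x (phi (rowT (g x)) * v x)%:E)%E) ->
  forall C, measurable C ->
    (\int[m]_(x in f @^-1` C) (u x)%:E = \int[m]_(x in g @^-1` C) (v x)%:E)%E.
Proof.
move=> mf mg h C mC.
apply: (measure_eq_test (nu1 := wpush u0 iu mf) (nu2 := wpush v0 iv mg)) => //.
move=> phi cphi phi01.
rewrite (integral_wpush u0 iu mf (measurable_continuous_rowT cphi)).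
rewrite (integral_wpush v0 iv mg (measurable_continuous_rowT cphi)).
exact: h.
Qed.

End test_functions.

Section integrable_aux.
Context d (X : measurableType d) (R : realType).
Variables (m : {measure set X -> \bar R}).

Lemma integrable_bounded_mul (p w : X -> R) M :
  measurable_fun setT p -> (forall x, `|p x| <= M) ->
  m.-integrable setT (EFin \o w) ->
  m.-integrable setT (fun x => (p x * w x)%:E).
Proof.
move=> mp pM iw.
have mw : measurable_fun setT w by exact/measurable_EFinP/(measurable_int _ iw).
apply: (@le_integrable _ _ _ _ _ measurableT _ (fun x => M%:E * (w x)%:E)%E).
- by apply/measurable_EFinP; exact: measurable_funM.
- move=> x _ /=; rewrite lee_fin !normrM ler_wpM2r//.
  by rewrite (le_trans (pM x))// ler_norm.
- exact: integrableZl.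
Qed.

End integrable_aux.

Section martingale_test.
Context {R : realType} {T : nat}.
Variable Q : probability (T.-tuple R) R.

Definition prefix_tuple (t : nat) (x : T.-tuple R) : t.+1.-tuple R :=
  [tuple coord x i | i < t.+1].

Lemma rowT_prefix t x : rowT (prefix_tuple t x) = rowUpTo t x.
Proof. by apply/rowP => i; rewrite !mxE tnth_mktuple. Qed.

Lemma measurable_coord k : measurable_fun setT (fun x : T.-tuple R => coord x k).
Proof.
have [kT|kT] := ltnP k T; last first.
  rewrite (_ : (fun x => _) = cst 0); first exact: measurable_cst.
  by apply/funext => x; rewrite /coord nth_default// size_tuple.
rewrite (_ : (fun x => _) = (fun x : T.-tuple R => tnth x (Ordinal kT))).
  exact: measurable_tnth.
by apply/funext => x; rewrite (tnth_nth 0).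
Qed.

Lemma measurable_prefix t : measurable_fun setT (prefix_tuple t).
Proof.
apply/measurable_fun_tnthP => i.
rewrite (_ : _ \o _ = fun x => coord x i); first exact: measurable_coord.
by apply/funext => x /=; rewrite tnth_mktuple.
Qed.

Lemma natural_filtrationE t (B : set (T.-tuple R)) :
  natural_filtration t B <->
  exists2 C, measurable C & B = prefix_tuple t @^-1` C.
Proof.
rewrite /natural_filtration.
have -> : (fun (i : 'I_t.+1) (x : T.-tuple R) => coord x i) =
    (fun i => (@tnth _ R)^~ i \o prefix_tuple t).
  by apply/funext => i; apply/funext => x /=; rewrite tnth_mktuple.
rewrite g_sigma_preimage_comp; split=> [[C mC <-]|[C mC ->]].
  by exists C => //; rewrite setTI.
by exists C => //; rewrite setTI.
Qed.

(** The increment is signed, so it is split into positive and negative parts. Both conditions then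
    say that the two parts have the same image measure under the past, which sets and continuous
    tests detect equally well. Integrability permits moving one part across the equation. *)
Lemma martingale_testP t :
  Q.-integrable setT (fun x => (coord x t)%:E) ->
  Q.-integrable setT (fun x => (coord x t.+1)%:E) ->
  (forall B, natural_filtration t B ->
    (\int[Q]_(x in B) (coord x t.+1)%:E = \int[Q]_(x in B) (coord x t)%:E)%E) <->
  (forall vt : 'rV[R]_t.+1 -> R, Cb vt ->
    (\int[Q]_x (vt (rowUpTo t x) * (coord x t.+1 - coord x t))%:E = 0)%E).
Proof.
move=> i0 i1.
pose D (x : T.-tuple R) : R := coord x t.+1 - coord x t.
have iD : Q.-integrable setT (EFin \o D).
  by have := integrableB measurableT i1 i0; apply: eq_integrable.
have mD : measurable_fun setT D by apply: measurable_funB; exact: measurable_coord.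
pose u x : R := Num.max (D x) 0; pose v x : R := Num.max (- D x) 0.
have u0 x : 0 <= u x by rewrite le_max lexx orbT.
have v0 x : 0 <= v x by rewrite le_max lexx orbT.
have uvD x : D x = u x - v x.
  exact: posnegE.
have iu : Q.-integrable setT (EFin \o u).
  apply: (le_integrable measurableT _ _ iD).
    by apply/measurable_EFinP; exact: measurable_maxr.
  move=> x _ /=; rewrite lee_fin ger0_norm//.
  by rewrite /u ge_max ler_norm normr_ge0.
have iv : Q.-integrable setT (EFin \o v).
  apply: (le_integrable measurableT _ _ iD).
    by apply/measurable_EFinP; apply: measurable_maxr => //; exact: measurableT_comp.
  move=> x _ /=; rewrite lee_fin ger0_norm//.
  by rewrite /v ge_max -normrN ler_norm normr_ge0.
have mpre C : measurable C -> measurable (prefix_tuple t @^-1` C).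
  by move=> mC; rewrite -[X in measurable X]setTI; exact: measurable_prefix.
have setsP C : measurable C ->
    (\int[Q]_(x in prefix_tuple t @^-1` C) (coord x t.+1)%:E =
     \int[Q]_(x in prefix_tuple t @^-1` C) (coord x t)%:E)%E <->
    (\int[Q]_(x in prefix_tuple t @^-1` C) (u x)%:E =
     \int[Q]_(x in prefix_tuple t @^-1` C) (v x)%:E)%E.
  move=> mC; have mB := mpre C mC.
  have sub f : Q.-integrable setT f -> Q.-integrable (prefix_tuple t @^-1` C) f.
    exact: integrableS.
  have e1 : (\int[Q]_(x in prefix_tuple t @^-1` C) (D x)%:E =
     \int[Q]_(x in prefix_tuple t @^-1` C) (coord x t.+1)%:E -
     \int[Q]_(x in prefix_tuple t @^-1` C) (coord x t)%:E)%E.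
    by rewrite -integralB//; exact: sub.
  have e2 : (\int[Q]_(x in prefix_tuple t @^-1` C) (D x)%:E =
     \int[Q]_(x in prefix_tuple t @^-1` C) (u x)%:E -
     \int[Q]_(x in prefix_tuple t @^-1` C) (v x)%:E)%E.
    rewrite -integralB_EFin//; [|exact: sub|exact: sub].
    by apply: eq_integral => x _; rewrite uvD EFinB.
  have f1 : (\int[Q]_(x in prefix_tuple t @^-1` C) (coord x t)%:E)%E \is a fin_num.
    by apply: integrable_fin_num => //; exact: sub.
  have f2 : (\int[Q]_(x in prefix_tuple t @^-1` C) (v x)%:E)%E \is a fin_num.
    by apply: integrable_fin_num => //; exact: sub.
  apply: (iff_trans (iff_sym (sube_eq0P _ f1))).
  by apply: (iff_trans _ (sube_eq0P _ f2)); rewrite -e1 -e2.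
have tests vt : Cb vt ->
    (\int[Q]_x (vt (rowUpTo t x) * D x)%:E =
     \int[Q]_x (vt (rowT (prefix_tuple t x)) * u x)%:E -
     \int[Q]_x (vt (rowT (prefix_tuple t x)) * v x)%:E)%E /\
    (\int[Q]_x (vt (rowT (prefix_tuple t x)) * v x)%:E)%E \is a fin_num.
  move=> [cvt [M vtM]].
  have mvt : measurable_fun setT (fun x => vt (rowT (prefix_tuple t x))).
    exact: (measurableT_comp (measurable_continuous_rowT cvt) (@measurable_prefix t)).
  have iuv := integrable_bounded_mul mvt (fun x => vtM _) iu.
  have ivv := integrable_bounded_mul mvt (fun x => vtM _) iv.
  split; last exact: integrable_fin_num.
  rewrite -integralB//; apply: eq_integral => x _.
  by rewrite -rowT_prefix uvD mulrBr EFinB.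
split=> [h vt Cvt|h B /natural_filtrationE[C mC ->]].
  have [-> fv] := tests vt Cvt; apply/(sube_eq0P _ fv).
  apply: (eq_integral_weighted u0 v0 iu iv (phi := fun y => vt (rowT y))).
  - exact: measurable_prefix.
  - exact: measurable_prefix.
  - exact: measurable_continuous_rowT Cvt.1.
  - by move=> C mC; apply/(setsP C mC); apply: h; apply/natural_filtrationE; exists C.
apply/(setsP C mC).
apply: (eq_weighted_sets u0 v0 iu iv (@measurable_prefix t) (@measurable_prefix t) _ mC).
move=> phi cphi phi01.
have Cphi : Cb phi.
  by split => //; exists 1 => w; have /andP[p0 p1] := phi01 w; rewrite ger0_norm.
have [e fv] := tests phi Cphi; apply/(sube_eq0P _ fv).
by rewrite -e; exact: h.
Qed.

End martingale_test.

Lemma integrable_bounded d (X : measurableType d) (R : realType)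
    (m : {finite_measure set X -> \bar R}) (p : X -> R) M :
  measurable_fun setT p -> (forall x, `|p x| <= M) ->
  m.-integrable setT (EFin \o p).
Proof.
move=> mp pM; apply: (@le_integrable _ _ _ _ _ measurableT _ (cst M%:E)).
- exact/measurable_EFinP.
- by move=> x _ /=; rewrite lee_fin (le_trans (pM x))// ler_norm.
- apply/integrableP; split => //; rewrite integral_cst//= lte_mul_pinfty//.
  by rewrite -ge0_fin_numE//; exact: fin_num_measure.
Qed.

Section kernel_density.
Context d (X : measurableType d) (R : realType) (Q : probability X R).
Variables (Y Z : X -> R) (K : R.-pker R ~> R).
Hypotheses (mY : measurable_fun setT Y) (mZ : measurable_fun setT Z).
Hypothesis hK : forall A B : set R, measurable A -> measurable B ->
  Q (Y @^-1` A `&` Z @^-1` B) = (\int[Q]_(x in Y @^-1` A) K (Y x) B)%E.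
Variables (mu th : {finite_measure set R -> \bar R}) (dd : R -> R).
Hypothesis muE : forall A : set R, measurable A -> Q (Y @^-1` A) = mu A.
Hypothesis Cdd : Cb dd.
Hypothesis thE : forall A : set R, measurable A ->
  th A = (\int[mu]_(y in A) (dd y)%:E)%E.

(* A continuous version of the density may be negative off the support. *)
Let w (y : R) : R := Num.max (dd y) 0.

Let mdd : measurable_fun setT dd.
Proof. exact: continuous_measurable_fun Cdd.1. Qed.

Let mw : measurable_fun setT w.
Proof. exact: measurable_maxr. Qed.

Let w0 y : 0 <= w y.
Proof. by rewrite le_max lexx orbT. Qed.

Let wM : exists M : R, forall y, `|w y| <= M.
Proof.
have [_ [M ddM]] := Cdd; exists M => y; rewrite ger0_norm// ge_max.
by rewrite (le_trans (ler_norm _) (ddM y))/= (le_trans _ (ddM y)).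
Qed.

Let mYA A : measurable A -> measurable (Y @^-1` A).
Proof. by move=> mA; rewrite -[X in measurable X]setTI; exact: mY. Qed.

Let mZA A : measurable A -> measurable (Z @^-1` A).
Proof. by move=> mA; rewrite -[X in measurable X]setTI; exact: mZ. Qed.

(** Every integral of the density over a set is a value of the measure [th], hence nonnegative. *)
Lemma density_ge0_ae : {ae mu, forall y, 0 <= dd y}.
Proof.
have [_ [M ddM]] := Cdd.
apply: integral_le_ae.
- apply: (@integrable_bounded _ _ _ _ _ 0) => //=.
  by move=> x; rewrite normr0.
- exact: (integrable_bounded mu mdd ddM).
- by move=> A mA; rewrite -thE// integral0_eq.
Qed.

Lemma density_pos_ae : {ae Q, forall x, dd (Y x) = w (Y x)}.
Proof.
have [N [mN muN sN]] := density_ge0_ae.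
exists (Y @^-1` N); split; first exact: mYA.
  by rewrite muE.
move=> x /= nx; apply: sN => /= d0; apply: nx.
by rewrite /w max_l.
Qed.

Let i1 : Q.-integrable setT (EFin \o cst (1 : R)).
Proof.
by apply: (@integrable_bounded _ _ _ _ _ 1) => // x; rewrite normr1.
Qed.

Lemma integral_law (A : set R) (k : R -> \bar R) : measurable A ->
  measurable_fun setT k -> (forall y, 0 <= k y)%E ->
  (\int[mu]_(y in A) k y = \int[Q]_(x in Y @^-1` A) k (Y x))%E.
Proof.
move=> mA mk k0.
transitivity (\int[wpush (fun=> ler01) i1 mY]_(y in A) k y)%E.
  apply: eq_measure_integral => C mC _; apply: etrans (esym (muE mC)) _.
  apply/esym; transitivity (\int[Q]_(x in Y @^-1` C) (cst 1%E x))%E => //.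
  by rewrite integral_cst ?mul1e//; exact: mYA.
by rewrite ge0_integral_wpush_in//; apply: eq_integral => x _; rewrite mule1.
Qed.

(** On rectangles, the law of $(Y,Z)$ weighted by the density is $\theta\otimes K$. The law of $Y$
    restricted to $Z\in B$ has density $K(\cdot,B)$ with respect to [mu]; integrating $w$ against it
    and exchanging the two densities gives the integral of $K(\cdot,B)$ against [th]. *)
Lemma kernel_integral_density (A B : set R) : measurable A -> measurable B ->
  (\int[Q]_(x in Y @^-1` A `&` Z @^-1` B) (w (Y x))%:E =
   \int[th]_(y in A) K y B)%E.
Proof.
move=> mA mB.
have mKB : measurable_fun setT (fun y => K y B) by exact: measurable_kernel.
have K0 y : (0 <= K y B)%E by [].
have Kfin y : K y B \is a fin_num.
  rewrite ge0_fin_numE// (le_lt_trans _ (ltry 1))//.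
  rewrite -(@prob_kernel _ _ _ _ _ K y); apply: le_measure; rewrite ?inE//.
pose kB y := fine (K y B).
have kB0 y : 0 <= kB y by exact: fine_ge0.
have mkB : measurable_fun setT kB.
  by apply/measurable_EFinP; rewrite (_ : _ \o _ = fun y => K y B)//;
    apply/funext => y; rewrite /kB/= fineK.
have kB1 y : `|kB y| <= 1.
  rewrite ger0_norm// -lee_fin fineK//.
  by rewrite -(@prob_kernel _ _ _ _ _ K y); apply: le_measure; rewrite ?inE.
have [M hM] := wM.
have iw := integrable_bounded mu mw hM.
have ik := integrable_bounded mu mkB kB1.
have mid : measurable_fun setT (@id R) by exact: measurable_id.
have -> : (\int[th]_(y in A) K y B = \int[wpush w0 iw mid]_(y in A) K y B)%E.
  apply: eq_measure_integral => C mC CA; apply: (etrans (thE mC)).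
  transitivity (\int[mu]_(y in C) (w y)%:E)%E => //.
  apply: ae_eq_integral => //.
  - by apply: measurable_funTS; exact/measurable_EFinP.
  - by apply: measurable_funTS; exact/measurable_EFinP.
  - by apply: filterS density_ge0_ae => y d0 _ /=; rewrite /w max_l.
rewrite ge0_integral_wpush_in//.
have mZB := mZA mB.
have iZ : Q.-integrable setT (EFin \o (\1_(Z @^-1` B) : X -> R)).
  by apply: integrable_indic => //; rewrite -ge0_fin_numE//; exact: fin_num_measure.
have Z0 x : 0 <= \1_(Z @^-1` B) x :> R by rewrite indicE.
transitivity (\int[wpush Z0 iZ mY]_(y in A) (w y)%:E)%E.
  rewrite ge0_integral_wpush_in//; last exact/measurable_EFinP.
  rewrite integral_mkcondr; apply: eq_integral => x _.
  by rewrite patchE indicE; case: ifP; rewrite ?mule1 ?mule0.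
transitivity (\int[wpush kB0 ik mid]_(y in A) (w y)%:E)%E.
  apply: eq_measure_integral => C mC _.
  transitivity (Q (Z @^-1` B `&` Y @^-1` C)).
    by rewrite -(integral_indic Q (mYA mC) mZB).
  rewrite setIC hK// -(integral_law mC mKB K0).
  by apply: eq_integral => y _; rewrite /kB fineK.
rewrite ge0_integral_wpush_in//; last exact/measurable_EFinP.
by apply: eq_integral => y _; rewrite /= /kB fineK// muleC.
Qed.

Lemma integral_density_pos (g : X -> R) : measurable_fun setT g ->
  (\int[Q]_x (g x * dd (Y x))%:E = \int[Q]_x (g x * w (Y x))%:E)%E.
Proof.
move=> mg; apply: ae_eq_integral => //.
- by apply/measurable_EFinP/measurable_funM => //; exact: measurableT_comp.
- by apply/measurable_EFinP/measurable_funM => //; exact: measurableT_comp.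
- by apply: filterS density_pos_ae => x /= -> _.
Qed.

End kernel_density.

Section pair_tuple.
Context {R : realType}.

(** The comparison of measures by tests is stated for tuples, whereas the instruments are functions
    on [R * R]. *)
Definition pair_tuple (y z : R) : 2.-tuple R := [tuple y; z].

Lemma measurable_pair_tuple d (X : measurableType d) (Y Z : X -> R) :
  measurable_fun setT Y -> measurable_fun setT Z ->
  measurable_fun setT (fun x => pair_tuple (Y x) (Z x)).
Proof.
move=> mY mZ; apply/measurable_fun_tnthP => -[[|[|//]] i] //=.
Qed.

Lemma rectangle_measure_eq (m1 m2 : {finite_measure set (2.-tuple R) -> \bar R}) :
  (forall A B : set R, measurable A -> measurable B ->
    m1 [set p | A (tnth p ord0) /\ B (tnth p ord_max)] =
    m2 [set p | A (tnth p ord0) /\ B (tnth p ord_max)]) ->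
  forall C, measurable C -> m1 C = m2 C.
Proof.
move=> h C mC.
pose G : set (set (2.-tuple R)) := [set D | exists A B : set R,
  [/\ measurable A, measurable B &
   D = [set p | A (tnth p ord0) /\ B (tnth p ord_max)]]].
have GT : G setT.
  by exists setT, setT; split => //; apply/seteqP; split.
apply: (measure_unique G (fun=> setT)) => //.
- apply/seteqP; split.
    apply: smallest_sub; first exact: smallest_sigma_algebra.
    rewrite -bigcup_mkord_ord; apply: bigcup_sub => i /= i2 D [A mA <-].
    apply: sub_sigma_algebra.
    move: i2; case: i => [|[|//]] _.
      exists A, setT; split => //; apply/seteqP; split => p /=.
        by rewrite (_ : inord 0 = ord0) => [[]|]; last by apply/val_inj; rewrite /= inordK.
      by rewrite (_ : inord 0 = ord0) => [[]|]; last by apply/val_inj; rewrite /= inordK.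
    exists setT, A; split => //; apply/seteqP; split => p /=.
      by rewrite (_ : inord 1 = ord_max) => [[]|]; last by apply/val_inj; rewrite /= inordK.
    by rewrite (_ : inord 1 = ord_max) => [[]|]; last by apply/val_inj; rewrite /= inordK.
  apply: smallest_sub; first exact: sigma_algebra_measurable.
  move=> _ [A [B [mA mB ->]]]; apply: measurableI.
    by rewrite -[X in measurable X]setTI; exact: (measurable_tnth (ord0 : 'I_2)).
  by rewrite -[X in measurable X]setTI; exact: (measurable_tnth (ord_max : 'I_2)).
- move=> _ _ [A1 [B1 [mA1 mB1 ->]]] [A2 [B2 [mA2 mB2 ->]]].
  exists (A1 `&` A2), (B1 `&` B2); split; [exact: measurableI|exact: measurableI|].
  by apply/seteqP; split => p /=; tauto.
- by rewrite bigcup_const//; exists 0%N.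
- by move=> _ [A [B [mA mB ->]]]; exact: h.
- by move=> k; rewrite -ge0_fin_numE//; exact: fin_num_measure.
Qed.

Lemma continuous_pair_row (g : R * R -> R) : continuous g ->
  continuous (fun v : 'rV[R]_2 => g (v ord0 ord0, v ord0 ord_max)).
Proof.
move=> cg v.
have h : ((w : 'rV[R]_2) ord0 ord0, w ord0 ord_max) @[w --> v] -->
    (v ord0 ord0, v ord0 ord_max).
  exact: (cvg_pair (@coord_continuous R 1 2 ord0 ord0 v)
                   (@coord_continuous R 1 2 ord0 ord_max v)).
exact: (cvg_comp _ _ h (cg _)).
Qed.

Lemma continuous_row_pair (phi : 'rV[R]_2 -> R) : continuous phi ->
  continuous (fun p : R * R => phi (rowT (pair_tuple p.1 p.2))).
Proof.
move=> cphi p.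
have h : rowT (pair_tuple q.1 q.2) @[q --> p] --> rowT (pair_tuple p.1 p.2).
  apply/cvg_ballP => e e0.
  exists (ball p.1 e, ball p.2 e) => /=; first by split; exact: nbhsx_ballx.
  move=> q [q1 q2]; apply: ball_rowP => // i.
  by rewrite !mxE; case: i => -[|[|//]] ?; [exact: q1|exact: q2].
exact: (cvg_comp _ _ h (cphi _)).
Qed.

End pair_tuple.

Section homogeneity_test.
Context d (X : measurableType d) (R : realType) (Q : probability X R).
Variables (Y1 Z1 Y2 Z2 : X -> R) (K1 K2 : R.-pker R ~> R).
Hypotheses (mY1 : measurable_fun setT Y1) (mZ1 : measurable_fun setT Z1).
Hypotheses (mY2 : measurable_fun setT Y2) (mZ2 : measurable_fun setT Z2).
Hypothesis hK1 : forall A B : set R, measurable A -> measurable B ->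
  Q (Y1 @^-1` A `&` Z1 @^-1` B) = (\int[Q]_(x in Y1 @^-1` A) K1 (Y1 x) B)%E.
Hypothesis hK2 : forall A B : set R, measurable A -> measurable B ->
  Q (Y2 @^-1` A `&` Z2 @^-1` B) = (\int[Q]_(x in Y2 @^-1` A) K2 (Y2 x) B)%E.
Variables (mu1 mu2 th : {finite_measure set R -> \bar R}) (d1 d2 : R -> R).
Hypothesis mu1E : forall A : set R, measurable A -> Q (Y1 @^-1` A) = mu1 A.
Hypothesis mu2E : forall A : set R, measurable A -> Q (Y2 @^-1` A) = mu2 A.
Hypotheses (Cd1 : Cb d1) (Cd2 : Cb d2).
Hypothesis thE1 : forall A : set R, measurable A ->
  th A = (\int[mu1]_(y in A) (d1 y)%:E)%E.
Hypothesis thE2 : forall A : set R, measurable A ->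
  th A = (\int[mu2]_(y in A) (d2 y)%:E)%E.

Let w1 x : R := Num.max (d1 (Y1 x)) 0.
Let w2 x : R := Num.max (d2 (Y2 x)) 0.

Let w10 x : 0 <= w1 x. Proof. by rewrite le_max lexx orbT. Qed.
Let w20 x : 0 <= w2 x. Proof. by rewrite le_max lexx orbT. Qed.

Let integrable_weight (Y : X -> R) (dd : R -> R) : measurable_fun setT Y -> Cb dd ->
  Q.-integrable setT (fun x => (Num.max (dd (Y x)) 0)%:E).
Proof.
move=> mY [cdd [M ddM]]; apply: (@integrable_bounded _ _ _ _ _ M).
  apply: measurable_maxr => //.
  exact: (measurableT_comp (continuous_measurable_fun cdd)).
move=> x; rewrite ger0_norm ?le_max ?lexx ?orbT// ge_max.
by rewrite (le_trans (ler_norm _) (ddM _))/= (le_trans _ (ddM (Y x))).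
Qed.

Let iw1 := integrable_weight mY1 Cd1.
Let iw2 := integrable_weight mY2 Cd2.
Let mp1 := measurable_pair_tuple mY1 mZ1.
Let mp2 := measurable_pair_tuple mY2 mZ2.

Let rect1 A B : measurable A -> measurable B ->
  (\int[Q]_(x in (fun x => pair_tuple (Y1 x) (Z1 x)) @^-1`
     [set p | A (tnth p ord0) /\ B (tnth p ord_max)]) (w1 x)%:E =
   \int[th]_(y in A) K1 y B)%E.
Proof.
by move=> mA mB; rewrite -(kernel_integral_density mY1 mZ1 hK1 mu1E Cd1 thE1 mA mB).
Qed.

Let rect2 A B : measurable A -> measurable B ->
  (\int[Q]_(x in (fun x => pair_tuple (Y2 x) (Z2 x)) @^-1`
     [set p | A (tnth p ord0) /\ B (tnth p ord_max)]) (w2 x)%:E =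
   \int[th]_(y in A) K2 y B)%E.
Proof.
by move=> mA mB; rewrite -(kernel_integral_density mY2 mZ2 hK2 mu2E Cd2 thE2 mA mB).
Qed.

Let mcomp (g : R * R -> R) (Y Z : X -> R) : continuous g ->
  measurable_fun setT Y -> measurable_fun setT Z ->
  measurable_fun setT (fun x => g (Y x, Z x)).
Proof.
move=> cg mY mZ.
have := measurableT_comp (measurable_continuous_rowT (continuous_pair_row cg))
  (measurable_pair_tuple mY mZ).
congr measurable_fun; apply/funext => x /=.
by rewrite !mxE.
Qed.

Let weights (g : R * R -> R) : continuous g ->
  (\int[Q]_x (g (Y1 x, Z1 x) * d1 (Y1 x))%:E =
   \int[Q]_x (g (Y1 x, Z1 x) * w1 x)%:E)%E /\
  (\int[Q]_x (g (Y2 x, Z2 x) * d2 (Y2 x))%:E =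
   \int[Q]_x (g (Y2 x, Z2 x) * w2 x)%:E)%E.
Proof.
move=> cg; split.
- exact: (integral_density_pos mY1 mu1E Cd1 thE1 (mcomp cg mY1 mZ1)).
- exact: (integral_density_pos mY2 mu2E Cd2 thE2 (mcomp cg mY2 mZ2)).
Qed.

(** The two weighted pair laws are $\theta\otimes K_1$ and $\theta\otimes K_2$; they agree on
    rectangles, hence on all sets and against all tests. *)
Lemma homogeneous_test : {ae th, forall y, forall B, measurable B -> K1 y B = K2 y B} ->
  forall g : R * R -> R, Cb g ->
  (\int[Q]_x (g (Y1 x, Z1 x) * d1 (Y1 x))%:E =
   \int[Q]_x (g (Y2 x, Z2 x) * d2 (Y2 x))%:E)%E.
Proof.
move=> hae g [cg _]; have [-> ->] := weights cg.
have mphi := measurable_continuous_rowT (continuous_pair_row cg).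
have sets C : measurable C ->
  (\int[Q]_(x in (fun x => pair_tuple (Y1 x) (Z1 x)) @^-1` C) (w1 x)%:E =
   \int[Q]_(x in (fun x => pair_tuple (Y2 x) (Z2 x)) @^-1` C) (w2 x)%:E)%E.
  apply: (rectangle_measure_eq (m1 := wpush w10 iw1 mp1) (m2 := wpush w20 iw2 mp2)).
  move=> A B mA mB; apply: (etrans (rect1 mA mB)); apply: etrans (esym (rect2 mA mB)).
  apply: ae_eq_integral => //.
  - by apply: measurable_funTS; exact: measurable_kernel.
  - by apply: measurable_funTS; exact: measurable_kernel.
  - by apply: filterS hae => y h _; exact: h.
have := eq_integral_weighted w10 w20 iw1 iw2 mp1 mp2 mphi sets.
have pairE y z : (rowT (pair_tuple y z) ord0 ord0, rowT (pair_tuple y z) ord0 ord_max) = (y, z).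
  by rewrite !mxE.
under eq_integral do rewrite pairE.
by under [X in _ = X -> _]eq_integral do rewrite pairE.
Qed.

(** Tests identify the two weighted pair laws; on rectangles $A\times B$ with $B$ fixed this gives
    $K_1(\cdot,B)=K_2(\cdot,B)$ outside a null set depending on $B$. Taking for $B$ the rational
    half-lines, which determine a measure, yields one null set for all $B$. *)
Lemma test_homogeneous : (forall g : R * R -> R, Cb g ->
  (\int[Q]_x (g (Y1 x, Z1 x) * d1 (Y1 x))%:E =
   \int[Q]_x (g (Y2 x, Z2 x) * d2 (Y2 x))%:E)%E) ->
  {ae th, forall y, forall B, measurable B -> K1 y B = K2 y B}.
Proof.
move=> h.
have sets C : measurable C ->
  (\int[Q]_(x in (fun x => pair_tuple (Y1 x) (Z1 x)) @^-1` C) (w1 x)%:E =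
   \int[Q]_(x in (fun x => pair_tuple (Y2 x) (Z2 x)) @^-1` C) (w2 x)%:E)%E.
  apply: (eq_weighted_sets w10 w20 iw1 iw2 mp1 mp2) => phi cphi phi01.
  have cg := continuous_row_pair cphi.
  have [e1 e2] := weights cg.
  apply: (etrans (esym e1)); apply: etrans e2.
  apply: (h (fun p : R * R => phi (rowT (pair_tuple p.1 p.2)))); split => //.
  by exists 1 => p; have /andP[? ?] := phi01 (rowT (pair_tuple p.1 p.2)); rewrite ger0_norm.
have Kfin (K : R.-pker R ~> R) y B : measurable B -> (K y B <= 1)%E.
  move=> mB; rewrite -(@prob_kernel _ _ _ _ _ K y); apply: le_measure; rewrite ?inE//.
have Bae B : measurable B -> {ae th, forall y, K1 y B = K2 y B}.
  move=> mB.
  have : ae_eq th setT (fun y => K1 y B) (fun y => K2 y B).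
    apply: integral_ae_eq => //.
    - apply: (@le_integrable _ _ _ _ _ measurableT _ (cst 1%E)).
      + exact: measurable_kernel.
      + by move=> y _; rewrite /= gee0_abs// normr1; exact: Kfin.
      + by apply: (@integrable_bounded _ _ _ _ (cst 1) 1) => // y; rewrite normr1.
    - exact: measurable_kernel.
    - move=> A _ mA; apply: (etrans (esym (rect1 mA mB))).
      apply: etrans (rect2 mA mB); apply: sets.
      apply: measurableI.
        by rewrite -[X in measurable X]setTI; exact: (measurable_tnth (ord0 : 'I_2)).
      by rewrite -[X in measurable X]setTI; exact: (measurable_tnth (ord_max : 'I_2)).
  by apply: filterS => y /(_ I).
have : {ae th, forall y, forall q : rat, K1 y `]-oo, ratr q] = K2 y `]-oo, ratr q]}.
  by apply: ae_forall_countable => q; apply: Bae; exact: measurable_itv.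
apply: filterS => y hq B mB.
apply: (measure_eq_rat_sandwich (m1 := K1 y) (m2 := K2 y)) => //.
- by rewrite (@prob_kernel _ _ _ _ _ K1 y) ltry.
- move=> q; rewrite -hq; apply: le_measure; rewrite ?inE; try exact: measurable_itv.
  by move=> z /=; rewrite !in_itv/=; exact: ltW.
- by move=> q; rewrite hq.
Qed.

End homogeneity_test.

(** * Lebesgue decomposition *)

Section lebesgue_decomposition.
Context {R : realType}.
Implicit Types mu nu th : {measure set R -> \bar R}.

Section finite_measure_add.
Variables m1 m2 : {finite_measure set R -> \bar R}.

Definition finite_add : set R -> \bar R :=
  msum (fun n => if n is 0%N then (m1 : {measure set R -> \bar R}) else m2) 2.

HB.instance Definition _ := Measure.on finite_add.

Lemma finite_addE A : finite_add A = (m1 A + m2 A)%E.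
Proof. by rewrite /finite_add/= /msum 2!big_ord_recl/= big_ord0 adde0. Qed.

Let fin_add : fin_num_fun finite_add.
Proof. by move=> A mA; rewrite finite_addE fin_numD !fin_num_measure. Qed.

HB.instance Definition _ := @Measure_isFinite.Build _ _ _ finite_add fin_add.

End finite_measure_add.

(** [ae_wedge] quantifies over decompositions, so one is required to extract information from it.
    The set [N] where the density of [nu] with respect to [mu + nu] vanishes carries the singular
    part: [nu] does not charge it, and off it a [nu]-null set is null for the sum. *)
Lemma lebesgue_decomp_exists (mu nu : {finite_measure set R -> \bar R}) :
  exists ma ms, lebesgue_decomp mu nu ma ms.
Proof.
pose la : {finite_measure set R -> \bar R} := finite_add mu nu.
have laE A : la A = (mu A + nu A)%E by rewrite [LHS]finite_addE.
have nula : nu `<< la.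
  apply/null_content_dominatesP => A mA laA.
  have /eqP : (mu A + nu A = 0)%E := etrans (esym (laE A)) laA.
  by rewrite padde_eq0// => /andP[_ /eqP].
have [f [f0 ffin If fE]] := radon_nikodym_sigma_finite nula.
have mf := measurable_int _ If.
pose N := f @^-1` [set 0%E].
have mN : measurable N by rewrite -[X in measurable X]setTI; exact: mf.
have nuN : nu N = 0%E.
  by rewrite fE// (eq_integral (cst 0%E)) ?integral0// => x; rewrite inE.
exists (mrestr mu (measurableC mN)), (mrestr mu mN); split; last split.
- by move=> A mA; rewrite (measureDI _ mA mN) setDE.
- apply/null_content_dominatesP => A mA nuA; rewrite /= /mrestr.
  have mAN : measurable (A `&` ~` N) by apply: measurableI => //; exact: measurableC.
  have : ae_eq la A f (cst 0%E).
    apply/(ae_eq_integral_abs _ mA (measurable_funTS mf)).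
    apply: etrans nuA; apply: etrans (esym (fE _ mA)).
    by apply: eq_integral => x _; rewrite gee0_abs.
  move=> aef.
  have : la (A `&` ~` N) = 0%E.
    apply/negligibleP => //; apply: negligibleS aef => x [Ax Nx] /=.
    by move=> /(_ Ax).
  move=> laA.
  have /eqP : (mu (A `&` ~` N) + nu (A `&` ~` N) = 0)%E.
    exact: etrans (esym (laE _)) laA.
  by rewrite padde_eq0// => /andP[/eqP].
- exists N; split => //; split => //=.
  by rewrite /mrestr setICl measure0.
Qed.

(** The set is split along the [nu]-null set [N] that carries [ms]: inside [N], [th] vanishes
    because it is dominated by [nu]; outside, [mu] coincides with [ma], and [th] is dominated by
    [mu]. *)
Lemma decomp_null_dominated mu nu th ma ms Z : lebesgue_decomp mu nu ma ms ->
  (forall A, measurable A -> mu A = 0%E -> th A = 0%E) ->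
  (forall A, measurable A -> nu A = 0%E -> th A = 0%E) ->
  measurable Z -> ma Z = 0%E -> th Z = 0%E.
Proof.
move=> [muE [_ [N [mN [nuN msN]]]]] thmu thnu mZ maZ.
have mZN : measurable (Z `\` N) by exact: measurableD.
have -> : th Z = (th (Z `\` N) + th (Z `&` N))%E by exact: measureDI.
rewrite thmu// ?add0e.
  apply/eqP; rewrite eq_le measure_ge0 andbT -(thnu _ mN nuN).
  by apply: le_measure; rewrite ?inE//; exact: measurableI.
have -> : mu (Z `\` N) = (ma (Z `\` N) + ms (Z `\` N))%E by exact: muE.
have -> : ma (Z `\` N) = 0%E by exact: subset_measure0 (@subDsetl _ _ _) maZ.
have -> : ms (Z `\` N) = 0%E.
  by apply: subset_measure0 msN => [//||x []//]; exact: measurableC.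
by rewrite adde0.
Qed.

(* The two absolutely continuous parts of a pair of measures have the same null
   sets, although they are parts of different measures. *)
Lemma decomp_null_sym (mu nu : {finite_measure set R -> \bar R}) th ma ms Z :
  lebesgue_decomp mu nu ma ms ->
  (forall na ns, lebesgue_decomp nu mu na ns -> na `<< th) ->
  measurable Z -> th Z = 0%E -> ma Z = 0%E.
Proof.
move=> [muE [manu _]] h mZ thZ.
have [na [ns d]] := lebesgue_decomp_exists nu mu.
have /null_content_dominatesP nath := h _ _ d.
have naZ := nath _ mZ thZ.
have [nuE [_ [N [mN [muN nsN]]]]] := d.
have mZN : measurable (Z `\` N) by exact: measurableD.
move: manu => /null_content_dominatesP manu.
have -> : ma Z = (ma (Z `\` N) + ma (Z `&` N))%E by exact: measureDI.
rewrite manu// ?add0e.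
  apply/eqP; rewrite eq_le measure_ge0 andbT.
  have <- : ma N = 0%E.
    apply/eqP; rewrite eq_le measure_ge0 andbT -muN muE//.
    by rewrite leeDl.
  by apply: le_measure; rewrite ?inE//; exact: measurableI.
apply: (etrans (nuE _ mZN)).
have -> : na (Z `\` N) = 0%E by exact: subset_measure0 (@subDsetl _ _ _) naZ.
have -> : ns (Z `\` N) = 0%E.
  by apply: subset_measure0 nsN => [//||x []//]; exact: measurableC.
by rewrite adde0.
Qed.

End lebesgue_decomposition.

(** * Marginals and weak duality *)

Section has_int.
Context d (X : measurableType d) (R : realType) (m : {measure set X -> \bar R}).
Implicit Types (f g : X -> R) (r s c : R).

(** Integrability is kept together with a real value of the integral, so that linear combinations
    and comparisons are computed in [R] and not in the extended reals. *)
Definition has_int f r :=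
  m.-integrable setT (EFin \o f) /\ (\int[m]_x (f x)%:E)%E = r%:E.

Lemma has_int_fine f : m.-integrable setT (EFin \o f) ->
  has_int f (fine (\int[m]_x (f x)%:E)%E).
Proof. by move=> If; split => //; rewrite fineK//; exact: integrable_fin_num. Qed.

Lemma has_intD f g r s : has_int f r -> has_int g s ->
  has_int (fun x => f x + g x) (r + s).
Proof.
move=> [If fr] [Ig gs]; split; first exact: (integrableD measurableT If Ig).
by rewrite EFinD -fr -gs -integralD_EFin.
Qed.

Lemma has_intZ f r c : has_int f r -> has_int (fun x => c * f x) (c * r).
Proof.
move=> [If fr]; split; first exact: (integrableZl measurableT c If).
by rewrite EFinM -fr -integralZl.
Qed.

Lemma has_intB f g r s : has_int f r -> has_int g s ->
  has_int (fun x => f x - g x) (r - s).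
Proof.
move=> hf /(has_intZ (- 1)) hg; have := has_intD hf hg.
by rewrite mulN1r; congr has_int; apply/funext => x; rewrite mulN1r.
Qed.

Lemma has_int0 : has_int (fun=> 0) 0.
Proof. by split; [exact: integrable0|rewrite integral0]. Qed.

Lemma has_int_sum (I : finType) (P : pred I) (F : I -> X -> R) (r : I -> R) :
  (forall i, P i -> has_int (F i) (r i)) ->
  has_int (fun x => \sum_(i | P i) F i x) (\sum_(i | P i) r i).
Proof.
move=> h; rewrite -fct_sumE.
elim/big_ind2: _ => //; first exact: has_int0.
by move=> f r' g s'; exact: has_intD.
Qed.

Lemma has_int_le f g r s : has_int f r -> has_int g s ->
  (forall x, f x <= g x) -> r <= s.
Proof.
move=> [If fr] [Ig gs] fg; rewrite -lee_fin -fr -gs.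
by apply: le_integral => // x _; rewrite lee_fin.
Qed.

Lemma has_int_unique f r s : has_int f r -> has_int f s -> r = s.
Proof. by move=> [_ fr] [_]; rewrite fr => -[]. Qed.

End has_int.

Lemma has_int_cst d (X : measurableType d) (R : realType) (P : probability X R) (c : R) :
  has_int P (fun=> c) c.
Proof.
split; last first.
  apply: (etrans (integral_cst P measurableT c%:E)).
  by rewrite [X in (_ * X)%E](_ : _ = 1%E) ?mule1//; exact: probability_setT.
by apply: (@integrable_bounded _ _ _ _ _ `|c|).
Qed.

Section row_tuple.
Context {R : realType}.

Definition row_tuple {n} (v : 'rV[R]_n) : n.-tuple R := [tuple v ord0 i | i < n].

Lemma rowTK n : cancel (@rowT R n) (@row_tuple n).
Proof. by move=> x; apply: eq_from_tnth => i; rewrite tnth_mktuple mxE. Qed.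

Lemma coord_row_tuple n (v : 'rV[R]_n) k (kn : (k < n)%N) :
  coord (row_tuple v) k = v ord0 (Ordinal kn).
Proof. by rewrite /coord -[k]/(val (Ordinal kn)) -tnth_nth tnth_mktuple. Qed.

Lemma coord_oversize n (x : n.-tuple R) k : (n <= k)%N -> coord x k = 0.
Proof. by move=> nk; rewrite /coord nth_default// size_tuple. Qed.

Lemma norm_row_coord n (v : 'rV[R]_n) i : `|v ord0 i| <= `|v|.
Proof.
change (`|v ord0 i| <= mx_norm v); rewrite mx_normrE.
by apply/bigmax_geP; right => /=; exists (ord0, i).
Qed.

Lemma norm_row_attained n (v : 'rV[R]_n) : (0 < n)%N ->
  exists2 k, (k < n)%N & `|v| <= `|coord (row_tuple v) k|.
Proof.
move=> n0; have [v0|/mx_norm_neq0[[i j] /= vE]] := eqVneq (mx_norm v) 0.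
  by exists 0%N => //; rewrite [leLHS]v0.
exists j => //; rewrite coord_row_tuple [leLHS]vE ord1.
by rewrite (_ : Ordinal _ = j)//; exact: val_inj.
Qed.

Lemma norm_coord_row_tuple n (v : 'rV[R]_n) k : `|coord (row_tuple v) k| <= `|v|.
Proof.
have [kn|kn] := ltnP k n; first by rewrite coord_row_tuple norm_row_coord.
by rewrite coord_oversize// normr0.
Qed.

Lemma continuous_coord_row n k :
  continuous (fun v : 'rV[R]_n => coord (row_tuple v) k).
Proof.
have [kn|kn] := ltnP k n.
  rewrite (_ : (fun v => _) = fun v : 'rV[R]_n => v ord0 (Ordinal kn)).
    exact: coord_continuous.
  by apply/funext => v; rewrite coord_row_tuple.
rewrite (_ : (fun v => _) = fun v : 'rV[R]_n => 0); first exact: cst_continuous.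
by apply/funext => v; rewrite coord_oversize.
Qed.

Lemma continuous_rowUpTo n t :
  continuous (fun v : 'rV[R]_n => rowUpTo t (row_tuple v)).
Proof.
suff h (v : 'rV[R]_n) : rowUpTo t (row_tuple w) @[w --> v] -->
    rowUpTo t (row_tuple v) by exact: h.
have Fv : Filter (nbhs v) by exact: nbhs_filter.
apply/(@cvg_ballP _ _ _ (nbhs v) Fv) => e e0.
apply: filterS (nbhsx_ballx v e e0) => w vw.
apply: ball_rowP => // i; rewrite !mxE.
have [kn|kn] := ltnP i n; last by rewrite !coord_oversize// subrr normr0.
by rewrite !coord_row_tuple; case: vw => _; exact.
Qed.

Lemma continuous_coord_comp n k (h : R -> R) : continuous h ->
  continuous (fun v : 'rV[R]_n => h (coord (row_tuple v) k)).
Proof.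
move=> ch v; have c := @continuous_coord_row n k v.
exact: (cvg_comp _ _ c (ch _)).
Qed.

Lemma Clin_coord n k (h : R -> R) : Clin h ->
  Clin (fun v : 'rV[R]_n => h (coord (row_tuple v) k)).
Proof.
move=> /[dup] -[ch _] /Clin_bound[C C0 hC]; split.
  exact: continuous_coord_comp.
exists C => v; rewrite (le_trans (hC _))// ler_wpM2l// lerD2l.
exact: norm_coord_row_tuple.
Qed.

End row_tuple.

Section marginals.
Context {R : realType} {T : nat}.
Variable mu : nat -> probability R R.

Lemma has_int_coord (Q : probability (T.-tuple R) R) t (h : R -> R) r :
  in_Pi mu Q -> (t < T)%N -> measurable_fun setT h -> has_int (mu t) h r ->
  has_int Q (fun x => h (coord x t)) r.
Proof.
move=> hPi tT mh [Ih hr].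
have mc : measurable_fun setT (fun x : T.-tuple R => coord x t) by exact: measurable_coord.
have i1 : Q.-integrable setT (EFin \o cst (1 : R)).
  by apply: (@integrable_bounded _ _ _ _ _ 1) => // x; rewrite normr1.
pose nu := wpush (fun=> ler01) i1 mc.
have nuE A : measurable A -> nu A = mu t A.
  move=> mA; apply: etrans (hPi t tT A mA).
  transitivity (\int[Q]_(x in (fun x : T.-tuple R => coord x t) @^-1` A) (cst 1%E x))%E => //.
  rewrite integral_cst ?mul1e//.
  by rewrite -[X in measurable X]setTI; exact (mc measurableT A mA).
have absE (g : R -> \bar R) : measurable_fun setT g -> (forall y, 0 <= g y)%E ->
    (\int[Q]_x g (coord x t) = \int[mu t]_y g y)%E.
  move=> mg g0.
  transitivity (\int[nu]_y g y)%E.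
    by rewrite ge0_integral_wpush//; apply: eq_integral => x _; rewrite mule1.
  by apply: eq_measure_integral => A mA _; exact: nuE.
split.
  apply/integrableP; split.
    by apply/measurable_EFinP; exact: (measurableT_comp mh mc).
  rewrite (absE (fun y => `|(h y)%:E|)%E)//.
    by move/integrableP : Ih => [].
  by apply: measurableT_comp => //; exact/measurable_EFinP.
rewrite -hr; transitivity (\int[nu]_y (h y)%:E)%E.
  by rewrite integral_wpush//; apply: eq_integral => x _; rewrite mulr1.
by apply: eq_measure_integral => A mA _; exact: nuE.
Qed.

Lemma in_Pi_test (Q : probability (T.-tuple R) R) :
  (forall t, (t < T)%N -> forall h : R -> R, continuous h ->
    (forall y, 0 <= h y <= 1) ->
    (\int[Q]_x (h (coord x t))%:E = \int[mu t]_y (h y)%:E)%E) -> in_Pi mu Q.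
Proof.
move=> hQ t tT A mA.
(* One-tuples bring laws on the line within reach of [measure_eq_test]. *)
pose f (x : T.-tuple R) : 1.-tuple R := [tuple coord x t].
pose g (y : R) : 1.-tuple R := [tuple y].
have mf : measurable_fun setT f.
  apply/measurable_fun_tnthP => i.
  rewrite (_ : _ \o _ = fun x => coord x t); first exact: measurable_coord.
  by apply/funext => x; rewrite ord1.
have mg : measurable_fun setT g.
  apply/measurable_fun_tnthP => i.
  by rewrite (_ : _ \o _ = id)//; apply/funext => x; rewrite ord1.
have i1 : Q.-integrable setT (EFin \o cst (1 : R)).
  by apply: (@integrable_bounded _ _ _ _ _ 1) => // x; rewrite normr1.
have i2 : (mu t).-integrable setT (EFin \o cst (1 : R)).
  by apply: (@integrable_bounded _ _ _ _ _ 1) => // x; rewrite normr1.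
pose C : set (1.-tuple R) := (@tnth _ R)^~ ord0 @^-1` A.
have mC : measurable C.
  by rewrite -[X in measurable X]setTI; exact: (measurable_tnth (ord0 : 'I_1)).
have eC : wpush (fun=> ler01) i1 mf C = wpush (fun=> ler01) i2 mg C.
  apply: (measure_eq_test (nu1 := wpush (fun=> ler01) i1 mf)
    (nu2 := wpush (fun=> ler01) i2 mg)) => // phi cphi phi01.
  have mphi := measurable_continuous_rowT cphi.
  rewrite !integral_wpush//.
  have ch : continuous (fun y : R => phi (rowT (g y))).
    move=> y; have c : rowT (g z) @[z --> y] --> rowT (g y).
      apply/cvg_ballP => e e0; apply/nbhs_ballP; exists e => //= z yz.
      by apply: ball_rowP => // i; rewrite !mxE ord1.
    exact: (cvg_comp _ _ c (cphi _)).
  apply: etrans (etrans _ (hQ t tT _ ch (fun y => phi01 _))) _.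
    by apply: eq_integral => x _; rewrite mulr1.
  by apply: eq_integral => x _; rewrite mulr1.
move: eC; rewrite /wpush (_ : f @^-1` C = (fun x => coord x t) @^-1` A)//.
rewrite (_ : g @^-1` C = A)// => eC.
have mfA : measurable ((fun x : T.-tuple R => coord x t) @^-1` A).
  by rewrite -[X in measurable X]setTI; exact: measurable_coord.
have := integral_cst Q mfA 1%E; have := integral_cst (mu t) mA 1%E.
rewrite !mul1e => e1 e2.
by apply: (etrans (esym e2)); apply: (etrans eC).
Qed.

End marginals.

Section wedge.
Context {R : realType} {T : nat}.
Variable mu : nat -> probability R R.
Variables (theta : nat -> nat -> {finite_measure set R -> \bar R}).
Variables (dth_s dth_t : nat -> nat -> R -> R).
Hypothesis hA : assumptionA T mu theta dth_s dth_t.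
Variable Q : probability (T.-tuple R) R.
Hypothesis hPi : in_Pi mu Q.

Lemma lebesgue_decomp_eq (m m' n n' : set R -> \bar R)
    (ma ms : {measure set R -> \bar R}) :
  (forall A, measurable A -> m A = m' A) -> (forall A, measurable A -> n A = n' A) ->
  lebesgue_decomp m n ma ms -> lebesgue_decomp m' n' ma ms.
Proof.
move=> mm' nn' [mE [man [N [mN [nN msN]]]]]; split; last split.
- by move=> A mA; rewrite -mm'// mE.
- by move=> A nA; apply: man => B mB BA; rewrite nn'//; exact: nA.
- by exists N; split => //; split => //; rewrite -nn'.
Qed.

Let dominated (th m : {finite_measure set R -> \bar R}) (dd : R -> R) :
  Cb dd -> (forall A, measurable A -> th A = (\int[m]_(y in A) (dd y)%:E)%E) ->
  forall A, measurable A -> m A = 0%E -> th A = 0%E.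
Proof.
move=> Cdd thE A mA mA0; apply: (etrans (thE _ mA)); apply: null_set_integral => //.
apply: measurable_funTS; apply/measurable_EFinP.
exact: continuous_measurable_fun Cdd.1.
Qed.

(** Assumption (A) compares $\theta^{s,t}$ with the part of $\mu_t$ with respect to $\mu_s$, while
    the wedge is the part of $\mu_s$ with respect to $\mu_t$. In one direction $\theta^{s,t}$ has
    densities with respect to both measures and so is dominated by that part; in the other the
    symmetry of null sets applies. *)
Lemma ae_wedgeP s t (P : R -> Prop) : (s < T)%N -> (t < T)%N ->
  ae_wedge (marginal Q s) (marginal Q t) P <-> {ae theta s t, forall y, P y}.
Proof.
move=> sT tT; have [thab [Ct [Cs [thEt thEs]]]] := hA sT tT.
split=> [hP|[Z [mZ thZ PZ]] ma ms dec].
  have [ma [ms dec]] := lebesgue_decomp_exists (mu s) (mu t).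
  have dec' : lebesgue_decomp (marginal Q s) (marginal Q t) ma ms.
    by apply: lebesgue_decomp_eq dec => A mA; rewrite hPi.
  have [Z [mZ maZ PZ]] := hP _ _ dec'.
  exists Z; split => //; apply: (decomp_null_dominated dec _ _ mZ maZ).
    exact: (dominated Cs thEs).
  exact: (dominated Ct thEt).
have {}dec : lebesgue_decomp (mu s) (mu t) ma ms.
  by apply: lebesgue_decomp_eq dec => A mA; rewrite hPi.
exists Z; split => //; apply: (decomp_null_sym dec _ mZ thZ) => na ns dec'.
by have [] := thab _ _ dec'.
Qed.

End wedge.

(** * Hedging instruments and the set of dual values *)

Section duality.
Context {R : realType} {T : nat}.
Hypothesis hT : (2 <= T)%N.
Variable mu : nat -> probability R R.
Hypothesis hmom : forall t, (t < T)%N -> finite_first_moment (mu t).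
Variables (theta : nat -> nat -> {finite_measure set R -> \bar R}).
Variables (dth_s dth_t : nat -> nat -> R -> R).
Hypothesis hA : assumptionA T mu theta dth_s dth_t.

Notation V := 'rV[R]_T.
Notation X := (T.-tuple R).

Lemma integrable_Clin t (h : R -> R) : (t < T)%N -> Clin h ->
  (mu t).-integrable setT (EFin \o h).
Proof.
move=> tT /[dup] -[ch _] /Clin_bound[C C0 hC].
apply: (@le_integrable _ _ _ _ _ measurableT _ (fun y : R => (C * (1 + `|y|))%:E)).
- by apply/measurable_EFinP; exact: continuous_measurable_fun.
- move=> y _ /=; rewrite lee_fin (le_trans (hC y))// ler_norm//.
- have /has_int_fine i : (mu t).-integrable setT (EFin \o (fun y : R => `|y|)).
    exact: integrable_norm (hmom tT).
  by have [] := has_intZ C (has_intD (has_int_cst (mu t) 1) i).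
Qed.

Definition marginal_int t (h : R -> R) : R := fine (\int[mu t]_y (h y)%:E)%E.

Lemma has_int_mu t h : (t < T)%N -> Clin h -> has_int (mu t) h (marginal_int t h).
Proof. by move=> tT Ch; apply: has_int_fine; exact: integrable_Clin. Qed.

Definition hedge_static (h : nat -> R -> R) (x : X) : R := \sum_(t < T) h t (coord x t).

Definition hedge_dynamic (vt : forall t : nat, 'rV[R]_t.+1 -> R) (x : X) : R :=
  \sum_(t < T.-1) vt t (rowUpTo t x) * (coord x t.+1 - coord x t).

Definition hom_term (g : R * R -> R) (s t tau : nat) (x : X) : R :=
  g (coord x s, coord x (s + tau)) * dth_s s t (coord x s)
  - g (coord x t, coord x (t + tau)) * dth_t s t (coord x t).

Definition hedge_hom (g : nat -> nat -> nat -> R * R -> R) (x : X) : R :=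
  \sum_(s < T) \sum_(t < T) \sum_(tau < T | inDelta T s t tau)
    hom_term (g s t tau) s t tau x.

(** Dual values are taken as real numbers, as Hahn-Banach requires a real-valued functional; first
    moments make every static cost finite, and [dual_valueE] returns to the extended reals. *)
Definition dual_set (phi : V -> R) : set R :=
  [set r | exists h vt g, dual_admissible phi dth_s dth_t h vt g /\
    r = \sum_(t < T) marginal_int t (h t)].

Lemma dual_valueE (phi : V -> R) h vt g : dual_admissible phi dth_s dth_t h vt g ->
  dual_value T mu h = (\sum_(t < T) marginal_int t (h t))%:E.
Proof.
move=> [Ch _]; rewrite -sumEFin; apply: eq_bigr => t _.
by have [_ ->] := has_int_mu (ltn_ord t) (Ch _ (ltn_ord t)).
Qed.

Lemma has_int_coord_id (Q : probability X R) t : in_Pi mu Q -> (t < T)%N ->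
  Q.-integrable setT (fun x => (coord x t)%:E).
Proof.
move=> hPi tT.
have hm : has_int (mu t) (fun y => y) (fine (\int[mu t]_y y%:E)%E).
  by apply: has_int_fine; exact: hmom.
by have [] := has_int_coord hPi tT (@measurable_id _ R setT) hm.
Qed.

Let bounded_hom_term (Q : probability X R) (g : R * R -> R) s u (dd : R -> R) :
  Cb g -> Cb dd ->
  Q.-integrable setT (fun x => (g (coord x s, coord x u) * dd (coord x s))%:E).
Proof.
move=> [cg [M gM]] [cdd [N ddN]].
have mg : measurable_fun setT (fun x : X => g (coord x s, coord x u)).
  have := measurableT_comp (measurable_continuous_rowT (continuous_pair_row cg))
    (measurable_pair_tuple (@measurable_coord R T s) (@measurable_coord R T u)).
  by congr measurable_fun; apply/funext => x /=; rewrite !mxE.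
have md : measurable_fun setT (fun x : X => dd (coord x s)).
  exact: (measurableT_comp (continuous_measurable_fun cdd) (@measurable_coord R T s)).
apply: (integrable_bounded_mul mg (fun x => gM _)).
exact: (integrable_bounded Q md (fun x => ddN _)).
Qed.

Lemma inDelta_bounds s t tau : inDelta T s t tau ->
  [/\ (s < T)%N, (t < T)%N, (tau < T)%N, (s + tau < T)%N & (t + tau < T)%N].
Proof.
move=> /and3P[st t0 tT]; split => //.
- by rewrite (leq_ltn_trans _ tT)// (leq_trans (ltnW st))// leq_addr.
- by rewrite (leq_ltn_trans _ tT)// leq_addr.
- by rewrite (leq_ltn_trans _ tT)// leq_addl.
- by rewrite (leq_ltn_trans _ tT)// leq_add2r ltnW.
Qed.

Lemma assumptionA_Cb s t tau : inDelta T s t tau -> Cb (dth_s s t) /\ Cb (dth_t s t).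
Proof.
by move=> /inDelta_bounds[sT tT _ _ _]; have [_ [? [? _]]] := hA sT tT.
Qed.

Lemma hom_term_zeroP (Q : probability X R) s t tau (g : R * R -> R) :
  inDelta T s t tau -> Cb g ->
  has_int Q (hom_term g s t tau) 0 <->
  (\int[Q]_x (g (coord x s, coord x (s + tau)) * dth_s s t (coord x s))%:E =
   \int[Q]_x (g (coord x t, coord x (t + tau)) * dth_t s t (coord x t))%:E)%E.
Proof.
move=> D Cg; have [Cs Ct] := assumptionA_Cb D.
have h1 := has_int_fine (bounded_hom_term Q s (s + tau) Cg Cs).
have h2 := has_int_fine (bounded_hom_term Q t (t + tau) Cg Ct).
have h12 := has_intB h1 h2.
have [[_ e1] [_ e2]] := (h1, h2).
split => [h0|e].
  rewrite e1 e2; congr (_%:E); apply/eqP; rewrite -subr_eq0; apply/eqP.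
  exact: has_int_unique h12 h0.
by move: h12; rewrite e subrr.
Qed.

(** Under (A) both sides express $\theta^{s,t}\otimes K_{s,s+\tau}=\theta^{s,t}\otimes
    K_{t,t+\tau}$. The forward direction feeds weak duality, the converse makes the representing law
    homogeneous. *)
Lemma hom_term_test (Q : probability X R) (K : nat -> nat -> R.-pker R ~> R) s t tau :
  in_Pi mu Q -> inDelta T s t tau ->
  disintegrates Q s (s + tau) (K s (s + tau)) ->
  disintegrates Q t (t + tau) (K t (t + tau)) ->
  ae_wedge (marginal Q s) (marginal Q t)
    (fun y => forall B, measurable B -> K s (s + tau) y B = K t (t + tau) y B) <->
  (forall g : R * R -> R, Cb g -> has_int Q (hom_term g s t tau) 0).
Proof.
move=> hPi D hKs hKt; have [sT tT _ _ _] := inDelta_bounds D.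
have [_ [Ct [Cs [thEt thEs]]]] := hA sT tT.
have mc k := @measurable_coord R T k.
have muE k : (k < T)%N -> forall A, measurable A ->
    Q ((fun x : X => coord x k) @^-1` A) = mu k A.
  by move=> kT A mA; exact: hPi.
apply: (iff_trans (ae_wedgeP hA hPi _ sT tT)); split => h.
  move=> g Cg; apply/(hom_term_zeroP Q D Cg).
  exact: (homogeneous_test (mc s) (mc _) (mc t) (mc _) hKs hKt
    (muE s sT) (muE t tT) Cs Ct thEs thEt h Cg).
apply: (test_homogeneous (mc s) (mc (s + tau)%N) (mc t) (mc (t + tau)%N) hKs hKt
    (muE s sT) (muE t tT) Cs Ct thEs thEt) => g Cg.
exact/(hom_term_zeroP Q D Cg)/h.
Qed.

Lemma weak_duality (Q : probability X R) phi r s : in_Mhom mu Q ->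
  has_int Q (fun x => phi (rowT x)) r -> dual_set phi s -> r <= s.
Proof.
move=> [[hPi [iS hmart]] [K [hK hom]]] hr [h [vt [g [[Ch [Cvt [Cg adm]]] ->]]]].
have h1 : has_int Q (hedge_static h) (\sum_(t < T) marginal_int t (h t)).
  apply: has_int_sum => t _.
  apply: (has_int_coord hPi (ltn_ord t)).
    exact: continuous_measurable_fun (Ch t (ltn_ord t)).1.
  exact: (has_int_mu (ltn_ord t) (Ch t (ltn_ord t))).
have h2 : has_int Q (hedge_dynamic vt) 0.
  have -> : 0 = \sum_(t < T.-1) 0 :> R by rewrite big1.
  apply: has_int_sum => t _.
  have tT : (t.+1 < T)%N by have := ltn_ord t; rewrite -ltnS prednK// (ltn_trans _ hT).
  have it := has_int_coord_id hPi (ltnW tT); have it1 := has_int_coord_id hPi tT.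
  split; last first.
    by apply: ((martingale_testP it it1).1 _ _ (Cvt t tT)); exact: hmart.
  have [cvt [M vtM]] := Cvt t tT.
  apply: (@integrable_bounded_mul _ _ _ Q (fun x => vt t (rowUpTo t x)) _ M).
  - have := measurableT_comp (measurable_continuous_rowT cvt) (@measurable_prefix R T t).
    by congr measurable_fun; apply/funext => x /=; rewrite rowT_prefix.
  - by move=> x; exact: vtM.
  - have := integrableB measurableT it1 it; exact: eq_integrable.
have h3 : has_int Q (hedge_hom g) 0.
  have -> : 0 = \sum_(s < T) \sum_(t < T) \sum_(tau < T | inDelta T s t tau) 0 :> R.
    by rewrite big1// => i _; rewrite big1// => j _; rewrite big1.
  apply: has_int_sum => i _; apply: has_int_sum => j _; apply: has_int_sum => k D.
  have [iT jT kT ikT jkT] := inDelta_bounds D.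
  have k0 : (0 < k)%N by case/and3P : D.
  apply: (hom_term_test hPi D (hK _ _ k0 ikT) (hK _ _ k0 jkT)).1; first exact: hom.
  exact: Cg.
have := has_int_le hr (has_intD (has_intD h1 h2) h3) adm.
by rewrite !addr0.
Qed.

Lemma dual_setD phi psi r s : dual_set phi r -> dual_set psi s ->
  dual_set (phi + psi) (r + s).
Proof.
move=> [h [vt [g [[Ch [Cvt [Cg adm]]] ->]]]] [h' [vt' [g' [[Ch' [Cvt' [Cg' adm']]] ->]]]].
have CbD (U : topologicalType) (a b : U -> R) : Cb a -> Cb b -> Cb (fun u => a u + b u).
  move=> [ca [M aM]] [cb [N bN]]; split.
    by move=> u; exact: (cvgD (ca u) (cb u)).
  by exists (M + N) => u; rewrite (le_trans (ler_normD _ _))// lerD.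
exists (fun t y => h t y + h' t y), (fun t v => vt t v + vt' t v),
  (fun s t tau p => g s t tau p + g' s t tau p); split; last first.
  rewrite -big_split/=; apply: eq_bigr => t _; apply/esym.
  have hh := has_int_mu (ltn_ord t) (Ch t (ltn_ord t)).
  have hh' := has_int_mu (ltn_ord t) (Ch' t (ltn_ord t)).
  have [_ e] := has_intD hh hh'.
  by rewrite /marginal_int e.
split; last split; last split.
- by move=> t tT; exact: ClinD (Ch t tT) (Ch' t tT).
- by move=> t tT; exact: CbD (Cvt t tT) (Cvt' t tT).
- by move=> i j k D; exact: CbD (Cg i j k D) (Cg' i j k D).
- move=> x; apply: le_trans (lerD (adm x) (adm' x)) _.
  rewrite le_eqVlt; apply/orP; left; apply/eqP.
  rewrite [LHS]addrACA [X in X + _ = _]addrACA -!big_split/=.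
  congr (_ + _ + _).
    by apply: eq_bigr => t _; rewrite mulrDl.
  apply: eq_bigr => i _; rewrite -big_split/=; apply: eq_bigr => j _.
  by rewrite -big_split/=; apply: eq_bigr => k _; rewrite !mulrDl; ring.
Qed.

Lemma dual_setZ c phi r : 0 < c -> dual_set phi r -> dual_set (c *: phi) (c * r).
Proof.
move=> c0 [h [vt [g [[Ch [Cvt [Cg adm]]] ->]]]].
have CbZ (U : topologicalType) (a : U -> R) : Cb a -> Cb (fun u => c * a u).
  move=> [ca [M aM]]; split; first by move=> u; exact: (cvgM (cvg_cst c) (ca u)).
  by exists (c * M) => u; rewrite normrM gtr0_norm// ler_wpM2l// ltW.
exists (fun t y => c * h t y), (fun t v => c * vt t v),
  (fun s t tau p => c * g s t tau p); split; last first.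
  rewrite mulr_sumr; apply: eq_bigr => t _; apply/esym.
  have [_ e] := has_intZ c (has_int_mu (ltn_ord t) (Ch t (ltn_ord t))).
  by rewrite /marginal_int e.
split; last split; last split.
- by move=> t tT; exact: (@ClinZ _ _ c _ (Ch t tT)).
- by move=> t tT; exact: CbZ (Cvt t tT).
- by move=> i j k D; exact: CbZ (Cg i j k D).
- move=> x; apply: le_trans (ler_wpM2l (ltW c0) (adm x)) _.
  rewrite le_eqVlt; apply/orP; left; apply/eqP.
  rewrite 2!mulrDr !mulr_sumr; congr (_ + _ + _).
    by apply: eq_bigr => t _; rewrite mulrA.
  apply: eq_bigr => i _; rewrite mulr_sumr; apply: eq_bigr => j _.
  by rewrite mulr_sumr; apply: eq_bigr => k _; ring.
Qed.

End duality.

Section pick.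
Context {R : realType}.

Lemma sum_pick_nat n k (F : nat -> R) : (k < n)%N ->
  \sum_(i < n) (if (i : nat) == k then F i else 0) = F k.
Proof.
move=> kn; rewrite (bigD1 (Ordinal kn))//= eqxx big1 ?addr0// => i ik.
by rewrite ifN//; apply: contra ik => /eqP ik; apply/eqP/val_inj.
Qed.

End pick.

(** * Dual bounds for particular functions, and linear growth *)

Section dual_elements.
Context {R : realType} {T : nat}.
Hypothesis hT : (2 <= T)%N.
Variable mu : nat -> probability R R.
Hypothesis hmom : forall t, (t < T)%N -> finite_first_moment (mu t).
Variables (theta : nat -> nat -> {finite_measure set R -> \bar R}).
Variables (dth_s dth_t : nat -> nat -> R -> R).
Hypothesis hA : assumptionA T mu theta dth_s dth_t.

Notation V := 'rV[R]_T.
Notation X := (T.-tuple R).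
Local Notation dual_set := (@dual_set R T mu dth_s dth_t).
Local Notation hom_term := (@hom_term R T dth_s dth_t).
Local Notation marginal_int := (marginal_int mu).

Let Cb0 (U : topologicalType) : Cb ((fun=> 0) : U -> R).
Proof. by split; [exact: cst_continuous|exists 0 => u; rewrite normr0]. Qed.

Let Clin0 : Clin ((fun=> 0) : R -> R).
Proof. exact: Clin_cst. Qed.

Let marginal_int0 t : marginal_int t (fun=> 0) = 0.
Proof. by have [_ e] := has_int0 (mu t); rewrite /marginal_int e. Qed.

Lemma dual_set_static (h : nat -> R -> R) (phi : V -> R) :
  (forall t, (t < T)%N -> Clin (h t)) ->
  (forall x : X, phi (rowT x) <= \sum_(t < T) h t (coord x t)) ->
  dual_set phi (\sum_(t < T) marginal_int t (h t)).
Proof.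
move=> Ch adm; exists h, (fun _ _ => 0), (fun _ _ _ _ => 0); split => //.
split => //; split; first by move=> *; exact: Cb0.
split; first by move=> *; exact: Cb0.
move=> x; apply: le_trans (adm x) _; rewrite -addrA lerDl.
rewrite big1 ?add0r; last by move=> i _; rewrite mul0r.
rewrite big1// => i _; rewrite big1// => j _; rewrite big1// => k _.
by rewrite !mul0r subrr.
Qed.

Lemma dual_set0 (phi : V -> R) : (forall v, phi v <= 0) -> dual_set phi 0.
Proof.
move=> h; have -> : 0 = \sum_(t < T) marginal_int t (fun=> 0).
  by rewrite big1.
by apply: (dual_set_static (h := fun _ _ => 0)) => // x; rewrite big1.
Qed.

Lemma dual_set_coord t h : (t < T)%N -> Clin h ->
  dual_set (fun v => h (coord (row_tuple v) t)) (marginal_int t h).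
Proof.
move=> tT Ch; pose h' k := if k == t then h else fun=> 0.
have -> : marginal_int t h = \sum_(k < T) marginal_int k (h' k).
  rewrite -(sum_pick_nat (fun k => marginal_int k h) tT).
  by apply: eq_bigr => k _; rewrite /h'; case: ifP.
apply: dual_set_static => [k kT|x]; first by rewrite /h'; case: ifP.
rewrite rowTK -(sum_pick_nat (fun k => h (coord x k)) tT).
by apply: ler_sum => k _; rewrite /h'; case: ifP.
Qed.

Lemma dual_set_martingale t (vt : 'rV[R]_t.+1 -> R) : (t.+1 < T)%N -> Cb vt ->
  dual_set (fun v => vt (rowUpTo t (row_tuple v)) *
    (coord (row_tuple v) t.+1 - coord (row_tuple v) t)) 0.
Proof.
move=> tT Cvt.
(* The row is resized because [k == t] does not identify the two domains. *)
pose w k (v : 'rV[R]_k.+1) : R :=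
  if k == t then vt (\row_(i < t.+1) v ord0 (inord i)) else 0.
have wt : w t = vt.
  apply/funext => v; rewrite /w eqxx; congr vt; apply/rowP => i.
  by rewrite mxE inord_val.
have w0 k : k != t -> w k = fun=> 0.
  by move=> /negbTE kt; apply/funext => v; rewrite /w kt.
exists (fun _ _ => 0), w, (fun _ _ _ _ => 0); split; last by rewrite big1.
split => //; split.
  move=> k kT; have [->|kt] := eqVneq k t; first by rewrite wt.
  by rewrite w0//; exact: Cb0.
split; first by move=> *; exact: Cb0.
move=> x; rewrite rowTK.
have tT1 : (t < T.-1)%N by rewrite -ltnS prednK// (ltn_trans _ hT).
have -> : \sum_(k < T.-1) w k (rowUpTo k x) * (coord x k.+1 - coord x k) =
    w t (rowUpTo t x) * (coord x t.+1 - coord x t).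
  rewrite (bigD1 (Ordinal tT1))//= big1 ?addr0// => i it.
  rewrite w0 ?mul0r//; apply: contra it => /eqP it; exact/eqP/val_inj.
rewrite wt big1// add0r lerDl big1// => i _; rewrite big1// => j _.
by rewrite big1// => k _; rewrite !mul0r subrr.
Qed.

Lemma dual_set_homogeneous s t tau g : inDelta T s t tau -> Cb g ->
  dual_set (fun v => hom_term g s t tau (row_tuple v)) 0.
Proof.
move=> D Cg; have [sT tT kT _ _] := inDelta_bounds D.
pose g' i j k : R * R -> R :=
  if i == s then if j == t then if k == tau then g else fun=> 0 else fun=> 0
  else fun=> 0.
exists (fun _ _ => 0), (fun _ _ => 0), g'; split; last by rewrite big1.
split => //; split; first by move=> *; exact: Cb0.
split.
  move=> i j k _; rewrite /g'; do 3 (case: ifP => _; last exact: Cb0).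
  exact: Cg.
move=> x; rewrite rowTK big1// add0r big1 ?add0r; last by move=> i _; rewrite mul0r.
have h0 i j k : hom_term (fun=> 0) i j k x = 0.
  have : 0 * dth_s i j (coord x i) - 0 * dth_t i j (coord x j) = 0.
    by rewrite !mul0r subrr.
  exact.
rewrite le_eqVlt; apply/orP; left; apply/eqP; apply/esym.
transitivity (\sum_(i < T) if (i : nat) == s then
    \sum_(j < T) (if (j : nat) == t then
      \sum_(k < T) if (k : nat) == tau then hom_term g i j k x else 0 else 0) else 0).
  apply: eq_bigr => i _; rewrite -/(hom_term _ _ _ _ _).
  case: ifP => [/eqP ei|ei]; last first.
    rewrite big1// => j _; rewrite big1// => k _.
    by rewrite /g' ei; exact: h0.
  apply: eq_bigr => j _; case: ifP => [/eqP ej|ej]; last first.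
    rewrite big1// => k _; rewrite /g' ej ei eqxx; exact: h0.
  rewrite big_mkcond; apply: eq_bigr => k _; case: ifP => [Dk|Dk].
    rewrite /g' ei ej !eqxx; case: ifP => _ //; exact: h0.
  case: ifP => // /eqP ek; move: Dk; by rewrite ei ej ek D.
rewrite (@sum_pick_nat R T s (fun i => \sum_(j < T) (if (j : nat) == t then
      \sum_(k < T) if (k : nat) == tau then hom_term g i j k x else 0 else 0)))//.
rewrite (@sum_pick_nat R T t (fun j =>
      \sum_(k < T) if (k : nat) == tau then hom_term g s j k x else 0))//.
exact: (@sum_pick_nat R T tau (fun k => hom_term g s t k x)).
Qed.

Lemma Clin_linear (C : R) : Clin (fun y : R => C * (1 + `|y|)).
Proof.
split; last by exists `|C| => y; rewrite normrM (ger0_norm (addr_ge0 _ _)).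
move=> y; apply: (cvgM (cvg_cst (C : R))).
exact: (cvgD (cvg_cst (1 : R)) (@norm_continuous _ R^o y)).
Qed.

(** Rows carry the maximum norm, attained at some coordinate as $T>0$. A function of linear growth
    is thus dominated by a purely static position, which gives a dual candidate, integrability under
    every coupling, and the dominating function of the representation. *)
Lemma Clin_sum_bound (phi : V -> R) : Clin phi -> exists2 C, 0 <= C &
  forall v, `|phi v| <= \sum_(t < T) C * (1 + `|coord (row_tuple v) t|).
Proof.
move=> /Clin_bound[C C0 hC]; exists C => // v.
have [k kT vk] := norm_row_attained v (ltn_trans (ltn0Sn 0) hT).
apply: le_trans (hC v) _; rewrite (bigD1 (Ordinal kT))//=.
rewrite -[leLHS]addr0 lerD//; first by rewrite ler_wpM2l// lerD2l.
by apply: sumr_ge0 => i _; rewrite mulr_ge0// addr_ge0.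
Qed.

Lemma dual_set_nonempty phi : Clin phi -> dual_set phi !=set0.
Proof.
move=> /Clin_sum_bound[C C0 hC].
exists (\sum_(t < T) marginal_int t (fun y => C * (1 + `|y|))).
apply: (dual_set_static (h := fun _ y => C * (1 + `|y|))) => [t _|x].
  exact: Clin_linear.
by have := hC (rowT x); rewrite rowTK; apply: le_trans; exact: ler_norm.
Qed.

Lemma has_int_Clin (Q : probability X R) (phi : V -> R) : in_Pi mu Q -> Clin phi ->
  has_int Q (fun x => phi (rowT x)) (fine (\int[Q]_x (phi (rowT x))%:E)%E).
Proof.
move=> hPi Cphi; have [C C0 hC] := Clin_sum_bound Cphi.
apply: has_int_fine.
have [I _] : has_int Q (fun x : X => \sum_(t < T) C * (1 + `|coord x t|))
    (\sum_(t < T) marginal_int t (fun y => C * (1 + `|y|))).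
  apply: has_int_sum => t _.
  apply: (has_int_coord (h := fun y => C * (1 + `|y|)) hPi (ltn_ord t)).
    exact: continuous_measurable_fun (Clin_linear C).1.
  exact (@has_int_mu R T mu hmom t _ (ltn_ord t) (Clin_linear C)).
apply: (le_integrable measurableT _ _ I).
  by apply/measurable_EFinP; exact: measurable_continuous_rowT Cphi.1.
move=> x _ /=; rewrite lee_fin; have := hC (rowT x); rewrite rowTK => /le_trans; apply.
exact: ler_norm.
Qed.

Lemma Clin_martingale_term t (vt : 'rV[R]_t.+1 -> R) : Cb vt ->
  Clin (fun v : V => vt (rowUpTo t (row_tuple v)) *
    (coord (row_tuple v) t.+1 - coord (row_tuple v) t)).
Proof.
move=> [cvt [M vtM]]; split.
  move=> v; have Fv : Filter (nbhs v) by exact: nbhs_filter.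
  apply: cvgM; last first.
    exact: (cvgB (@continuous_coord_row R T t.+1 v) (@continuous_coord_row R T t v)).
  have c := @continuous_rowUpTo R T t v.
  exact: (cvg_comp _ _ c (cvt _)).
exists (M * 2) => v; rewrite normrM -mulrA ler_pM//.
apply: le_trans (ler_normB _ _) _.
have h1 := norm_coord_row_tuple v t.+1; have h2 := norm_coord_row_tuple v t.
by lra.
Qed.

(** Continuity and boundedness of the densities in (A) bring these instruments into the domain of
    [L]. *)
Lemma Clin_hom_term s t tau (g : R * R -> R) : inDelta T s t tau -> Cb g ->
  Clin (fun v : V => hom_term g s t tau (row_tuple v)).
Proof.
move=> D [cg [M gM]]; have [[cs [Ms hs]] [ct [Mt ht]]] := assumptionA_Cb hA D.
have cgc i j : continuous (fun v : V => g (coord (row_tuple v) i, coord (row_tuple v) j)).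
  move=> v; have c : (coord (row_tuple w) i, coord (row_tuple w) j) @[w --> v] -->
      (coord (row_tuple v) i, coord (row_tuple v) j).
    have Fv : Filter (nbhs v) by exact: nbhs_filter.
    exact: (cvg_pair (F := nbhs v) (@continuous_coord_row R T i v)
      (@continuous_coord_row R T j v)).
  exact: (cvg_comp _ _ c (cg _)).
apply: (@Clin_bounded _ _ _ (M * Ms + M * Mt)).
  have cM i j dd : continuous dd -> continuous (fun v : V =>
      g (coord (row_tuple v) i, coord (row_tuple v) j) * dd (coord (row_tuple v) i)).
    by move=> cdd v; exact: (cvgM (cgc i j v) (@continuous_coord_comp R T i dd cdd v)).
  by move=> v; exact: (cvgB (cM s (s + tau)%N _ cs v) (cM t (t + tau)%N _ ct v)).
move=> v; apply: le_trans (ler_normB _ _) _.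
by rewrite !normrM lerD// ler_pM.
Qed.

End dual_elements.

(** * Representation of the dual functional *)

Section representation.
Context {R : realType} {T : nat}.
Hypothesis hT : (2 <= T)%N.
Variable mu : nat -> probability R R.
Hypothesis hmom : forall t, (t < T)%N -> finite_first_moment (mu t).
Variables (theta : nat -> nat -> {finite_measure set R -> \bar R}).
Variables (dth_s dth_t : nat -> nat -> R -> R).
Hypothesis hA : assumptionA T mu theta dth_s dth_t.

Notation V := 'rV[R]_T.
Notation X := (T.-tuple R).
Local Notation dual_set := (@dual_set R T mu dth_s dth_t).
Local Notation hom_term := (@hom_term R T dth_s dth_t).
Local Notation marginal_int := (marginal_int mu).

Variable L : (V -> R) -> R.
Hypothesis LD : forall f g, Clin f -> Clin g -> L (f + g) = L f + L g.
Hypothesis LZ : forall c f, Clin f -> L (c *: f) = c * L f.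
Hypothesis L_le : forall f r, Clin f -> dual_set f r -> L f <= r.

Let LN f : Clin f -> L (- f) = - L f.
Proof. by move=> cf; rewrite -scaleN1r LZ// mulN1r. Qed.

Let ClinN f : Clin f -> Clin (- f : V -> R).
Proof. by move=> cf; rewrite -scaleN1r; exact: ClinZ. Qed.

Let LB f g : Clin f -> Clin g -> L (f - g) = L f - L g.
Proof. by move=> cf cg; rewrite LD ?LN//; exact: ClinN. Qed.

Let L_ge0 f : Clin f -> (forall v, 0 <= f v) -> 0 <= L f.
Proof.
move=> cf f0; rewrite -oppr_le0 -LN//; apply: L_le; first exact: ClinN.
by apply: dual_set0 => v; rewrite [leLHS](_ : _ = - f v)// oppr_le0.
Qed.

(** A function of one coordinate is its own static hedge; applied to $h$ and to $-h$, this gives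
    both inequalities. *)
Let L_coord t h : (t < T)%N -> Clin h ->
  L (fun v => h (coord (row_tuple v) t)) = marginal_int t h.
Proof.
move=> tT Ch; apply/eqP; rewrite eq_le; apply/andP; split.
  by apply: L_le; [exact: Clin_coord|exact: dual_set_coord].
have ChN : Clin (- h) by rewrite -scaleN1r; exact: ClinZ.
have : L (fun v => (- h) (coord (row_tuple v) t)) <= marginal_int t (- h).
  by apply: L_le; [exact: Clin_coord|exact: dual_set_coord].
rewrite [X in L X](_ : _ = - (fun v => h (coord (row_tuple v) t)))//.
rewrite LN; last exact: Clin_coord.
have e1 := has_intZ (- 1) (has_int_mu hmom tT Ch).
have e2 := has_int_mu hmom tT ChN.
have e3 : (fun y => - 1 * h y) = - h by apply/funext => y; rewrite mulN1r.
rewrite e3 in e1; rewrite -(has_int_unique e1 e2) mulN1r lerN2; exact.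
Qed.

Let marginal_int_cst t c : marginal_int t (fun=> c) = c.
Proof. by have [_ e] := has_int_cst (mu t) c; rewrite /marginal_int e. Qed.

Let T0 : (0 < T)%N. Proof. exact: leq_trans hT. Qed.

Let L_cst c : L (fun=> c) = c.
Proof.
rewrite -[RHS](marginal_int_cst 0 c).
by rewrite -(@L_coord 0 (fun=> c))//; exact: Clin_cst.
Qed.

Let L_sum (h : nat -> R -> R) : (forall t, (t < T)%N -> Clin (h t)) ->
  Clin (fun v : V => \sum_(t < T) h t (coord (row_tuple v) t)) /\
  L (fun v => \sum_(t < T) h t (coord (row_tuple v) t)) =
    \sum_(t < T) marginal_int t (h t).
Proof.
move=> Ch; rewrite -(fct_sumE _ _ (fun (t : 'I_T) (v : V) => h t (coord (row_tuple v) t))).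
elim/big_ind2: _ => //.
- by split; [exact: Clin_cst|exact: L_cst].
- by move=> f r g s [cf <-] [cg <-]; split; [exact: ClinD|exact: LD].
- move=> t _; have tT := ltn_ord t; split; first exact: Clin_coord (Ch _ tT).
  exact: L_coord (Ch _ tT).
Qed.

Let tail k (y : R) : R := Num.max (`|y| - k%:R) 0.

Let tail_le k y : `|tail k y| <= `|y|.
Proof.
rewrite /tail; have [h|h] := leP (`|y| - k%:R) 0; first by rewrite normr0.
by rewrite gtr0_norm// lerBlDr lerDl.
Qed.

Let tail_cont k : continuous (tail k).
Proof.
apply: (@max_fun_continuous _ _ _ (fun y : R => `|y| - k%:R) (fun=> 0)).
  by move=> y; exact: (cvgB (@norm_continuous _ R^o y) (cvg_cst (k%:R : R))).
exact: cst_continuous.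
Qed.

Let tail_Clin k : Clin (tail k).
Proof.
split; first exact: tail_cont.
by exists 1 => y; rewrite mul1r (le_trans (tail_le k y))// lerDr.
Qed.

Let tail_cvg t : (t < T)%N -> marginal_int t (tail k) @[k --> \oo] --> 0.
Proof.
move=> tT; apply: fine_cvg.
rewrite -[X in _ --> X](integral0 (mu t) setT).
apply: (@dominated_cvg _ _ _ (mu t) setT measurableT
  (fun k y => (tail k y)%:E) (cst 0%E) (fun y : R => (`|y|)%:E)) => //.
- by move=> k; apply/measurable_EFinP; exact: continuous_measurable_fun (tail_cont (k := k)).
- move=> y _; apply: cvg_near_cst; near=> k.
  rewrite /tail max_r// subr_le0; apply: ltW; near: k; exact: nbhs_infty_gtr.
- exact: integrable_norm (hmom tT).
- by move=> k y _; rewrite lee_fin tail_le.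
Unshelve. all: by end_near. Qed.

Let tails_cvg : \sum_(t < T) marginal_int t (tail k) @[k --> \oo] --> 0.
Proof.
suff h : (\sum_(t < T) (fun k => marginal_int t (tail k))) @ \oo --> \sum_(t < T) (0 : R).
  rewrite [X in _ --> X]big1// in h.
  rewrite (_ : (fun k => _) = \sum_(t < T) (fun k => marginal_int t (tail k)))//.
  by apply/funext => k; rewrite fct_sumE.
apply: (big_ind2 (fun (f : nat -> R) (r : R) => f @ \oo --> r)) => //.
  exact: cvg_cst.
  by move=> f r g s; exact: cvgD.
by move=> t _; exact: tail_cvg.
Qed.

(** First moments make the integrals of $(|y|-k)^+$ vanish as $k$ grows, and [L] integrates a sum of
    such tails coordinatewise. The radius $k+1$ ensures that beyond it some coordinate contributes
    at least 1. *)
Let L_tight e : 0 < e -> exists W M, [/\ Clin W, L W <= e,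
  forall v, 0 <= W v & forall v : V, M < `|v| -> 1 <= W v].
Proof.
move=> e0.
have [k ke] : exists k, \sum_(t < T) marginal_int t (tail k) < e.
  have /cvgrPdist_lt/(_ e e0)[k _ /(_ k (leqnn k))] := tails_cvg.
  by rewrite sub0r normrN => /ltr_normlW ?; exists k.
have [CW LW] := L_sum (fun t _ => tail_Clin k).
have tail0 y : 0 <= tail k y by rewrite /tail le_max lexx orbT.
exists (fun v => \sum_(t < T) tail k (coord (row_tuple v) t)), (k%:R + 1).
split => //; first by rewrite LW ltW.
  by move=> v; exact: sumr_ge0.
move=> v kv; have [j jT vj] := norm_row_attained v T0.
rewrite (bigD1 (Ordinal jT))//= -[leLHS]addr0 lerD//; last exact: sumr_ge0.
by rewrite le_max lerBrDr (le_trans _ vj)// addrC ltW.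
Qed.

Section law.
Variable Q : probability X R.
Hypothesis Q_le : forall f, Clin f -> (forall v, 0 <= f v) ->
  (\int[Q]_x (f (rowT x))%:E <= (L f)%:E)%E.

(** Both $H+\phi$ and $H-\phi$ are nonnegative, so the one-sided bound applies to each; as $H$ is
    integrated exactly it cancels and leaves two opposite inequalities for $\phi$. *)
Let sandwich (H phi : V -> R) : Clin H -> has_int Q (fun x => H (rowT x)) (L H) ->
  Clin phi -> (forall v, `|phi v| <= H v) ->
  has_int Q (fun x => phi (rowT x)) (L phi).
Proof.
move=> CH hH Cphi pH.
have hp : has_int Q (fun x => phi (rowT x)) (fine (\int[Q]_x (phi (rowT x))%:E)%E).
  apply: has_int_fine; apply: (le_integrable measurableT _ _ hH.1).
    by apply/measurable_EFinP; exact: measurable_continuous_rowT Cphi.1.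
  by move=> x _ /=; rewrite lee_fin (le_trans (pH _))// ler_norm.
suff <- : fine (\int[Q]_x (phi (rowT x))%:E)%E = L phi by [].
set r := fine _ in hp *; apply/eqP; rewrite eq_le; apply/andP; split.
- have : (\int[Q]_x ((H + phi) (rowT x))%:E <= (L (H + phi))%:E)%E.
    apply: Q_le; first exact: ClinD.
    move=> v; rewrite [leRHS](_ : _ = H v + phi v)//.
    by have := pH v; rewrite ler_norml => /andP[]; lra.
  by have [_ ->] := has_intD hH hp; rewrite LD// lee_fin lerD2l.
- have : (\int[Q]_x ((H - phi) (rowT x))%:E <= (L (H - phi))%:E)%E.
    apply: Q_le; first exact: ClinB.
    move=> v; rewrite [leRHS](_ : _ = H v - phi v)//.
    by have := pH v; rewrite ler_norml => /andP[]; lra.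
  by have [_ ->] := has_intB hH hp; rewrite LB// lee_fin lerD2l lerN2.
Qed.

(** At this stage only constants are known to be integrated exactly, because $Q$ is a probability.
    The dominating function 1 reaches bounded functions, and these determine the marginals. *)
Let hPi : in_Pi mu Q.
Proof.
apply: in_Pi_test => t tT h ch h01.
have h1 y : `|h y| <= 1 by have /andP[a b] := h01 y; rewrite ger0_norm.
have Ch : Clin h by exact: (@Clin_bounded _ _ _ 1).
have h1c : has_int Q (fun x => (fun=> 1 : R) (rowT x)) (L (fun=> 1)).
  by rewrite L_cst; exact: has_int_cst.
have [_] := sandwich (@Clin_cst _ _ 1) h1c (@Clin_coord _ T t _ Ch) (fun v => h1 _).
rewrite L_coord//; have [_ ->] := has_int_mu hmom tT Ch => <-.
by apply: eq_integral => x _; rewrite rowTK.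
Qed.

(** With the marginals identified, $\sum_t C(1+|x_t|)$ is integrated exactly as well, and it
    dominates every function of linear growth. *)
Let rep phi : Clin phi -> has_int Q (fun x => phi (rowT x)) (L phi).
Proof.
move=> Cphi; have [C C0 pC] := Clin_sum_bound hT Cphi.
have Cl : Clin (fun y : R => C * (1 + `|y|)) by exact: Clin_linear.
have [CH LH] := L_sum (h := fun _ y => C * (1 + `|y|)) (fun _ _ => Cl).
apply: (sandwich CH) => //; rewrite LH.
apply: has_int_sum => t _; rewrite (_ : (fun x => _) = fun x : X => C * (1 + `|coord x t|)).
  apply: (has_int_coord (h := fun y => C * (1 + `|y|)) hPi (ltn_ord t)).
    exact: continuous_measurable_fun Cl.1.
  exact (@has_int_mu R T mu hmom t _ (ltn_ord t) Cl).
by apply/funext => x; rewrite rowTK.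
Qed.

Let L0P phi : Clin phi -> dual_set phi 0 -> dual_set (- phi) 0 -> L phi = 0.
Proof.
move=> Cphi d1 d2; apply/eqP; rewrite eq_le L_le//=.
by rewrite -oppr_le0 -LN// L_le//; exact: ClinN.
Qed.

Let CbN (U : topologicalType) (h : U -> R) : Cb h -> Cb (fun u => - h u).
Proof.
move=> [ch [M hM]]; split; first by move=> u; exact: (cvgN (ch u)).
by exists M => u; rewrite normrN.
Qed.

Lemma representing_law : in_Mhom mu Q /\
  forall phi, Clin phi -> has_int Q (fun x => phi (rowT x)) (L phi).
Proof.
split; last exact: rep.
have ic t : (t < T)%N -> Q.-integrable setT (fun x => (coord x t)%:E).
  by move=> tT; exact: (has_int_coord_id hmom hPi tT).
split.
  split => //; split => // t tT.
  apply: (martingale_testP (ic t (ltnW tT)) (ic _ tT)).2 => vt Cvt.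
  have Cphi := @Clin_martingale_term R T t vt Cvt.
  have [_] := rep Cphi; rewrite (L0P Cphi (dual_set_martingale hT mu dth_s dth_t tT Cvt)).
    by move=> e; rewrite -[RHS]e; apply: eq_integral => x _; rewrite rowTK.
  have := dual_set_martingale hT mu dth_s dth_t tT (CbN Cvt).
  by congr (dual_set _ 0); apply/funext => v; rewrite mulNr.
(* Kernels are chosen separately for each pair of times; their compatibility is then read off the
   tests by [hom_term_test]. *)
have dis s u := disintegration Q (@measurable_coord R T s) (@measurable_coord R T u).
exists (fun s u => projT1 (cid (dis s u))).
have hK s u : disintegrates Q s u (projT1 (cid (dis s u))).
  by move=> A B mA mB; exact: (projT2 (cid (dis s u))).
split=> [s tau _ _|s t tau D]; first exact: hK.
apply: (hom_term_test hA (K := fun s u => projT1 (cid (dis s u))) hPi D (hK _ _) (hK _ _)).2.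
move=> g Cg; have Cphi := Clin_hom_term hA D Cg.
have h := rep Cphi; rewrite (L0P Cphi (dual_set_homogeneous mu dth_s dth_t D Cg)) in h.
  by move: h; congr has_int; apply/funext => x; rewrite rowTK.
have <- : (fun v : V => hom_term (fun u => - g u) s t tau (row_tuple v)) =
    - (fun v : V => hom_term g s t tau (row_tuple v)).
  apply/funext => v; apply: (etrans (y := - g _ * _ - - g _ * _)) => //.
  by rewrite !mulNr -opprD.
exact (dual_set_homogeneous mu dth_s dth_t D (CbN Cg)).
Qed.

End law.

Lemma representation : exists2 Q : probability X R, in_Mhom mu Q &
  forall phi, Clin phi -> has_int Q (fun x => phi (rowT x)) (L phi).
Proof.
have [Q hQ] := daniell LD LZ L_ge0 (L_cst 1) L_tight.
by have [] := representing_law hQ; exists Q.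
Qed.

End representation.

(** * Strong duality and attainment *)

Theorem theorem3p3 (R : realType) (T : nat) (hT : (2 <= T)%N)
    (mu : nat -> probability R R)
    (hmom : forall t, (t < T)%N -> finite_first_moment (mu t))
    (f : 'rV[R]_T -> R) (hf : Clin f)
    (hne : exists Q : probability (T.-tuple R) R, in_Mhom mu Q)
    (theta : nat -> nat -> {finite_measure set R -> \bar R})
    (dth_s dth_t : nat -> nat -> R -> R)
    (hA : assumptionA T mu theta dth_s dth_t) :
  exists Q0 : probability (T.-tuple R) R,
    in_Mhom mu Q0 /\
    (forall Q : probability (T.-tuple R) R, in_Mhom mu Q ->
       (primal_value f Q <= primal_value f Q0)%E) /\
    primal_value f Q0 =
      ereal_inf [set v : \bar R | exists h vt g,
        dual_admissible f dth_s dth_t h vt g /\ v = dual_value T mu h].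
Proof.
pose D phi := @dual_set R T mu dth_s dth_t phi.
pose p phi := inf (D phi).
have [Q1 hQ1] := hne.
have weak Q phi r : in_Mhom mu Q -> Clin phi -> D phi r ->
    fine (\int[Q]_x (phi (rowT x))%:E)%E <= r.
  move=> hQ Cphi; apply: (weak_duality hT hmom hA hQ).
  exact: (has_int_Clin hT hmom hQ.1.1 Cphi).
have D0 phi : Clin phi -> D phi !=set0 by move=> Cphi; exact: dual_set_nonempty.
have Dlb phi : Clin phi -> has_lbound (D phi).
  by move=> Cphi; exists (fine (\int[Q1]_x (phi (rowT x))%:E)%E) => r; exact: weak.
have p_le phi r : Clin phi -> D phi r -> p phi <= r.
  by move=> Cphi; apply: ge_inf; exact: Dlb.
have p_eps phi e : Clin phi -> 0 < e -> exists2 r, D phi r & r < p phi + e.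
  by move=> Cphi e0; apply: inf_adherent => //; split; [exact: D0|exact: Dlb].
have sp : sublinear_on [set phi : 'rV[R]_T -> R | Clin phi] p.
  split=> [u v Cu Cv|c u c0 Cu].
    apply/ler_addgt0Pr => e e0; have e2 : 0 < e / 2 by rewrite divr_gt0.
    have [r Dr rp] := p_eps u _ Cu e2; have [s Ds sp] := p_eps v _ Cv e2.
    have := p_le _ _ (ClinD Cu Cv) (dual_setD hmom Dr Ds); lra.
  rewrite -ler_pdivrMl//; apply: lb_le_inf; first exact: D0.
  move=> r Dr; rewrite ler_pdivrMl//; apply: p_le; first exact: ClinZ.
  exact: dual_setZ.
have [L [LD LZ Lp Lf]] := hahn_banach (fun u v => @ClinD R _ u v)
  (fun c u => @ClinZ R _ c u) sp hf.
have L_le phi r : Clin phi -> D phi r -> L phi <= r.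
  by move=> Cphi Dr; rewrite (le_trans (Lp _ Cphi))// p_le.
have [Q hQ repQ] := representation hT hmom hA LD LZ L_le.
have fQ : primal_value f Q = (p f)%:E by rewrite -Lf; exact: (repQ f hf).2.
exists Q; split => //; split; last first.
  (* The set of dual values of $f$ is nonempty and bounded below, so its real infimum is also the
     infimum in the extended reals. *)
  rewrite fQ; have <- := ereal_inf_EFin (Dlb f hf) (D0 f hf).
  congr ereal_inf; apply/seteqP; split=> [_ [_ [h [vt [g [adm ->]]]] <-]|_ [h [vt [g [adm ->]]]]].
    by exists h, vt, g; split => //; rewrite (dual_valueE hmom adm).
  exists (\sum_(t < T) marginal_int mu t (h t)); last by rewrite (dual_valueE hmom adm).
  by exists h, vt, g.
move=> Q' hQ'; have [_ e] := has_int_Clin hT hmom hQ'.1.1 hf.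
rewrite fQ /primal_value e lee_fin; apply: lb_le_inf; first exact: D0.
by move=> r; exact: weak.
Qed.
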